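(* Let $\Pi=(\pi_n)_{n\in\mathbb{N}}$ be a sequence of partitions of $\mathbb{R}_{\ge 0}$ with $|\pi_n|\to 0$. (i) Let $X\in QV(\Pi)$ satisfy $X_0=a$ and $X_t\wedge X_{t-}>0$ for all $t\ge 0$. Suppose that its running maximum $\overline{X}$ is continuous. Consider a function $w:[a^*,\infty[\to\mathbb{R}$ of class $C^1$ satisfying $y-w(y)>0$ for all $y\in[a^*,\infty[$. Moreover, define $$V(y)=a\exp\Big(\int_{[a^*,y]}\frac{1}{s-w(s)}\,ds\Big),\qquad y\in[a^*,\infty[,$$ and $U=V^{-1}$. Then $M^U(X)$ is the unique solution $Y$ of $$(\ast)\qquad Y_t=a^*+\int_0^t\frac{Y_{s-}-w(\overline{Y}_s)}{X_{s-}}\,dX_s,\qquad t\ge0,$$ that satisfies the $w$-drawdown constraint and has continuous running maximum. (ii) Let $a$, $a^*$, $w$ and $V$ be as in (i), and let $Y\in QV(\Pi)$. Suppose that $Y$ satisfies the $w$-drawdown constraint, $Y_0=a^*$, and its running maximum is continuous. Then $X_t=M^V_t(Y)$ is the unique càdlàg path of $QV(\Pi)$ such that $\overline{X}$ is continuous, $X_0=a$, and $X$ satisfies $(\ast)$.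
   Context: Conventions. A càdlàg path is a function on $\mathbb{R}_{\ge 0}$ that is right continuous with finite left limits; $X_{0-}=X_0$, $\Delta X_t=X_t-X_{t-}$. The running maximum of a real càdlàg path is $\overline{X}_t=\sup_{0\le s\le t}X_s$. A partition is $\pi=(t_i)_{i\in\mathbb{N}}$ with $0=t_0<t_1<\cdots\to\infty$, and $|\pi|=\sup_i|t_{i+1}-t_i|$. Quadratic variation. A real càdlàg path $X$ has quadratic variation along $\Pi=(\pi_n)$ if $t\mapsto\sum_{t_i\in\pi_n}(X_{t_{i+1}\wedge t}-X_{t_i\wedge t})^2$ converges pointwise to a càdlàg increasing function $[X,X]$ with $\Delta[X,X]_t=(\Delta X_t)^2$ for all $t\ge0$. $QV(\Pi)$ is the set of such paths. $FV_{\mathrm{loc}}$ is the set of real càdlàg paths of locally finite variation. Itô–Föllmer integral. For a real càdlàg path $\xi$ and $X\in QV(\Pi)$, $\int_0^t\xi_{s-}\,dX_s:=\lim_{n\to\infty}\sum_{t_i\in\pi_n}\xi_{t_i}(X_{t_{i+1}\wedge t}-X_{t_i\wedge t})$, if this limit exists and is finite. The integral in $(\ast)$ is the Itô–Föllmer integral of $\xi=(Y-w(\overline{Y}))/X$ with respect to $X$. Admissible integrands. A function $f(b,x)$ on an open $D\subset\mathbb{R}^m\times\mathbb{R}$ is of class $C^{1,2}$ if it is once continuously differentiable in $b$ and twice in $x$, with all these derivatives continuous in $(b,x)$ jointly. A real càdlàg path $\xi$ is an admissible integrand of $X\in QV(\Pi)$ if for any $T>0$ there exist $m\in\mathbb{N}$,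 an open $D\subset\mathbb{R}^m\times\mathbb{R}$, a real function $f$ of class $C^{1,2}$ on $D$, and $A\in FV_{\mathrm{loc}}^m$ such that $\xi_t=\frac{\partial f}{\partial x}(A_t,X_t)$ for all $t\in[0,T]$ and the image of $[0,T]\ni t\mapsto(A_t,X_t)\in D$ is relatively compact in $D$. Solutions. A solution of $(\ast)$ (for given $X$) means an admissible integrand $Y$ of $X$ that satisfies equation $(\ast)$. Azéma–Yor paths. For $X\in QV(\Pi)$ with $X_0=a$ and continuous running maximum, and a $C^2$ function $U:[a,\infty[\to\mathbb{R}$ (right derivatives at $a$), the Azéma–Yor path associated with $U$ and $X$ is $M^U_t(X)=U(\overline{X}_t)-U'(\overline{X}_t)(\overline{X}_t-X_t)$. The same formula is used when $U$ is an inverse function, and likewise for $M^V(Y)$ with $V$ on $[a^*,\infty[$ and $Y_0=a^*$. Drawdown constraint. A real càdlàg path $X$ satisfies the $w$-drawdown constraint (with $w$ a real function defined on a set containing $[X_0,\infty[$) if $X_t\wedge X_{t-}>w(\overline{X}_t)$ for all $t\ge0$.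
   Formalization: In (i) the running maximum of X is assumed to stay in V([a*,∞[), since V may be bounded and M^U(X) then undefined; in (ii) ''X satisfies (∗)'' includes that Y is an admissible integrand of X and that X and its left limits never vanish, without which uniqueness fails or (∗) is undefined. *)

(* Defs.v *)
From HB Require Import structures.
From mathcomp Require Import all_boot all_order all_algebra.
From mathcomp Require Import all_classical all_reals all_analysis.

Set Implicit Arguments.
Unset Strict Implicit.
Unset Printing Implicit Defensive.

Import Order.TTheory GRing.Theory Num.Theory.
Import numFieldNormedType.Exports.

Local Open Scope classical_set_scope.
Local Open Scope ring_scope.

(* A path on [0, +oo[ is a function R -> R whose values at negative times are
   irrelevant: every notion below only looks at nonnegative times, and two
   paths are identified when they agree on [0, +oo[. *)

Section Paths.
Context {R : realType}.
Implicit Types (X Y A Q xi : R -> R) (t : R).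

Definition cadlag X : Prop :=
  (forall t, 0 <= t -> X s @[s --> t^'+] --> X t) /\
  (forall t, 0 < t -> cvg (X s @[s --> t^'-])).

(* The convention X_{0-} = X_0. *)
Definition left_lim X t : R :=
  if t == 0 then X 0 else lim (X s @[s --> t^'-]).

Definition jump X t : R := X t - left_lim X t.

Definition running_max X t : R := sup (X @` `[0, t]).

Definition continuous_running_max X : Prop :=
  {within `[0, +oo[, continuous (running_max X)}.

Definition is_partition (p : nat -> R) : Prop :=
  [/\ p 0%N = 0, forall i, p i < p i.+1 & p i @[i --> \oo] --> +oo].

Definition mesh (p : nat -> R) : \bar R :=
  ereal_sup (range (fun i => `|p i.+1 - p i|%:E)).

(* The increment X_{t_{i+1} /\ t} - X_{t_i /\ t}.  It vanishes as soon as
   t <= t_i, so the infinite sums below have finitely many nonzero terms. *)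
Definition stopped_incr (p : nat -> R) X t (i : nat) : R :=
  X (Num.min (p i.+1) t) - X (Num.min (p i) t).

Definition qv_sum (p : nat -> R) X t : R :=
  limn (series (fun i => stopped_incr p X t i ^+ 2)).

Definition riemann_sum (p : nat -> R) xi X t : R :=
  limn (series (fun i => xi (p i) * stopped_incr p X t i)).

Definition QV (Pi : nat -> nat -> R) : set (R -> R) :=
  [set X | cadlag X /\ exists Q : R -> R,
    [/\ cadlag Q,
        forall s t, 0 <= s -> s <= t -> Q s <= Q t,
        forall t, 0 <= t -> qv_sum (Pi n) X t @[n --> \oo] --> Q t
      & forall t, 0 <= t -> jump Q t = jump X t ^+ 2]].

Definition FV_loc : set (R -> R) :=
  [set A | cadlag A /\ forall T, 0 < T -> bounded_variation 0 T A].

(* [l] is the Ito-Follmer integral of xi_{s-} against X on [0, t]. *)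
Definition is_ito_follmer (Pi : nat -> nat -> R) xi X t (l : R) : Prop :=
  cadlag xi /\ riemann_sum (Pi n) xi X t @[n --> \oo] --> l.

Section C12.
Context {m : nat}.
Implicit Types (f : 'rV[R]_m * R -> R) (D : set ('rV[R]_m * R)).

Definition dir_b (j : 'I_m) : 'rV[R]_m * R := (delta_mx 0 j, 0).
Definition dir_x : 'rV[R]_m * R := (0, 1).

(* Since D is open, the conditions do not depend on f outside D. *)
Definition class_C12 D f : Prop :=
  [/\ open D,
      forall (j : 'I_m) p, D p ->
        derivable f p (dir_b j) /\ {for p, continuous ('D_(dir_b j) f)},
      forall p, D p ->
        derivable f p dir_x /\ {for p, continuous ('D_dir_x f)}
    & forall p, D p ->
        derivable ('D_dir_x f) p dir_x /\
        {for p, continuous ('D_dir_x ('D_dir_x f))}].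

Definition relatively_compact_in D (S : set ('rV[R]_m * R)) : Prop :=
  S `<=` D /\ compact (closure S `&` D).

End C12.

Definition admissible_integrand X xi : Prop :=
  cadlag xi /\ forall T, 0 < T ->
  exists (m : nat) (D : set ('rV[R]_m * R)) (f : 'rV[R]_m * R -> R)
         (A : R -> 'rV[R]_m),
    [/\ class_C12 D f,
        forall j : 'I_m, FV_loc (fun t => A t 0 j),
        forall t, 0 <= t <= T -> xi t = 'D_dir_x f (A t, X t)
      & relatively_compact_in D [set (A t, X t) | t in `[0, T]]].

Definition drawdown (w : R -> R) X : Prop :=
  forall t, 0 <= t -> w (running_max X t) < Num.min (X t) (left_lim X t).

(* The derivative of a function on [a, +oo[ (or on [a, b[): the right
   derivative at a, the usual derivative at the points x > a. *)
Definition derive_from (a : R) (F : R -> R) (x : R) : R :=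
  if x == a then lim ((F (a + h) - F a) / h @[h --> 0^'+]) else derive1 F x.

Definition C1_from (a : R) (F : R -> R) : Prop :=
  [/\ cvg ((F (a + h) - F a) / h @[h --> 0^'+]),
      forall x, a < x -> derivable F x 1
    & {within `[a, +oo[, continuous (derive_from a F)}].

(* M^U(X), for U defined on an interval with left end point a = X 0. *)
Definition azema_yor (a : R) (U X : R -> R) t : R :=
  U (running_max X t)
  - derive_from a U (running_max X t) * (running_max X t - X t).

Definition V_of (a astar : R) (w : R -> R) (y : R) : R :=
  a * expR (\int[lebesgue_measure]_(s in `[astar, y]) (s - w s)^-1).

Definition integrand (w : R -> R) X Y t : R :=
  (Y t - w (running_max Y t)) / X t.

(* Y is a solution of
     Y_t = astar + \int_0^t (Y_{s-} - w(runmax Y_s)) / X_{s-} dX_s.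
   As x / 0 = 0 here, the quotient is required to be meaningful. *)
Definition is_solution (Pi : nat -> nat -> R) (astar : R) (w : R -> R) X Y
    : Prop :=
  [/\ admissible_integrand X Y,
      forall t, 0 <= t -> X t != 0 /\ left_lim X t != 0
    & forall t, 0 <= t ->
        exists2 I : R, is_ito_follmer Pi (integrand w X Y) X t I
                     & Y t = astar + I].

End Paths.

(* Main.v *)
Require Import Defs.
From HB Require Import structures.
From mathcomp Require Import all_boot all_order all_algebra.
From mathcomp Require Import all_classical all_reals all_analysis.
From mathcomp Require Import lra ring.

(** Write y for the running maximum of Y and phi for V', so that
    V(y) = phi(y) (y - w(y)).  With this notation

      M^V(Y) = phi(y) (Y - w(y))      and      M^U(X) = w(y) + X / phi(y),

    where y = U(max X) in the second formula.  The Azema-Yor transforms are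
    thus two affine maps with coefficients driven by the maximum only, inverse
    to each other, and when X and Y correspond to each other the integrand
    (Y - w(y)) / X is simply 1 / phi(y).

    Existence.  Both transforms have the form h - g (max X - X), with
    (h, g) = (U(max X), U'(max X)) [ay_path].  The increment of such a path
    differs from g dX by at most L d(max X) (d(max X) + max X - X).  As max X is
    continuous and increases only where max X - X is small, these differences
    sum up to 0 as the mesh vanishes [null_sum, ay_sum_cvg].  Hence the Riemann
    sums of g against X converge to the increment of the path, which proves
    that M^U(X) solves the equation [ay_is_solution].  It is admissible, being
    the derivative in x of b0 x + b1 x^2 / 2 at b0 = w(y) and b1 = 1 / phi(y).
    In the other direction the transform c Y + d of Y, with c and d continuous
    of locally finite variation, must have quadratic variation: its squared increments are
    c^2 dY^2 up to terms that sum up to 0, and the sums of c^2 dY^2 converge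
    because c is continuous [QV_affine].

    Uniqueness.  Let Y solve the equation for X, let N = M^V(Y) and
    xi = (Y - w(y)) / X.  The claim is N = X, from which Y = M^U(X) follows by
    inverting the affine map.  The ratio R = N / X starts from 1, and its
    increments are (phi e + eta) / X, where e = dY - xi dX sums up to 0 by the
    equation and eta = dN - phi dY sums up to 0 as above.  However phi / X is
    not of finite variation, so a bound on the sums of |e| is needed to move
    this weight out of the sum.  Admissibility provides it: near each time
    xi has a primitive F(A, w(y), X), so that dF - xi dX, hence also
    Y - F, is controlled by the increments of the quadratic variation Q of X
    and of the variation of A and y [local_ito, sol_err_le].  With M the sum of
    these, |e| <= C (dM + dX^2), so an almost constant weight gives
    |dR| <= eps dM on a short interval on either side of each time
    [ratio_incr_le].  At a jump, the identity between the jump of Q and the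
    squared jump of X forces Y to jump by xi_- times the jump of X, so R does
    not jump [sol_jump].  Therefore |R_t - R_0| <= eps (M_t - M_0) for every
    eps [ratio_le], and R is constant.

    All the passages from short intervals to [0, T] use an induction principle
    along the reals [real_induction] together with the additivity of the sums
    along a partition, up to one subinterval [partition_sum_split]. *)

Set Implicit Arguments.
Unset Strict Implicit.
Unset Printing Implicit Defensive.

Import Order.TTheory GRing.Theory Num.Theory.
Import numFieldNormedType.Exports.

Local Open Scope classical_set_scope.
Local Open Scope ring_scope.

(** * Real induction and sums along a partition *)

Section PartitionSums.
Context {R : realType}.
Implicit Types (p : nat -> R) (e : R -> R -> R) (s t d T : R).

Lemma ltD_mono t s d d' : d <= d' -> s < t + d -> s < t + d'.
Proof. by move=> dd' /lt_le_trans; apply; rewrite lerD2l. Qed.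

Lemma ltB_mono t s d d' : d <= d' -> t - d < s -> t - d' < s.
Proof. by move=> dd'; apply: le_lt_trans; rewrite lerB. Qed.

Lemma le_ltD t s d : 0 < d -> s <= t -> s < t + d.
Proof. by move=> d0 st; rewrite (le_lt_trans st) // ltrDl. Qed.

Lemma le_ltB t s d : 0 < d -> t <= s -> t - d < s.
Proof. by move=> d0 ts; rewrite (lt_le_trans _ ts) // gtrBl. Qed.

(** The supremum of the set where P holds belongs to it by the left hypothesis,
    and cannot be smaller than T by the right one. *)
Lemma real_induction (T : R) (P : R -> Prop) : 0 <= T -> P 0 ->
  (forall t, 0 <= t -> t < T -> P t ->
     exists2 d, 0 < d & forall s, t < s -> s < t + d -> s <= T -> P s) ->
  (forall t, 0 < t -> t <= T ->
     exists2 d, 0 < d & forall s, 0 <= s -> t - d < s -> s < t -> P s -> P t) ->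
  P T.
Proof.
move=> T0 P0 right left.
pose E := [set t | 0 <= t <= T /\ P t].
have E0 : E 0 by split; rewrite ?lexx.
have supE : has_sup E by split; [exists 0|exists T => x [/andP[]]].
pose c := sup E.
have c0 : 0 <= c by exact: ub_le_sup supE.2 _ E0.
have cT : c <= T by apply: ge_sup => [|x [/andP[]]//]; exists 0.
have Pc : P c.
  have [c_gt0|] := ltP 0 c; last first.
    by move=> c_le0; have /eqP -> : c == 0 by rewrite eq_le c_le0 c0.
  have [d d0 Hd] := left c c_gt0 cT.
  have [x Ex cdx] := sup_adherent d0 supE.
  have [[/andP[x0 xT] Px]] := Ex.
  have xc : x <= c by exact: ub_le_sup supE.2 _ Ex.
  move: xc; rewrite le_eqVlt => /orP[/eqP <-//|xc].
  exact: (Hd x).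
move: cT; rewrite le_eqVlt => /orP[/eqP <-//|cT].
have [d d0 Hd] := right c c0 cT Pc.
pose s := c + Num.min (d / 2) (T - c).
have m0 : 0 < Num.min (d / 2) (T - c) by rewrite lt_min; apply/andP; split; lra.
have m1 : Num.min (d / 2) (T - c) <= d / 2 by rewrite ge_min lexx.
have m2 : Num.min (d / 2) (T - c) <= T - c by rewrite ge_min lexx orbT.
have Es : E s.
  split; first by apply/andP; split; rewrite /s; lra.
  by apply: Hd; rewrite /s; lra.
have : s <= c by exact: ub_le_sup supE.2 _ Es.
by rewrite /s; lra.
Qed.

(** The sums are meant for interval functions e that vanish on the degenerate
    intervals, so that only the subintervals that start before t contribute. *)
Definition partition_sum p e t : R :=
  limn (series (fun i => e (Num.min (p i) t) (Num.min (p i.+1) t))).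

Definition interior_sum p e (k j : nat) : R := \sum_(k <= i < j) e (p i) (p i.+1).

Lemma qv_sumE p X t : qv_sum p X t = partition_sum p (fun x y => (X y - X x) ^+ 2) t.
Proof. by []. Qed.

Lemma partition_le p : is_partition p -> forall i j, (i <= j)%N -> p i <= p j.
Proof.
move=> [_ inc _] i j ij; apply: (@homo_leq _ _ (fun x y : R => x <= y)) => //.
  by move=> *; apply: le_trans; eassumption.
by move=> k; exact: ltW.
Qed.

Lemma partition_lt_inv p : is_partition p ->
  forall i j, p i < p j -> (i < j)%N.
Proof.
by move=> pp i j; rewrite ltnNge; apply: contraTN => /(partition_le pp); rewrite leNgt.
Qed.

Lemma partition_ge0 p : is_partition p -> forall i, 0 <= p i.
Proof. by move=> pp i; case: (pp) => <- _ _; exact: partition_le. Qed.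

Lemma partition_unbounded p t : is_partition p -> exists i, t < p i.
Proof.
move=> [_ _ /cvgryPgt/(_ t)[N _ HN]]; exists N; exact: (HN N (leqnn N)).
Qed.

Lemma partition_loc p t : is_partition p -> 0 <= t ->
  exists k, p k <= t < p k.+1.
Proof.
move=> pp t0; have ex := partition_unbounded t pp.
case: (ex_minnP ex) => -[|k]; first by case: pp => -> _ _; rewrite ltNge t0.
move=> tk mink; exists k; rewrite tk andbT leNgt; apply/negP => /mink.
by rewrite ltnn.
Qed.

Lemma partition_locr p t : is_partition p -> 0 < t ->
  exists k, p k < t <= p k.+1.
Proof.
move=> pp t0.
have ex : exists i, t <= p i.
  by have [i ?] := partition_unbounded t pp; exists i; exact: ltW.
case: (ex_minnP ex) => -[|k]; first by case: pp => -> _ _; rewrite leNgt t0.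
move=> tk mink; exists k; rewrite tk andbT ltNge; apply/negP => /mink.
by rewrite ltnn.
Qed.

Lemma partition_sum_last p e t k : is_partition p -> (forall x, e x x = 0) ->
  p k <= t <= p k.+1 -> partition_sum p e t = interior_sum p e 0 k + e (p k) t.
Proof.
move=> pp e0 /andP[pkt tpk].
rewrite /partition_sum; apply: (@cvg_lim _) => //.
apply: cvg_near_cst; exists k.+1 => // n /= kn.
rewrite /series /= (@big_cat_nat _ _ _ k.+1) //=.
have -> : \sum_(k.+1 <= i < n) e (Num.min (p i) t) (Num.min (p i.+1) t) = 0.
  rewrite big_nat_cond big1 // => i /andP[/andP[ki _] _].
  have tpi : t <= p i by apply: (le_trans tpk); exact: partition_le.
  have tpi1 : t <= p i.+1 by apply: (le_trans tpi); exact: partition_le.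
  by rewrite !min_r.
rewrite addr0 big_nat_recr //= (min_l pkt) (min_r tpk); congr (_ + _).
rewrite /interior_sum !big_nat; apply: eq_bigr => i /andP[_ ik].
by rewrite !min_l //; apply: le_trans pkt; apply: partition_le => //; exact: ltnW.
Qed.

Lemma partition_sum0 p e : is_partition p -> (forall x, e x x = 0) -> partition_sum p e 0 = 0.
Proof.
move=> pp e0; rewrite (@partition_sum_last _ _ _ 0%N) //.
  by rewrite /interior_sum big_geq // add0r; case: pp => -> _ _.
by case: (pp) => p0 inc _; rewrite p0 lexx /= -p0 ltW.
Qed.

Lemma eq_partition_sum p e e' t : is_partition p -> 0 <= t ->
  (forall x, e x x = 0) -> (forall x, e' x x = 0) ->
  (forall x y, 0 <= x -> x <= y -> y <= t -> e x y = e' x y) ->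
  partition_sum p e t = partition_sum p e' t.
Proof.
move=> pp t0 e0 e0' ee'; have [k /andP[pk1 pk2]] := partition_loc pp t0.
rewrite !(@partition_sum_last _ _ _ k) ?pk1 ?(ltW pk2) //; congr (_ + _).
  rewrite /interior_sum !big_nat; apply: eq_bigr => i /andP[_ ik].
  apply: ee'; rewrite ?partition_ge0 ?partition_le //.
  by apply: le_trans pk1; exact: partition_le.
by rewrite ee' // partition_ge0.
Qed.

Lemma partition_sumD p e e' t : is_partition p -> 0 <= t ->
  (forall x, e x x = 0) -> (forall x, e' x x = 0) ->
  partition_sum p (fun x y => e x y + e' x y) t = partition_sum p e t + partition_sum p e' t.
Proof.
move=> pp t0 e0 e0'; have [k /andP[pk1 pk2]] := partition_loc pp t0.
rewrite !(@partition_sum_last _ _ _ k) ?pk1 ?(ltW pk2) //; last by move=> x; rewrite e0 e0' addr0.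
rewrite /interior_sum big_split /=; ring.
Qed.

Lemma partition_sum_telescope p F t : is_partition p -> 0 <= t ->
  partition_sum p (fun x y => F y - F x) t = F t - F 0.
Proof.
move=> pp t0; have [k /andP[pk1 pk2]] := partition_loc pp t0.
rewrite (@partition_sum_last _ _ _ k) ?pk1 ?(ltW pk2) //; last by move=> x; rewrite subrr.
rewrite /interior_sum telescope_sumr //; case: pp => -> _ _; ring.
Qed.

Lemma partition_sum_norm_le p e e' t : is_partition p -> 0 <= t ->
  (forall x, e x x = 0) -> (forall x, e' x x = 0) ->
  (forall x y, 0 <= x -> x <= y -> y <= t -> `|e x y| <= e' x y) ->
  `|partition_sum p e t| <= partition_sum p e' t.
Proof.
move=> pp t0 e0 e0' ee'; have [k /andP[pk1 pk2]] := partition_loc pp t0.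
rewrite !(@partition_sum_last _ _ _ k) ?pk1 ?(ltW pk2) //.
apply: (le_trans (ler_normD _ _)); apply: lerD.
  apply: (le_trans (ler_norm_sum _ _ _)).
  rewrite /interior_sum !big_nat; apply: ler_sum => i /andP[_ ik].
  apply: ee'; rewrite ?partition_ge0 ?partition_le //.
  by apply: le_trans pk1; exact: partition_le.
by rewrite ee' // partition_ge0.
Qed.

Lemma interior_sum_norm_le p e e' k j : is_partition p ->
  (forall x y, p k <= x -> x <= y -> y <= p j -> `|e x y| <= e' x y) ->
  `|interior_sum p e k j| <= interior_sum p e' k j.
Proof.
move=> pp ee'; apply: (le_trans (ler_norm_sum _ _ _)).
rewrite /interior_sum !big_nat; apply: ler_sum => i /andP[ki ij].
by apply: ee'; exact: partition_le.
Qed.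

Lemma eq_interior_sum p e e' k j : is_partition p ->
  (forall x y, p k <= x -> x <= y -> y <= p j -> e x y = e' x y) ->
  interior_sum p e k j = interior_sum p e' k j.
Proof.
move=> pp ee'; rewrite /interior_sum !big_nat; apply: eq_bigr => i /andP[ki ij].
by apply: ee'; exact: partition_le.
Qed.

Lemma interior_sumD p e e' k j :
  interior_sum p (fun x y => e x y + e' x y) k j = interior_sum p e k j + interior_sum p e' k j.
Proof. by rewrite /interior_sum big_split. Qed.

Lemma interior_sumZ p c e k j : interior_sum p (fun x y => c * e x y) k j = c * interior_sum p e k j.
Proof. by rewrite /interior_sum big_distrr. Qed.

Lemma interior_sum_telescope p F k j : (k <= j)%N ->
  interior_sum p (fun x y => F y - F x) k j = F (p j) - F (p k).
Proof. by move=> kj; rewrite /interior_sum telescope_sumr. Qed.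

Lemma riemann_sumE p xi X t : is_partition p -> 0 <= t ->
  riemann_sum p xi X t = partition_sum p (fun x y => xi x * (X y - X x)) t.
Proof.
move=> pp t0; rewrite /riemann_sum /partition_sum; congr (limn (series _)); apply/funext => i.
rewrite /stopped_incr; have [pit|tpi] := leP (p i) t; first by [].
rewrite min_r ?subrr ?mulr0 //; apply: (le_trans (ltW tpi)).
exact: partition_le.
Qed.

Lemma mesh_small (Pi : nat -> nat -> R) :
  mesh (Pi n) @[n --> \oo] --> 0%E -> forall d, 0 < d ->
  \forall n \near \oo, forall i, Pi n i.+1 - Pi n i < d.
Proof.
move=> Pi_mesh d d0.
have := Pi_mesh [set x | (x < d%:E)%E].
case.
  have := @open_nbhs_nbhs _ (0%:E : \bar R) [set x | (x < d%:E)%E].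
  by apply; split; [exact: open_ereal_lt_ereal|rewrite /= lte_fin].
move=> N _ HN; exists N => // n Nn i.
rewrite -lte_fin; apply: le_lt_trans (HN n Nn).
apply: le_trans (_ : (`|Pi n i.+1 - Pi n i|%:E <= _)%E); last first.
  by apply: ereal_sup_ubound; exists i.
by rewrite lee_fin ler_norm.
Qed.

(** The sum up to t is the sum up to s, plus the interior subintervals of [s, t]
    and a last incomplete one; the middle difference corrects the subinterval
    that contains s, which the sum up to s has cut at s. *)
Lemma partition_sum_split (Pi : nat -> nat -> R) :
  (forall n, is_partition (Pi n)) -> mesh (Pi n) @[n --> \oo] --> 0%E ->
  forall s t d, 0 <= s -> s < t -> 0 < d ->
  \forall n \near \oo, exists k j,
   [/\ s - d < Pi n k <= s, s < Pi n k.+1 < s + d,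
       t - d < Pi n j < t, (k.+1 <= j)%N &
       forall e, (forall x, e x x = 0) ->
       partition_sum (Pi n) e t = partition_sum (Pi n) e s
         + (e (Pi n k) (Pi n k.+1) - e (Pi n k) s)
         + (interior_sum (Pi n) e k.+1 j + e (Pi n j) t)].
Proof.
move=> Pi_part Pi_mesh s t d s0 st d0.
have m0 : 0 < Num.min d (t - s) by rewrite lt_min d0 subr_gt0.
near=> n.
have mes : forall i, Pi n i.+1 - Pi n i < Num.min d (t - s).
  by near: n; exact: mesh_small.
have mes1 i : Pi n i.+1 - Pi n i < d.
  by apply: lt_le_trans (mes i) _; rewrite ge_min lexx.
have mes2 i : Pi n i.+1 - Pi n i < t - s.
  by apply: lt_le_trans (mes i) _; rewrite ge_min lexx orbT.
have [k /andP[k1 k2]] := partition_loc (Pi_part n) s0.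
have [j /andP[j1 j2]] := partition_locr (Pi_part n) (le_lt_trans s0 st).
have kj : (k < j)%N.
  rewrite -ltnS; apply: (partition_lt_inv (Pi_part n)); apply: lt_le_trans j2.
  have := mes2 k; lra.
exists k, j; split => //.
- by have := mes1 k; lra.
- by have := mes1 k; lra.
- by have := mes1 j; lra.
move=> e e0; rewrite (@partition_sum_last _ _ t j) ?j2 ?(ltW j1) //.
rewrite (@partition_sum_last _ _ s k) ?k1 ?(ltW k2) //.
rewrite /interior_sum (@big_cat_nat _ _ _ k.+1) //=.
rewrite big_nat_recr //=; ring.
Unshelve. all: by end_near.
Qed.

End PartitionSums.

(** * Cadlag paths and running maxima *)

Section Paths.
Context {R : realType}.
Implicit Types (p : nat -> R) (e : R -> R -> R) (s t eps d K T r l : R) (X Y y : R -> R).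

(** Continuity on [0, +oo[ in the same window form as the one-sided estimates
    of cadlag paths below, with which it is combined. *)
Definition path_continuous y := forall t eps, 0 <= t -> 0 < eps ->
  exists2 d, 0 < d &
    forall s, 0 <= s -> t - d < s -> s < t + d -> `|y s - y t| < eps.

Lemma cadlag_right X t eps : cadlag X -> 0 <= t -> 0 < eps ->
  exists2 d, 0 < d & forall s, t <= s -> s < t + d -> `|X s - X t| < eps.
Proof.
move=> [rX _] t0 eps0; have /cvgrPdist_lt/(_ _ eps0)[d /= d0 Hd] := rX t t0.
exists d => // s; rewrite le_eqVlt => /orP[/eqP <- _|ts std].
  by rewrite subrr normr0.
rewrite distrC; apply: Hd => //=; rewrite distrC ger0_norm; lra.
Qed.

Lemma cadlag_left_cvg X t : cadlag X -> 0 < t ->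
  X s @[s --> t^'-] --> left_lim X t.
Proof. by move=> [_ lX] t0; rewrite /left_lim gt_eqF //; exact: lX. Qed.

Lemma left_lim_eq X t l : 0 < t -> X s @[s --> t^'-] --> l -> left_lim X t = l.
Proof. by move=> t0 Xl; rewrite /left_lim gt_eqF //; apply: cvg_lim Xl. Qed.

Lemma left_lim0 X : left_lim X 0 = X 0.
Proof. by rewrite /left_lim eqxx. Qed.

Lemma at_left_eps X t l eps : 0 < eps -> X s @[s --> t^'-] --> l ->
  exists2 d, 0 < d & forall s, t - d < s -> s < t -> `|X s - l| < eps.
Proof.
move=> eps0 /cvgrPdist_lt/(_ _ eps0)[d /= d0 Hd].
exists d => // s ts std.
rewrite distrC; apply: Hd => //=; rewrite ger0_norm; lra.
Qed.

Lemma cadlag_left X t eps : cadlag X -> 0 < t -> 0 < eps ->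
  exists2 d, 0 < d &
    forall s, t - d < s -> s < t -> `|X s - left_lim X t| < eps.
Proof. by move=> cX t0 eps0; exact: at_left_eps (cadlag_left_cvg cX t0). Qed.

Lemma cadlag_right_osc X t eps : cadlag X -> 0 <= t -> 0 < eps ->
  exists2 d, 0 < d & forall x z, t <= x -> x < t + d -> t <= z -> z < t + d ->
    `|X x - X z| < eps.
Proof.
move=> cX t0 eps0; have [d d0 Hd] := cadlag_right cX t0 (divr_gt0 eps0 (ltr0n _ 2)).
exists d => // x z tx xd tz zd; rewrite (splitr eps) (le_lt_trans (ler_distD (X t) _ _)) //.
by rewrite ltrD //; [exact: Hd|rewrite distrC; exact: Hd].
Qed.

Lemma cadlag_left_osc X t eps : cadlag X -> 0 < t -> 0 < eps ->
  exists2 d, 0 < d & forall x z, t - d < x -> x < t -> t - d < z -> z < t ->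
    `|X x - X z| < eps.
Proof.
move=> cX t0 eps0; have [d d0 Hd] := cadlag_left cX t0 (divr_gt0 eps0 (ltr0n _ 2)).
exists d => // x z tx xd tz zd.
rewrite (splitr eps) (le_lt_trans (ler_distD (left_lim X t) _ _)) //.
by rewrite ltrD //; [exact: Hd|rewrite distrC; exact: Hd].
Qed.

Lemma eps_at_left X t l :
  (forall eps, 0 < eps -> exists2 d, 0 < d &
    forall s, t - d < s -> s < t -> `|X s - l| < eps) ->
  X s @[s --> t^'-] --> l.
Proof.
move=> H; apply/cvgrPdist_lt => eps /H[d d0 Hd]; exists d => //= s.
move=> tsd st; rewrite distrC; apply: Hd => //.
by move: tsd; rewrite /= ltr_norml; lra.
Qed.

Lemma eps_at_right X t l :
  (forall eps, 0 < eps -> exists2 d, 0 < d &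
    forall s, t < s -> s < t + d -> `|X s - l| < eps) ->
  X s @[s --> t^'+] --> l.
Proof.
move=> H; apply/cvgrPdist_lt => eps /H[d d0 Hd]; exists d => //= s.
move=> tsd st; rewrite distrC; apply: Hd => //.
by move: tsd; rewrite /= ltr_norml; lra.
Qed.

Lemma path_continuousP y :
  {within `[0, +oo[, continuous y} <-> path_continuous y.
Proof.
split.
- move=> /subspace_continuousP H t eps t0 eps0.
  have /H/cvgrPdist_lt/(_ _ eps0)[d /= d0 Hd] : `[0, +oo[%classic t.
    by rewrite /= in_itv /= t0.
  exists d => // s s0 ts st; rewrite distrC; apply: Hd => /=.
    rewrite ltr_norml; lra.
  by rewrite in_itv /= s0.
- move=> H; apply/subspace_continuousP => t; rewrite /= in_itv /= andbT => t0.
  apply/cvgrPdist_lt => eps eps0; have [d d0 Hd] := H t eps t0 eps0.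
  exists d => //= s + s0 => tsd; rewrite distrC; apply: Hd.
  - by move: s0; rewrite in_itv /= andbT.
  - by move: tsd; rewrite /= ltr_norml; lra.
  - by move: tsd; rewrite /= ltr_norml; lra.
Qed.

Lemma path_continuous_right y t : path_continuous y -> 0 <= t ->
  y s @[s --> t^'+] --> y t.
Proof.
move=> cy t0; apply: eps_at_right => eps eps0.
have [d d0 Hd] := cy t eps t0 eps0; exists d => // s ts std.
by apply: Hd => //; lra.
Qed.

Lemma path_continuous_left y t : path_continuous y -> 0 < t ->
  y s @[s --> t^'-] --> y t.
Proof.
move=> cy t0; apply: eps_at_left => eps eps0.
have [d d0 Hd] := cy t eps (ltW t0) eps0.
have m1 : Num.min d t <= d by rewrite ge_min lexx.
have m2 : Num.min d t <= t by rewrite ge_min lexx orbT.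
exists (Num.min d t); first by rewrite lt_min d0.
by move=> s ts std; apply: Hd => //; lra.
Qed.

Lemma path_continuous_cadlag y : path_continuous y -> cadlag y.
Proof.
move=> cy; split=> t t0; first exact: path_continuous_right.
by apply/cvg_ex; exists (y t); exact: path_continuous_left.
Qed.

Lemma cadlagD X Y : cadlag X -> cadlag Y -> cadlag (fun t => X t + Y t).
Proof.
move=> [rX lX] [rY lY]; split=> t t0; first exact: cvgD (rX t t0) (rY t t0).
by apply: is_cvgD; [exact: lX|exact: lY].
Qed.

Lemma cadlagM X Y : cadlag X -> cadlag Y -> cadlag (fun t => X t * Y t).
Proof.
move=> [rX lX] [rY lY]; split=> t t0; first exact: cvgM (rX t t0) (rY t t0).
by apply: is_cvgM; [exact: lX|exact: lY].
Qed.

Lemma cadlagN X : cadlag X -> cadlag (fun t => - X t).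
Proof.
move=> [rX lX]; split=> t t0; first exact: cvgN (rX t t0).
by apply: is_cvgN; exact: lX.
Qed.

Lemma cadlagB X Y : cadlag X -> cadlag Y -> cadlag (fun t => X t - Y t).
Proof. by move=> cX cY; apply: cadlagD => //; exact: cadlagN. Qed.

Lemma cadlagV X : cadlag X ->
  (forall t, 0 <= t -> X t != 0 /\ left_lim X t != 0) ->
  cadlag (fun t => (X t)^-1).
Proof.
move=> cX X0; split=> t t0.
  by apply: cvgV; [case: (X0 t t0)|case: cX => rX _; exact: rX].
apply/cvg_ex; exists (left_lim X t)^-1; apply: cvgV.
  by case: (X0 t (ltW t0)).
exact: cadlag_left_cvg.
Qed.

Lemma cadlag_ext X Y : (forall t, 0 <= t -> X t = Y t) -> cadlag X -> cadlag Y.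
Proof.
move=> XY cX; split=> t t0.
  rewrite -XY //; apply: eps_at_right => eps eps0.
  have [d d0 Hd] := cadlag_right cX t0 eps0; exists d => // s ts std.
  by rewrite -XY; [apply: Hd => //; exact: ltW|lra].
apply/cvg_ex; exists (left_lim X t); apply: eps_at_left => eps eps0.
have [d d0 Hd] := cadlag_left cX t0 eps0.
have m1 : Num.min d t <= d by rewrite ge_min lexx.
have m2 : Num.min d t <= t by rewrite ge_min lexx orbT.
exists (Num.min d t); first by rewrite lt_min d0.
by move=> s ts std; rewrite -XY; [apply: Hd => //; lra|lra].
Qed.

Lemma left_lim_ext X Y t : cadlag X -> (forall s, 0 <= s -> X s = Y s) ->
  0 <= t -> left_lim X t = left_lim Y t.
Proof.
move=> cX XY; rewrite le_eqVlt => /orP[/eqP <-|t0].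
  by rewrite !left_lim0 XY.
apply/esym/left_lim_eq => //; apply: eps_at_left => eps eps0.
have [d d0 Hd] := cadlag_left cX t0 eps0.
have m1 : Num.min d t <= d by rewrite ge_min lexx.
have m2 : Num.min d t <= t by rewrite ge_min lexx orbT.
exists (Num.min d t); first by rewrite lt_min d0.
by move=> s ts std; rewrite -XY; [apply: Hd => //; lra|lra].
Qed.

Lemma left_lim_affine (c d X : R -> R) t : path_continuous c -> path_continuous d ->
  cadlag X -> 0 <= t ->
  left_lim (fun t => c t * X t + d t) t = c t * left_lim X t + d t.
Proof.
move=> cc cd cX; rewrite le_eqVlt => /orP[/eqP <-|t0]; first by rewrite !left_lim0.
apply: left_lim_eq => //; apply: cvgD; last exact: path_continuous_left.
by apply: cvgM; [exact: path_continuous_left|exact: cadlag_left_cvg].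
Qed.

(** A right neighbourhood and a left neighbourhood of each time have bounded
    image, so boundedness propagates along [0, T]. *)
Lemma cadlag_bounded X T : cadlag X -> 0 <= T ->
  exists2 K, 0 < K & forall t, 0 <= t -> t <= T -> `|X t| <= K.
Proof.
move=> cX T0.
apply: (@real_induction _ T (fun T => exists2 K, 0 < K &
  forall t, 0 <= t -> t <= T -> `|X t| <= K)) => //.
- exists (1 + `|X 0|) => [|t t0 t1]; first by have := normr_ge0 (X 0); lra.
  have -> : t = 0 by apply: le_anti; rewrite t0 t1.
  lra.
- move=> t t0 tT [K K0 HK]; have [d d0 Hd] := cadlag_right cX t0 ltr01.
  exists d => // s ts std sT; exists (K + 1 + `|X t|) => [|r r0 rs].
    by have := normr_ge0 (X t); lra.
  have [rt|tr] := leP r t; first by have := HK r r0 rt; have := normr_ge0 (X t); lra.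
  have h1 := Hd r (ltW tr) (le_lt_trans rs std).
  have h2 := ler_normD (X r - X t) (X t).
  by rewrite subrK in h2; lra.
- move=> t t0 tT; have [d d0 Hd] := cadlag_left cX t0 ltr01.
  exists d => // s s0 dts st [K K0 HK].
  exists (K + 1 + `|left_lim X t| + `|X t|) => [|r r0 rs].
    by have := normr_ge0 (X t); have := normr_ge0 (left_lim X t); lra.
  have n1 := normr_ge0 (X t); have n2 := normr_ge0 (left_lim X t).
  have [rt|tr] := leP r s; first by have := HK r r0 rt; lra.
  move: rs; rewrite le_eqVlt => /orP[/eqP ->|rt]; first lra.
  have h1 := Hd r (lt_trans dts tr) rt.
  have h2 := ler_normD (X r - left_lim X t) (left_lim X t).
  by rewrite subrK in h2; lra.
Qed.

Section RunningMax.
Variable X : R -> R.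
Hypothesis cX : cadlag X.

Lemma running_max_sup t : 0 <= t -> has_sup (X @` `[0, t]).
Proof.
move=> t0; split; first by exists (X 0), 0 => //=; rewrite in_itv /= lexx.
have [K K0 HK] := cadlag_bounded cX t0; exists K => _ [s /= + <-].
rewrite in_itv /= => /andP[s0 st]; exact: le_trans (ler_norm _) (HK s s0 st).
Qed.

Lemma running_max_ge s t : 0 <= s -> s <= t -> X s <= running_max X t.
Proof.
move=> s0 st; apply: ub_le_sup; first exact: (running_max_sup (le_trans s0 st)).2.
by exists s => //=; rewrite in_itv /= s0.
Qed.

Lemma running_max_le t c : 0 <= t ->
  (forall s, 0 <= s -> s <= t -> X s <= c) -> running_max X t <= c.
Proof.
move=> t0 H; apply: ge_sup; first exact: (running_max_sup t0).1.
by move=> _ [s /= + <-]; rewrite in_itv /= => /andP[s0 st]; exact: H.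
Qed.

Lemma running_max_mono s t : 0 <= s -> s <= t ->
  running_max X s <= running_max X t.
Proof.
move=> s0 st; apply: running_max_le => // r r0 rs.
by apply: running_max_ge => //; exact: le_trans st.
Qed.

Lemma running_max_approx t eps : 0 <= t -> 0 < eps ->
  exists s, [/\ 0 <= s, s <= t & running_max X t - eps < X s].
Proof.
move=> t0 eps0; have [_ [s /= + <-] H] := sup_adherent eps0 (running_max_sup t0).
by rewrite in_itv /= => /andP[s0 st]; exists s.
Qed.

Lemma running_max0 : running_max X 0 = X 0.
Proof.
apply: le_anti; rewrite running_max_ge // andbT; apply: running_max_le => // s s0 s1.
by have -> : s = 0 by apply: le_anti; rewrite s0 s1.
Qed.

(** A maximum that has increased since s is attained, up to an arbitrarily
    small amount, within [s, t], where the values of X barely exceed X t.  This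
    is what makes the drawdown small wherever the maximum increases. *)
Lemma running_max_incr s t eps : 0 <= s -> s <= t ->
  (forall r, s <= r -> r <= t -> X r <= X t + eps) ->
  running_max X s < running_max X t -> running_max X t <= X t + eps.
Proof.
move=> s0 st H lt; have t0 := le_trans s0 st.
rewrite leNgt; apply/negP => Hlt.
pose g := Num.min (running_max X t - running_max X s)
                  (running_max X t - (X t + eps)).
have g0 : 0 < g by rewrite lt_min !subr_gt0 lt.
have g1 : g <= running_max X t - running_max X s by rewrite ge_min lexx.
have g2 : g <= running_max X t - (X t + eps) by rewrite ge_min lexx orbT.
have [r [r0 rt Hr]] := running_max_approx t0 g0.
have [rs|sr] := leP r s.
  by have := running_max_ge r0 rs; lra.
by have := H r (ltW sr) rt; lra.
Qed.

End RunningMax.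

Lemma running_max_ext X Y t : (forall s, 0 <= s -> X s = Y s) ->
  running_max X t = running_max Y t.
Proof.
move=> XY; rewrite /running_max; congr sup; apply/seteqP; split => _ [s /= + <-];
  rewrite in_itv /= => /andP[s0 st]; exists s => //=; rewrite ?in_itv /= ?s0 ?XY //.
Qed.

End Paths.

(** * Azema-Yor paths *)

Section AzemaYorPaths.
Context {R : realType}.
Implicit Types (p : nat -> R) (e : R -> R -> R) (s t x z d eps eta L K T r : R) (X Y y h g : R -> R).

Section NullSum.
Variable Pi : nat -> nat -> R.
Hypotheses (Pi_part : forall n, is_partition (Pi n))
  (Pi_mesh : mesh (Pi n) @[n --> \oo] --> 0%E).
Variables (e : R -> R -> R) (M : R -> R) (T K : R).
Hypotheses (T0 : 0 <= T) (K0 : 0 <= K) (e0 : forall x, e x x = 0)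
  (cM : path_continuous M) (Mmono : forall s t, 0 <= s -> s <= t -> M s <= M t)
  (eK : forall s t, 0 <= s -> s <= t -> t <= T -> `|e s t| <= K * (M t - M s)).

(** The bound eps (M t - M 0 + t) has room for the subintervals that meet s
    and t: these are controlled only by K dM, which is small because M is
    continuous. *)
Lemma null_sum_step eps s t : 0 < eps -> 0 <= s -> s < t -> t <= T ->
  (forall x z, s <= x -> x <= z -> z < t -> `|e x z| <= eps * (M z - M x)) ->
  (\forall n \near \oo,
    partition_sum (Pi n) (fun x z => `|e x z|) s <= eps * (M s - M 0 + s)) ->
  \forall n \near \oo,
    partition_sum (Pi n) (fun x z => `|e x z|) t <= eps * (M t - M 0 + t).
Proof.
move=> eps0 s0 st tT He Ps; have K0' := K0.
have t0 : 0 <= t by lra.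
(* The subintervals that meet s and t cost at most 3 K eta in total. *)
pose eta := eps * (t - s) / (3 * (K + 1)).
have eta0 : 0 < eta.
  by rewrite /eta; apply: divr_gt0; [apply: mulr_gt0|]; lra.
have etaK : 3 * (K * eta) <= eps * (t - s).
  have -> : eps * (t - s) = 3 * ((K + 1) * eta) by rewrite /eta; field; lra.
  rewrite ler_pM2l ?ltr0n // mulrDl mul1r; lra.
have [d1 d10 H1] := cM s0 eta0; have [d2 d20 H2] := cM t0 eta0.
pose d := Num.min d1 d2.
have d0 : 0 < d by rewrite lt_min d10.
have dd1 : d <= d1 by rewrite ge_min lexx.
have dd2 : d <= d2 by rewrite ge_min lexx orbT.
move: Ps (partition_sum_split Pi_part Pi_mesh s0 st d0); apply: filterS2 => n E4.
move=> [k [j [/andP[k1 k2] /andP[k3 k4] /andP[j1 j2] kj ->]]]; last first.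
  by move=> x; rewrite e0 normr0.
have pk0 := partition_ge0 (Pi_part n) k; have pk10 := partition_ge0 (Pi_part n) k.+1.
have pj0 := partition_ge0 (Pi_part n) j.
have pkj : Pi n k.+1 <= Pi n j by exact: partition_le.
have kT : Pi n k.+1 <= T by exact: le_trans pkj (le_trans (ltW j2) tT).
have E1 : `|e (Pi n k) (Pi n k.+1)| <= 2 * (K * eta).
  apply: (le_trans (eK pk0 (le_trans k2 (ltW k3)) kT)).
  rewrite mulrCA ler_wpM2l //.
  have h1 : `|M (Pi n k.+1) - M s| < eta.
    by apply: H1 => //; [apply: le_ltB => //; exact: ltW|exact: ltD_mono k4].
  have h2 : `|M (Pi n k) - M s| < eta.
    by apply: H1 => //; [exact: ltB_mono k1|exact: le_ltD].
  apply: le_trans (ler_norm _) (le_trans (ler_distD (M s) _ _) _).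
  by rewrite mulr_natl mulr2n; apply: lerD; [exact: ltW|rewrite distrC; exact: ltW].
have E2 : `|e (Pi n j) t| <= K * eta.
  apply: (le_trans (eK pj0 (ltW j2) tT)); rewrite ler_wpM2l //.
  apply: le_trans (ler_norm _) _; rewrite distrC; apply/ltW/H2 => //.
    exact: ltB_mono j1.
  by apply: le_ltD => //; exact: ltW.
have E3 : interior_sum (Pi n) (fun x z => `|e x z|) k.+1 j <= eps * (M t - M s).
  apply: le_trans (ler_norm _) _.
  apply: (@le_trans _ _ (interior_sum (Pi n) (fun x z => eps * (M z - M x)) k.+1 j)).
    apply: interior_sum_norm_le => // x z x1 xz z1; rewrite normr_id; apply: He => //.
      exact: le_trans (ltW k3) x1.
    exact: le_lt_trans j2.
  rewrite interior_sumZ interior_sum_telescope // ler_pM2l // lerB //; first exact: Mmono (ltW j2).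
  exact: Mmono (ltW k3).
have E5 := normr_ge0 (e (Pi n k) s).
by rewrite mulrDr mulrBr in E4; rewrite mulrBr in E3; rewrite mulrBr in etaK;
   rewrite mulrDr mulrBr; lra.
Qed.

(** A sum of |e| is negligible as soon as |e| is dominated by the increments
    of a continuous nondecreasing path M, with an arbitrarily small factor on
    short intervals on either side of each time.  Intervals that contain the
    time itself may have a large factor, which allows e to involve the jumps of
    a cadlag path. *)
Lemma null_sum :
  (forall t eps, 0 <= t -> t < T -> 0 < eps -> exists2 d, 0 < d &
    forall x z, t <= x -> x <= z -> z < t + d -> z <= T ->
      `|e x z| <= eps * (M z - M x)) ->
  (forall t eps, 0 < t -> t <= T -> 0 < eps -> exists2 d, 0 < d &
    forall x z, 0 <= x -> t - d < x -> x <= z -> z < t ->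
      `|e x z| <= eps * (M z - M x)) ->
  partition_sum (Pi n) (fun x z => `|e x z|) T @[n --> \oo] --> 0.
Proof.
have T0' := T0; move=> right left; apply/cvgrPdist_lt => eps1 eps10.
have MT : 0 <= M T - M 0 by rewrite subr_ge0 Mmono.
pose eps := eps1 / (2 * (M T - M 0 + T + 1)).
have eps0 : 0 < eps by apply: divr_gt0; lra.
have epsE : eps * (M T - M 0 + T) < eps1.
  have E : eps1 = 2 * (eps * (M T - M 0 + T + 1)) by rewrite /eps; field; lra.
  have h := mulr_ge0 (ltW eps0) MT; have h' := mulr_ge0 (ltW eps0) T0.
  by rewrite [ltRHS]E !mulrDr mulr1; lra.
have H : \forall n \near \oo,
    partition_sum (Pi n) (fun x z => `|e x z|) T <= eps * (M T - M 0 + T).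
  apply: (real_induction (P := fun t => \forall n \near \oo,
    partition_sum (Pi n) (fun x z => `|e x z|) t <= eps * (M t - M 0 + t))) => //.
  - by near=> n; rewrite partition_sum0 // ?subrr ?addr0 ?mulr0 // => x; rewrite e0 normr0.
  - move=> t t0 tT Pt; have [d d0 Hd] := right t eps t0 tT eps0.
    exists d => // s ts std sT; apply: (null_sum_step eps0 t0 ts sT) => //.
    by move=> x z tx xz zs; apply: Hd => //; lra.
  - move=> t t0 tT; have [d d0 Hd] := left t eps t0 tT eps0.
    exists d => // s s0 tds st Ps; apply: (null_sum_step eps0 s0 st tT) => //.
    by move=> x z tx xz zs; apply: Hd => //; lra.
near=> n; rewrite sub0r normrN ger0_norm.
  by apply: le_lt_trans epsE; near: n.
apply: le_trans (normr_ge0 (partition_sum (Pi n) e T)) _.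
by apply: partition_sum_norm_le => // x; rewrite e0 normr0.
Unshelve. all: by end_near.
Qed.

End NullSum.

(** The properties of h = U(max X) and g = U'(max X) that matter: h has a
    second-order Taylor expansion with slope g, and g is Lipschitz, both in terms
    of max X.  Keeping h and g as paths covers at once the case of a function U
    that is only known as an inverse. *)
Definition ay_data X h g := forall T, 0 <= T -> exists2 L, 0 <= L &
  forall s t, 0 <= s -> s <= t -> t <= T ->
  `|h t - h s - g s * (running_max X t - running_max X s)|
    <= L * (running_max X t - running_max X s) ^+ 2 /\
  `|g t - g s| <= L * (running_max X t - running_max X s).

Definition ay_path X h g t := h t - g t * (running_max X t - X t).

Section AY.
Variables X h g : R -> R.
Hypotheses (cX : cadlag X) (cXm : path_continuous (running_max X))
  (D : ay_data X h g).
Let Xm := running_max X.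

Definition ay_err s t := ay_path X h g t - ay_path X h g s - g s * (X t - X s).

Let ay_err_le L s t : 0 <= L -> 0 <= s -> s <= t ->
  `|h t - h s - g s * (Xm t - Xm s)| <= L * (Xm t - Xm s) ^+ 2 ->
  `|g t - g s| <= L * (Xm t - Xm s) ->
  `|ay_err s t| <= L * (Xm t - Xm s) * ((Xm t - Xm s) + (Xm t - X t)).
Proof.
move=> L0 s0 st H1 H2.
have Zt : 0 <= Xm t - X t by rewrite subr_ge0 running_max_ge // (le_trans s0).
have -> : ay_err s t = (h t - h s - g s * (Xm t - Xm s))
                       - (g t - g s) * (Xm t - X t).
  by rewrite /ay_err /ay_path -/Xm; ring.
apply: le_trans (ler_normB _ _) _; rewrite (mulrDr (L * (Xm t - Xm s))); apply: lerD.
  by rewrite -mulrA -expr2.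
by rewrite normrM (ger0_norm Zt); apply: ler_wpM2r.
Qed.

(** The factor L d(max X) + L (max X - X) in the bound of the error is small on
    short intervals where max X increases, and the error vanishes on the
    others. *)
Lemma ay_sum_cvg (Pi : nat -> nat -> R) :
  (forall n, is_partition (Pi n)) -> mesh (Pi n) @[n --> \oo] --> 0%E ->
  forall T, 0 <= T ->
  partition_sum (Pi n) (fun s t => `|ay_err s t|) T @[n --> \oo] --> 0.
Proof.
move=> Pi_part Pi_mesh T T0.
have [L L0 HL] := D T0.
have [K K0 HK] := cadlag_bounded cX T0.
have XmK t : 0 <= t -> t <= T -> `|Xm t| <= K.
  move=> t0 tT; rewrite ler_norml; apply/andP; split.
    apply: le_trans (running_max_ge cX (lexx 0) t0).
    by have := HK 0 (lexx _) T0; rewrite ler_norml => /andP[].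
  apply: running_max_le => // s s0 st.
  by have := HK s s0 (le_trans st tT); rewrite ler_norml => /andP[].
have Xm_mono s t : 0 <= s -> s <= t -> Xm s <= Xm t by exact: running_max_mono.
have loc eps s t : 0 < eps -> 0 <= s -> s <= t -> t <= T ->
    (forall r, s <= r -> r <= t -> X r <= X t + eps / (2 * (L + 1))) ->
    Xm t - Xm s <= eps / (2 * (L + 1)) ->
    `|ay_err s t| <= eps * (Xm t - Xm s).
  move=> eps0 s0 st tT Xr Xmst; have [HL1 HL2] := HL s t s0 st tT.
  apply: le_trans (ay_err_le L0 s0 st HL1 HL2) _.
  have := Xm_mono _ _ s0 st; rewrite le_eqVlt => /orP[/eqP ->|lt].
    by rewrite subrr !(mulr0, mul0r).
  have Zt := running_max_incr cX s0 st Xr lt; rewrite -/Xm in Zt.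
  rewrite -mulrA mulrCA (mulrC eps) ler_pM2l ?subr_gt0 //.
  apply: (@le_trans _ _ (L * (2 * (eps / (2 * (L + 1)))))).
    by rewrite ler_wpM2l //; lra.
  apply: (@le_trans _ _ ((L + 1) * (2 * (eps / (2 * (L + 1)))))).
    by rewrite ler_wpM2r; [|apply: mulr_ge0 => //; apply: divr_ge0|]; lra.
  by rewrite le_eqVlt; apply/orP; left; apply/eqP; field; lra.
have epsL eps : 0 < eps -> 0 < eps / (2 * (L + 1)).
  by move=> eps0; apply: divr_gt0; lra.
apply: (@null_sum Pi Pi_part Pi_mesh ay_err Xm T (L * (4 * K))) => //.
- by apply: mulr_ge0; lra.
- by move=> x; rewrite /ay_err; ring.
- move=> s t s0 st tT; have [HL1 HL2] := HL s t s0 st tT.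
  apply: le_trans (ay_err_le L0 s0 st HL1 HL2) _.
  rewrite mulrAC; apply: ler_wpM2r; first by rewrite subr_ge0 Xm_mono.
  apply: ler_wpM2l => //.
  have h1 := XmK t (le_trans s0 st) tT; have h2 := XmK s s0 (le_trans st tT).
  have h3 := HK t (le_trans s0 st) tT; move: h1 h2 h3; rewrite !ler_norml; lra.
- move=> t eps t0 tT eps0; have e1 := epsL _ eps0.
  have [d1 d10 H1] := cadlag_right_osc cX t0 e1.
  have [d2 d20 H2] := cadlag_right_osc (path_continuous_cadlag cXm) t0 e1.
  exists (Num.min d1 d2); first by rewrite lt_min d10.
  move=> x z tx xz zt zT.
  have zd1 : z < t + d1 by apply: ltD_mono zt; rewrite ge_min lexx.
  have zd2 : z < t + d2 by apply: ltD_mono zt; rewrite ge_min lexx orbT.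
  have tz := le_trans tx xz.
  apply: loc => //; first exact: le_trans tx.
    move=> r xr rz; rewrite -lerBlDl; apply/ltW/(le_lt_trans (ler_norm _)).
    by apply: H1 => //; [exact: le_trans xr|exact: le_lt_trans zd1].
  apply/ltW/(le_lt_trans (ler_norm _))/H2 => //; exact: le_lt_trans zd2.
- move=> t eps t0 tT eps0; have e1 := epsL _ eps0.
  have [d1 d10 H1] := cadlag_left_osc cX t0 e1.
  have [d2 d20 H2] := cadlag_left_osc (path_continuous_cadlag cXm) t0 e1.
  exists (Num.min d1 d2); first by rewrite lt_min d10.
  move=> x z x0 tx xz zt.
  have xd1 : t - d1 < x by apply: ltB_mono tx; rewrite ge_min lexx.
  have xd2 : t - d2 < x by apply: ltB_mono tx; rewrite ge_min lexx orbT.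
  apply: loc => //; first exact: le_trans (ltW zt) tT.
    move=> r xr rz; rewrite -lerBlDl; apply/ltW/(le_lt_trans (ler_norm _)).
    apply: H1 => //; [exact: lt_le_trans xr|exact: le_lt_trans zt|].
    exact: lt_le_trans xz.
  apply/ltW/(le_lt_trans (ler_norm _))/H2 => //; first exact: lt_le_trans xz.
  exact: le_lt_trans zt.
Qed.

(** The Riemann sums telescope up to the error terms. *)
Lemma ay_riemann_cvg (Pi : nat -> nat -> R) :
  (forall n, is_partition (Pi n)) -> mesh (Pi n) @[n --> \oo] --> 0%E ->
  forall T, 0 <= T ->
  riemann_sum (Pi n) g X T @[n --> \oo]
    --> ay_path X h g T - ay_path X h g 0.
Proof.
move=> Pi_part Pi_mesh T T0; apply/cvgrPdist_lt => eps eps0.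
have /cvgrPdist_lt/(_ _ eps0) := ay_sum_cvg Pi_part Pi_mesh T0.
apply: filterS => n; rewrite sub0r normrN => /(le_lt_trans (ler_norm _)).
apply: le_lt_trans; rewrite riemann_sumE //.
have err0 x : ay_err x x = 0 by rewrite /ay_err !subrr mulr0 subr0.
have gX0 x : g x * (X x - X x) = 0 by rewrite subrr mulr0.
have -> : ay_path X h g T - ay_path X h g 0
    - partition_sum (Pi n) (fun s t => g s * (X t - X s)) T = partition_sum (Pi n) ay_err T.
  apply/eqP; rewrite subr_eq -partition_sumD // -(partition_sum_telescope _ (Pi_part n) T0); apply/eqP.
  apply: eq_partition_sum => // [x|x|x z _ _ _]; first by rewrite subrr.
    by rewrite err0 gX0 addr0.
  by rewrite subrK.
by apply: partition_sum_norm_le => // x; rewrite err0 normr0.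
Qed.

(** The path never exceeds h, and comes close to it at the times where X is
    close to its maximum. *)
Lemma running_max_ay T : (forall t, 0 <= t -> 0 <= g t) ->
  (forall s t, 0 <= s -> s <= t -> h s <= h t) -> 0 <= T ->
  running_max (ay_path X h g) T = h T.
Proof.
move=> g0 hmono T0.
have ayle s : 0 <= s -> s <= T -> ay_path X h g s <= h T.
  move=> s0 sT; apply: le_trans (hmono _ _ s0 sT).
  by rewrite /ay_path gerBl mulr_ge0 ?g0 // subr_ge0 running_max_ge.
have supE : has_sup (ay_path X h g @` `[0, T]).
  split; first by exists (ay_path X h g 0), 0 => //=; rewrite in_itv /= lexx.
  by exists (h T) => _ [s /= + <-]; rewrite in_itv /= => /andP[s0 sT]; exact: ayle.
apply: le_anti; apply/andP; split.
  apply: ge_sup; first exact: supE.1.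
  by move=> _ [s /= + <-]; rewrite in_itv /= => /andP[s0 sT]; exact: ayle.
apply/ler_addgt0Pr => eps eps0.
have [L L0 HL] := D T0.
(* A bound of g on [0, T]. *)
pose G := `|g 0| + L * (Xm T - Xm 0).
have XmT : 0 <= Xm T - Xm 0 by rewrite subr_ge0 running_max_mono.
have G0 : 0 <= G by rewrite addr_ge0 // mulr_ge0.
(* At a time s where X s is within d of the maximum at T, the path is below
   h T by at most (2 G + L) d. *)
pose d := Num.min 1 (eps / (2 * G + L + 1)).
have den : 0 < 2 * G + L + 1 by lra.
have d0 : 0 < d by rewrite lt_min ltr01 divr_gt0.
have d1 : d <= 1 by rewrite ge_min lexx.
have d2 : d * (2 * G + L + 1) <= eps.
  by rewrite -ler_pdivlMr // ge_min lexx orbT.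
have [s [s0 sT Xs]] := running_max_approx cX T0 d0; rewrite -/Xm in Xs.
have [HL1 HL2] := HL s T s0 sT (lexx _); rewrite -/Xm in HL1 HL2.
have Xms : X s <= Xm s by exact: running_max_ge.
have XmsT : Xm s <= Xm T by exact: running_max_mono.
have gG : g s <= G.
  have [_ HL3] := HL 0 s (lexx _) s0 sT; rewrite -/Xm in HL3.
  have h1 : L * (Xm s - Xm 0) <= L * (Xm T - Xm 0) by rewrite ler_wpM2l //; lra.
  have h2 := ler_norm (g 0); have h3 := ler_norm (g s - g 0); rewrite /G; lra.
have Zs : Xm s - X s <= d by lra.
have DX : Xm T - Xm s <= d by lra.
have e1 : g s * (Xm T - Xm s) <= G * d.
  by apply: ler_pM => //; rewrite ?g0 ?subr_ge0.
have e2 : g s * (Xm s - X s) <= G * d.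
  by apply: ler_pM => //; rewrite ?g0 ?subr_ge0.
have e3 : L * (Xm T - Xm s) ^+ 2 <= L * d.
  apply: ler_wpM2l => //; rewrite expr2.
  apply: (@le_trans _ _ (1 * d)); last by rewrite mul1r.
  by apply: ler_pM => //; rewrite ?subr_ge0 //; lra.
have ge : ay_path X h g s <= running_max (ay_path X h g) T.
  by apply: ub_le_sup; [exact: supE.2|exists s => //=; rewrite in_itv /= s0].
have dE : d * (2 * G + L + 1) = 2 * (G * d) + L * d + d by ring.
rewrite dE in d2; move: ge HL1; rewrite {1}/ay_path -/Xm ler_norml; lra.
Qed.

End AY.

End AzemaYorPaths.

(** * Locally Lipschitz functions on a half-line *)

Section HalfLine.
Context {R : realType}.
Implicit Types (c s t x y z b d eps eta l C : R) (F G h w : R -> R).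

Definition loc_lip c h := forall b, exists2 L, 0 <= L &
  forall x y, c <= x -> x <= y -> y <= b -> `|h y - h x| <= L * (y - x).

Lemma loc_lip_bounded c h b : loc_lip c h -> exists2 K, 0 <= K &
  forall x, c <= x -> x <= b -> `|h x| <= K.
Proof.
move=> /(_ b)[L L0 HL]; exists (`|h c| + L * `|b - c|) => [|x cx xb].
  by rewrite addr_ge0 // mulr_ge0.
have h1 := HL c x (lexx _) cx xb.
have h2 := ler_normD (h x - h c) (h c); rewrite subrK in h2.
have h3 : L * (x - c) <= L * `|b - c|.
  by rewrite ler_wpM2l //; apply: le_trans (ler_norm _); lra.
lra.
Qed.

Lemma loc_lip_continuous c h b : loc_lip c h -> {within `[c, b], continuous h}.
Proof.
move=> /(_ b)[L L0 HL]; apply/subspace_continuousP => x.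
rewrite /= in_itv /= => /andP[cx xb].
apply/cvgrPdist_lt => eps eps0; exists (eps / (L + 1)) => /= [|y].
  by apply: divr_gt0 => //; lra.
move=> xy; rewrite in_itv /= => /andP[cy yb].
have L1 : 0 < L + 1 by lra.
rewrite /ball_ /= ltr_pdivlMr // mulrDr mulr1 mulrC in xy.
have [xley|yltx] := leP x y.
  have := HL x y cx xley yb; rewrite distrC => h1; apply: le_lt_trans h1 _.
  by move: xy; rewrite distrC ger0_norm ?subr_ge0 //; lra.
have := HL y x cy (ltW yltx) xb => h1; apply: le_lt_trans h1 _.
by move: xy; rewrite ger0_norm ?subr_ge0 ?ltW //; lra.
Qed.

Lemma loc_lip_id c : loc_lip c id.
Proof. by move=> b; exists 1 => // x y _ xy _; rewrite mul1r ger0_norm ?subr_ge0. Qed.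

Lemma loc_lipB c F G : loc_lip c F -> loc_lip c G ->
  loc_lip c (fun x => F x - G x).
Proof.
move=> lF lG b; have [L L0 HL] := lF b; have [K K0 HK] := lG b.
exists (L + K) => [|x y cx xy yb]; first exact: addr_ge0.
have -> : F y - G y - (F x - G x) = (F y - F x) - (G y - G x) by ring.
apply: le_trans (ler_normB _ _) _; rewrite mulrDl; apply: lerD.
  exact: HL.
exact: HK.
Qed.

Lemma loc_lipM c F G : loc_lip c F -> loc_lip c G ->
  loc_lip c (fun x => F x * G x).
Proof.
move=> lF lG b; have [L L0 HL] := lF b; have [K K0 HK] := lG b.
have [A A0 HA] := loc_lip_bounded b lF; have [B B0 HB] := loc_lip_bounded b lG.
exists (A * K + B * L) => [|x y cx xy yb].
  by apply: addr_ge0; exact: mulr_ge0.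
have -> : F y * G y - F x * G x = F y * (G y - G x) + G x * (F y - F x) by ring.
apply: le_trans (ler_normD _ _) _; rewrite mulrDl !normrM -!mulrA; apply: lerD.
  by apply: ler_pM => //; [apply: HA; lra|exact: HK].
by apply: ler_pM => //; [apply: HB; lra|exact: HL].
Qed.

Lemma loc_lip_gt0_bound c F b : loc_lip c F -> (forall x, c <= x -> 0 < F x) ->
  exists2 m, 0 < m & forall x, c <= x -> x <= b -> m <= F x.
Proof.
move=> lF F0; have [cb|bc] := leP c b; last first.
  by exists 1 => // x cx xb; lra.
have [x + Hx] := EVT_min cb (loc_lip_continuous (b:=b) lF).
rewrite in_itv /= => /andP[cx xb]; exists (F x); first exact: F0.
by move=> y cy yb; apply: Hx; rewrite in_itv /= cy.
Qed.

Lemma loc_lipV c F : loc_lip c F -> (forall x, c <= x -> 0 < F x) ->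
  loc_lip c (fun x => (F x)^-1).
Proof.
move=> lF F0 b; have [L L0 HL] := lF b.
have [m m0 Hm] := loc_lip_gt0_bound b lF F0.
exists (m^-1 * m^-1 * L) => [|x y cx xy yb].
  by rewrite !mulr_ge0 // invr_ge0 ltW.
have Fx := F0 x cx; have Fy := F0 y (le_trans cx xy).
have -> : (F y)^-1 - (F x)^-1 = - ((F x)^-1 * (F y)^-1 * (F y - F x)).
  by field; rewrite !gt_eqF.
rewrite normrN !normrM -[leRHS]mulrA; apply: ler_pM => //.
  rewrite !gtr0_norm ?invr_gt0 //; apply: ler_pM; rewrite ?invr_ge0 ?(ltW Fx) ?(ltW Fy) //.
    by rewrite lef_pV2 ?posrE //; apply: Hm; lra.
  by rewrite lef_pV2 ?posrE //; apply: Hm; lra.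
exact: HL.
Qed.

(** * Derivatives from quadratic remainder estimates *)

(** Stated in a normed space, so as to cover the directions b_j and x of a
    generating function as well as functions of one real variable. *)
Lemma is_derive_quad (V : normedModType R) (f : V -> R) (p v : V) (l C d : R) :
  0 < d -> (forall h : R, `|h| < d -> `|f (p + h *: v) - f p - l * h| <= C * h ^+ 2) ->
  is_derive p v f l.
Proof.
move=> d0 H.
have cv : (fun h : R => h^-1 *: ((f \o shift p) (h *: v) - f p)) @ 0^' --> l.
  apply/cvgrPdist_lt => eps eps0.
  have C1 : 0 < `|C| + 1 by have := normr_ge0 C; lra.
  have m0 : 0 < Num.min d (eps / (`|C| + 1)) by rewrite lt_min d0 divr_gt0.
  exists (Num.min d (eps / (`|C| + 1))) => //= h.
  rewrite /ball_ /= sub0r normrN lt_min => /andP[hd heps] h0.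
  have hn : 0 < `|h| by rewrite normr_gt0.
  rewrite ltr_pdivlMr // in heps.
  have := H h hd; rewrite distrC (addrC p) => Hh.
  have -> : l - h^-1 *: (f (h *: v + p) - f p)
     = h^-1 * (l * h - (f (h *: v + p) - f p)).
    by rewrite /GRing.scale /=; field.
  rewrite normrM normfV ltr_pdivrMl //; apply: le_lt_trans Hh _.
  apply: le_lt_trans (ler_norm _) _; rewrite normrM normrX expr2.
  rewrite mulrCA ltr_pM2l //; apply: le_lt_trans heps.
  by rewrite mulrC ler_wpM2l //; have := normr_ge0 C; lra.
by split; [apply/cvg_ex; exists l|exact: cvg_lim cv].
Qed.

Lemma derive_from_quad c F x b l C : c <= x -> x < b ->
  (forall x', c <= x' -> x' <= b -> `|F x' - F x - l * (x' - x)| <= C * (x' - x) ^+ 2) ->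
  derive_from c F x = l.
Proof.
move=> cx xb H; rewrite /derive_from; case: eqVneq => [xc|xc].
  subst x; apply: cvg_lim => //; apply/cvgrPdist_lt => eps eps0.
  have C1 : 0 < `|C| + 1 by have := normr_ge0 C; lra.
  have m0 : 0 < Num.min (b - c) (eps / (`|C| + 1)).
    by rewrite lt_min subr_gt0 xb divr_gt0.
  exists (Num.min (b - c) (eps / (`|C| + 1))) => //= h.
  rewrite /ball_ /= sub0r normrN lt_min => /andP[hd heps] h0.
  rewrite ltr_pdivlMr // in heps; rewrite gtr0_norm // in hd heps.
  have ch : c <= c + h by lra.
  have chb : c + h <= b by lra.
  have := H (c + h) ch chb; have -> : c + h - c = h by ring.
  rewrite distrC => Hh.
  have -> : l - (F (c + h) - F c) / h
     = h^-1 * (l * h - (F (c + h) - F c)).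
    by field; rewrite gt_eqF.
  rewrite normrM normfV (gtr0_norm h0) ltr_pdivrMl //; apply: le_lt_trans Hh _.
  apply: le_lt_trans (ler_norm _) _; rewrite normrM normrX expr2 (gtr0_norm h0).
  rewrite mulrCA ltr_pM2l //; apply: le_lt_trans heps.
  by rewrite mulrC ler_wpM2l //; lra.
have cltx : c < x by rewrite lt_neqAle eq_sym xc.
rewrite derive1E.
have m1 : Num.min (x - c) (b - x) <= x - c by rewrite ge_min lexx.
have m2 : Num.min (x - c) (b - x) <= b - x by rewrite ge_min lexx orbT.
have : is_derive x 1 F l.
  apply: (@is_derive_quad _ F x 1 l C (Num.min (x - c) (b - x))).
    by rewrite lt_min !subr_gt0 cltx.
  move=> h; rewrite ltr_norml => /andP[h1 h2].
  have := H (x + h); have -> : x + h - x = h by ring.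
  by rewrite /GRing.scale /= mulr1; apply; lra.
by case.
Qed.

Lemma C1_from_continuous c F : C1_from c F ->
  {in `]c, +oo[, continuous F} /\ F x @[x --> c^'+] --> F c.
Proof.
move=> [H dF _]; split.
  move=> x; rewrite in_itv /= andbT => cx.
  exact/differentiable_continuous/derivable1_diffP/dF.
move/cvg_ex : H => [l /= /cvgrPdist_lt/(_ 1 ltr01)[d /= d0 Hd]].
apply: eps_at_right => eps eps0.
have L1 : 0 < `|l| + 1 by have := normr_ge0 l; lra.
exists (Num.min d (eps / (`|l| + 1))) => [|s cs sd].
  by rewrite lt_min d0 divr_gt0.
have s1 : s - c < d.
  have m1 : Num.min d (eps / (`|l| + 1)) <= d by rewrite ge_min lexx.
  lra.
have s2 : s - c < eps / (`|l| + 1).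
  have m2 : Num.min d (eps / (`|l| + 1)) <= eps / (`|l| + 1).
    by rewrite ge_min lexx orbT.
  lra.
have sc0 : 0 < s - c by lra.
have := Hd (s - c); rewrite /= sub0r normrN gtr0_norm // => /(_ s1 sc0).
have -> : c + (s - c) = s by ring.
move=> q1.
have q2 : `|(F s - F c) / (s - c)| < `|l| + 1.
  have := ler_normB l (l - (F s - F c) / (s - c)).
  have -> : l - (l - (F s - F c) / (s - c)) = (F s - F c) / (s - c) by ring.
  lra.
rewrite normrM normfV (gtr0_norm sc0) ltr_pdivrMr // in q2.
by apply: lt_trans q2 _; rewrite mulrC -ltr_pdivlMr.
Qed.

Lemma within_segment c F b : {within `[c, +oo[, continuous F} ->
  {within `[c, b], continuous F}.
Proof.
apply: continuous_subspaceW => x /=; rewrite !in_itv /= => /andP[-> _] //.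
Qed.

Lemma within_segmentS (x y x' y' : R) F : x <= x' -> y' <= y ->
  {within `[x, y], continuous F} -> {within `[x', y'], continuous F}.
Proof.
move=> xx yy; apply: continuous_subspaceW => z /=; rewrite !in_itv /=.
by move=> /andP[h1 h2]; rewrite (le_trans xx h1) (le_trans h2 yy).
Qed.

Lemma within_bounded F x y : {within `[x, y], continuous F} ->
  exists2 K, 0 <= K & forall z, x <= z -> z <= y -> `|F z| <= K.
Proof.
move=> cF; have [xy|yx] := leP x y; last first.
  by exists 0 => // z h1 h2; lra.
have [u _ Hu] := EVT_max xy cF; have [v _ Hv] := EVT_min xy cF.
exists (`|F u| + `|F v|) => [|z xz zy]; first exact: addr_ge0.
have zin : z \in `[x, y] by rewrite in_itv /= xz.
have := Hu z zin; have := Hv z zin; rewrite ler_norml => h1 h2.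
have := ler_norm (F u); have := ler_norm (- F v); rewrite normrN.
have := normr_ge0 (F u); have := normr_ge0 (F v); lra.
Qed.

Lemma C1_from_loc_lip c F : C1_from c F -> loc_lip c F.
Proof.
move=> CF b; have cF : {within `[c, +oo[, continuous F}.
  by apply/continuous_within_itvcyP; exact: C1_from_continuous.
case: CF => _ dF cdF.
have [L L0 HL] := within_bounded (within_segment (b := b) cdF).
exists L => // x y cx xy yb.
have [z + ->] : exists2 z, z \in `[x, y] & F y - F x = derive_from c F z * (y - x).
  apply: MVT_segment => // [z|].
    rewrite in_itv /= => /andP[xz zy].
    have cz : c < z by lra.
    rewrite /derive_from gt_eqF // derive1E; apply: DeriveDef => //; exact: dF.
  by apply: within_segmentS (within_segment (b := b) cF).
rewrite in_itv /= => /andP[xz zy]; rewrite normrM (ger0_norm (x := y - x)) ?subr_ge0 //.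
by rewrite ler_wpM2r ?subr_ge0 //; apply: HL; lra.
Qed.

End HalfLine.

(** * Functions with a positive Lipschitz slope *)

Section Slope.
Context {R : realType}.
Implicit Types (x y z b c m L : R).

(** V is a primitive of the positive function phi, in the form of the mean
    value theorem, which makes no distinction between the end point c and the
    other points.  The correspondence of paths uses nothing else about V than this
    property and the identity V y = phi y (y - w y). *)
Definition C1_slope c (V phi : R -> R) :=
  [/\ loc_lip c phi, forall y, c <= y -> 0 < phi y &
    forall x y, c <= x -> x <= y ->
      exists2 z, x <= z <= y & V y - V x = phi z * (y - x)].

Variables (c : R) (V phi : R -> R).
Hypothesis VS : C1_slope c V phi.

Lemma slope_loc_lip : loc_lip c V.
Proof.
have [phi_lip phi_gt0 Vmvt] := VS.
move=> b; have [K K0 HK] := loc_lip_bounded b phi_lip.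
exists K => // x y cx xy yb; have [z /andP[xz zy] ->] := Vmvt x y cx xy.
rewrite normrM (ger0_norm (x := y - x)) ?subr_ge0 // ler_wpM2r ?subr_ge0 //.
by apply: HK; [exact: le_trans xz|exact: le_trans yb].
Qed.

Lemma slope_taylor b : exists2 L, 0 <= L & forall x y,
  c <= x -> x <= b -> c <= y -> y <= b ->
  `|V y - V x - phi x * (y - x)| <= L * (y - x) ^+ 2.
Proof.
have [phi_lip phi_gt0 Vmvt] := VS.
have [L L0 HL] := phi_lip b.
exists L => // x y cx xb cy yb.
have [xy|/ltW yx] := leP x y.
  have [z /andP[xz zy] ->] := Vmvt x y cx xy.
  rewrite -mulrBl normrM (ger0_norm (x := y - x)) ?subr_ge0 // expr2 mulrA.
  rewrite ler_wpM2r ?subr_ge0 //.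
  apply: le_trans (HL x z cx xz (le_trans zy yb)) _.
  by rewrite ler_wpM2l // lerB.
have [z /andP[yz zx] E] := Vmvt y x cy yx.
have -> : V y - V x - phi x * (y - x) = (phi x - phi z) * (x - y).
  by rewrite -(opprB (V x)) E; ring.
rewrite normrM (ger0_norm (x := x - y)) ?subr_ge0 // -sqrrN opprB expr2 mulrA.
rewrite ler_wpM2r ?subr_ge0 //.
apply: le_trans (HL z x (le_trans cy yz) zx xb) _.
by rewrite ler_wpM2l // lerB.
Qed.

Lemma slope_incr b : exists2 m, 0 < m & forall x y,
  c <= x -> x <= y -> y <= b -> m * (y - x) <= V y - V x.
Proof.
have [phi_lip phi_gt0 Vmvt] := VS.
have [m m0 Hm] := loc_lip_gt0_bound b phi_lip phi_gt0.
exists m => // x y cx xy yb; have [z /andP[xz zy] ->] := Vmvt x y cx xy.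
rewrite ler_wpM2r ?subr_ge0 //.
by apply: Hm; [exact: le_trans xz|exact: le_trans yb].
Qed.

Lemma slope_le x y : c <= x -> x <= y -> V x <= V y.
Proof.
move=> cx xy; have [m m0 /(_ x y cx xy (lexx _)) h] := slope_incr y.
by rewrite -subr_ge0; apply: le_trans h; rewrite mulr_ge0 ?subr_ge0 // ltW.
Qed.

Lemma slope_inj x y : c <= x -> c <= y -> V x = V y -> x = y.
Proof.
wlog xy : x y / x <= y.
  by move=> H cx cy Vxy; have [xy|/ltW yx] := leP x y; [exact: H|exact/esym/H].
move=> cx cy Vxy; have [m m0 /(_ x y cx xy (lexx _))] := slope_incr y.
rewrite Vxy subrr => h; apply: le_anti; rewrite xy /= -subr_le0.
by rewrite -(pmulr_rle0 _ m0).
Qed.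

Lemma derive_from_slope y : c <= y -> derive_from c V y = phi y.
Proof.
move=> cy; have [L L0 HL] := slope_taylor (y + 1).
have y1 : y < y + 1 by rewrite ltrDl.
apply: (derive_from_quad (C := L) cy y1) => x' cx xb.
by apply: HL => //; exact: ltW.
Qed.

(** The second-order Taylor expansion of V is inverted, with V z - V y bounded
    below by a multiple of z - y.  The intermediate value theorem provides the
    point z above a given value x' of V. *)
Lemma derive_from_slope_inv U y : (forall x, c <= x -> U (V x) = x) ->
  c <= y -> derive_from (V c) U (V y) = (phi y)^-1.
Proof.
move=> UV cy; have y1 : y <= y + 1 by rewrite lerDl.
have [phi_lip phi_gt0 _] := VS; have py := phi_gt0 y cy.
have [L L0 HL] := slope_taylor (y + 1); have [m m0 Hm] := slope_incr (y + 1).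
have Vy1 : V y < V (y + 1).
  have := Hm y (y + 1) cy y1 (lexx _); rewrite addrAC subrr add0r mulr1 => h.
  by rewrite -subr_gt0; exact: lt_le_trans h.
apply: (derive_from_quad (C := (phi y)^-1 * L / (m * m)) (slope_le (lexx c) cy) Vy1).
move=> x' cx xb.
have [z + Vz] : exists2 z, z \in `[c, y + 1] & V z = x'.
  apply: IVT; [exact: le_trans y1|exact: loc_lip_continuous slope_loc_lip|].
  by rewrite le_max ge_min cx xb orbT.
rewrite in_itv /= => /andP[cz zb]; rewrite -Vz !UV //.
have -> : z - y - (phi y)^-1 * (V z - V y)
   = - ((phi y)^-1 * (V z - V y - phi y * (z - y))).
  by field; rewrite gt_eqF.
rewrite normrN normrM gtr0_norm ?invr_gt0 //.
have -> : (phi y)^-1 * L / (m * m) * (V z - V y) ^+ 2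
   = (phi y)^-1 * (L * ((V z - V y) ^+ 2 / (m * m))) by ring.
rewrite ler_pM2l ?invr_gt0 //.
apply: le_trans (HL y z cy y1 cz zb) _; apply: ler_wpM2l => //.
rewrite ler_pdivlMr ?mulr_gt0 //.
have -> : (z - y) ^+ 2 * (m * m) = (m * (z - y)) ^+ 2 by ring.
have [yz|/ltW zy] := leP y z.
  rewrite ler_sqr ?nnegrE ?mulr_ge0 ?subr_ge0 ?(ltW m0) ?slope_le //.
  exact: Hm.
rewrite -sqrrN -[leRHS]sqrrN -mulrN !opprB.
rewrite ler_sqr ?nnegrE ?mulr_ge0 ?subr_ge0 ?(ltW m0) ?slope_le //.
by apply: Hm => //.
Qed.

End Slope.

Section VOf.
Context {R : realType}.
Variables (a astar : R) (w : R -> R).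
Implicit Types (x y z b : R).

Lemma V_of_start : V_of a astar w astar = a.
Proof. by rewrite /V_of set_itv1 Rintegral_set1 expR0 mulr1. Qed.

Hypotheses (a0 : 0 < a) (w_C1 : C1_from astar w)
  (w_lt : forall y, astar <= y -> 0 < y - w y).
Let V := V_of a astar w.
Let k y := (y - w y)^-1.
Let phi y := V y / (y - w y).

Let k_lip : loc_lip astar k.
Proof.
apply: loc_lipV => //; apply: loc_lipB; first exact: loc_lip_id.
exact: C1_from_loc_lip.
Qed.

Let k_int b : lebesgue_measure.-integrable `[astar, b] (EFin \o k).
Proof.
apply: continuous_compact_integrable; first exact: segment_compact.
exact: loc_lip_continuous.
Qed.

Let k_cont y : astar < y -> {for y, continuous k}.
Proof.
move=> ay; have := loc_lip_continuous (b := y + 1) k_lip.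
have yy1 : y < y + 1 by rewrite ltrDl.
move=> /(continuous_within_itvP _ (lt_trans ay yy1))[H _ _]; apply: H.
by rewrite in_itv /= ay.
Qed.

Let is_derive_V_of y : astar < y -> is_derive y 1 V (phi y).
Proof.
move=> ay; pose I x := \int[lebesgue_measure]_(t in `[astar, x]) k t.
have [dI IE] := continuous_FTC1_closed (ltr_pwDr ltr01 (lexx y)) (k_int (y + 1)) ay
  (k_cont ay).
have dI' : is_derive y 1 I (k y).
  by apply: DeriveDef; [exact: dI|rewrite -derive1E; exact: IE].
have -> : phi y = a *: (expR (I y) * k y) by rewrite /phi /V /V_of [RHS]mulrA.
apply: (is_deriveZ (f := expR \o I)).
Qed.

Let V_of_continuous b : {within `[astar, b], continuous V}.
Proof.
have [ab|ba] := leP astar b; last first.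
  by rewrite set_itv_ge -?leNgt ?bnd_simp -?ltNge //; exact: continuous_subspace0.
have /subspace_continuousP H := parameterized_integral_continuous ab (k_int b).
apply/subspace_continuousP => x xab.
apply: cvgM; first exact: cvg_cst.
by apply: (cvg_comp _ _ (H x xab)); exact: continuous_expR.
Qed.

Let V_mvt x y : astar <= x -> x <= y ->
  exists2 z, x <= z <= y & V y - V x = phi z * (y - x).
Proof.
move=> ax xy.
have [z + ->] : exists2 z, z \in `[x, y] & V y - V x = phi z * (y - x).
  apply: MVT_segment => // [z|].
    by rewrite in_itv /= => /andP[xz zy]; apply: is_derive_V_of; exact: le_lt_trans xz.
  exact: within_segmentS (V_of_continuous (b := y)).
by rewrite in_itv /= => xzy; exists z.
Qed.

Let V_of_loc_lip : loc_lip astar V.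
Proof.
move=> b; have [K K0 HK] := within_bounded (V_of_continuous (b := b)).
have [K' K'0 HK'] := loc_lip_bounded b k_lip.
exists (K * K') => [|x y ax xy yb]; first exact: mulr_ge0.
have [z /andP[xz zy] ->] := V_mvt ax xy.
have az := le_trans ax xz; have zb := le_trans zy yb.
rewrite normrM (ger0_norm (x := y - x)) ?subr_ge0 // ler_wpM2r ?subr_ge0 //.
by rewrite /phi normrM; apply: ler_pM => //; [exact: HK|exact: HK'].
Qed.

(** The slope V / (y - w) comes from the fundamental theorem of calculus inside
    [astar, +oo[ and the continuity of the integral at astar. *)
Lemma V_of_slope : C1_slope astar (V_of a astar w)
  (fun y => V_of a astar w y / (y - w y)).
Proof.
split; [|by move=> y ay; rewrite divr_gt0 ?w_lt // mulr_gt0 ?expR_gt0|exact: V_mvt].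
by apply: loc_lipM; [exact: V_of_loc_lip|exact: k_lip].
Qed.

End VOf.

(** * The generating function of an Azema-Yor integrand *)

Section AzemaYorSolution.
Context {R : realType}.
Implicit Types (s t x z d r eps eta om delta C L T lo hi rho : R).

(** Its derivative in x is b0 + b1 x, the affine form w(y) + X / phi(y) of an
    Azema-Yor path. *)
Definition quad_fun (p : 'rV[R]_2 * R) : R :=
  p.1 0 ord0 * p.2 + p.1 0 ord_max * p.2 ^+ 2 / 2.

Lemma is_derive_quad_fun_x p :
  is_derive p dir_x quad_fun (p.1 0 ord0 + p.1 0 ord_max * p.2).
Proof.
apply: (@is_derive_quad _ _ _ _ _ _ `|p.1 0 ord_max| 1) => // h _.
rewrite /quad_fun /= !mxE /GRing.scale /= mulr0 !addr0 mulr1.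
set b0 := p.1 0 ord0; set b1 := p.1 0 ord_max.
have -> : b0 * (p.2 + h) + b1 * (p.2 + h) ^+ 2 / 2 -
   (b0 * p.2 + b1 * p.2 ^+ 2 / 2) - (b0 + b1 * p.2) * h = b1 * (h ^+ 2 / 2).
  by field.
rewrite normrM; apply: ler_wpM2l => //; rewrite ger0_norm; have := sqr_ge0 h; lra.
Qed.

Lemma is_derive_quad_fun_xx p :
  is_derive p dir_x (fun p : 'rV[R]_2 * R => p.1 0 ord0 + p.1 0 ord_max * p.2)
    (p.1 0 ord_max).
Proof.
apply: (@is_derive_quad _ _ _ _ _ _ 0 1) => // h _.
rewrite /= !mxE /GRing.scale /= mulr0 !addr0 mulr1 mul0r.
set b0 := p.1 0 ord0; set b1 := p.1 0 ord_max.
have -> : b0 + b1 * (p.2 + h) - (b0 + b1 * p.2) - b1 * h = 0 by ring.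
by rewrite normr0.
Qed.

Lemma is_derive_quad_fun_b p (j : 'I_2) :
  is_derive p (dir_b j) quad_fun (if j == ord0 then p.2 else p.2 ^+ 2 / 2).
Proof.
apply: (@is_derive_quad _ _ _ _ _ _ 0 1) => // h _.
rewrite /quad_fun /= !mxE /GRing.scale /= mulr0 !addr0 mul0r.
set b0 := p.1 0 ord0; set b1 := p.1 0 ord_max.
rewrite normr_le0; apply/eqP.
have [->|->] : j = ord0 \/ j = ord_max.
  by case: j => [[|[|//]]] ij; [left|right]; exact: val_inj.
  by rewrite eqxx /=; field.
by rewrite eqxx /=; field.
Qed.

Let rV2_continuous (i : 'I_2) :
  continuous (fun p : 'rV[R]_2 * R => p.1 0 i).
Proof.
move=> p; apply: (@continuous_comp _ _ _ fst (fun b : 'rV[R]_2 => b 0 i)).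
  exact: cvg_fst.
exact: coord_continuous.
Qed.

Let snd_continuous : continuous (fun p : 'rV[R]_2 * R => p.2).
Proof. by move=> p; exact: cvg_snd. Qed.

Lemma quad_fun_C12 : class_C12 setT quad_fun.
Proof.
have Dx : 'D_dir_x quad_fun = fun p => p.1 0 ord0 + p.1 0 ord_max * p.2.
  by apply/funext => p; have [] := is_derive_quad_fun_x p.
split => [|j p _|p _|p _]; first exact: openT.
- split; first by have [] := is_derive_quad_fun_b p j.
  have -> : 'D_(dir_b j) quad_fun = fun p => if j == ord0 then p.2 else p.2 ^+ 2 / 2.
    by apply/funext => q; have [] := is_derive_quad_fun_b q j.
  case: (j == ord0); first exact: snd_continuous.
  apply: cvgM; last exact: cvg_cst.
  by apply: cvgM; exact: snd_continuous.
- split; first by have [] := is_derive_quad_fun_x p.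
  rewrite Dx; apply: cvgD; first exact: rV2_continuous.
  by apply: cvgM; [exact: rV2_continuous|exact: snd_continuous].
- rewrite Dx; split; first by have [] := is_derive_quad_fun_xx p.
  have -> : 'D_dir_x (fun p : 'rV[R]_2 * R => p.1 0 ord0 + p.1 0 ord_max * p.2)
      = fun p => p.1 0 ord_max.
    by apply/funext => q; have [] := is_derive_quad_fun_xx q.
  exact: rV2_continuous.
Qed.

Lemma bounded_relatively_compact m (S : set ('rV[R]_m * R)) (C : R) :
  (forall p, S p -> (forall i, `|p.1 0 i| <= C) /\ `|p.2| <= C) ->
  relatively_compact_in setT S.
Proof.
move=> HS; split => //; rewrite setIT.
pose K := [set b : 'rV[R]_m | forall i, `[-C, C]%classic (b ord0 i)] `*` `[-C, C]%classic.
have cK : compact K.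
  apply: compact_setX; last exact: segment_compact.
  by apply: (@rV_compact _ _ (fun=> `[-C, C]%classic)) => i; exact: segment_compact.
apply: (subclosed_compact _ cK); first exact: closed_closure.
have clK : closed K by apply: compact_closed => //; exact: norm_hausdorff.
rewrite (closure_id K).1 //; apply: closure_subset => p /HS[H1 H2]; split => /=.
  by move=> i; rewrite in_itv /= -ler_norml.
by rewrite in_itv /= -ler_norml.
Qed.

(** * Lipschitz images of nondecreasing continuous paths *)

Lemma loc_lip_path_continuous c h (y : R -> R) : loc_lip c h ->
  (forall t, 0 <= t -> c <= y t) ->
  path_continuous y -> path_continuous (fun t => h (y t)).
Proof.
move=> lh cy yc t eps t0 eps0.
have [d1 d10 H1] := yc t 1 t0 ltr01; have [L L0 HL] := lh (y t + 1).
have L1 : 0 < L + 1 by lra.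
have [d2 d20 H2] := yc t _ t0 (divr_gt0 eps0 L1).
have m1 : Num.min d1 d2 <= d1 by rewrite ge_min lexx.
have m2 : Num.min d1 d2 <= d2 by rewrite ge_min lexx orbT.
exists (Num.min d1 d2); first by rewrite lt_min d10.
move=> s s0 ts st.
have ys1 : `|y s - y t| < 1 by apply: H1 => //; lra.
have ys2 : `|y s - y t| < eps / (L + 1) by apply: H2 => //; lra.
rewrite ltr_pdivlMr // mulrDr mulr1 mulrC in ys2.
have ysb : y s <= y t + 1 by move: ys1; rewrite ltr_norml; lra.
have n0 := normr_ge0 (y s - y t).
suff : `|h (y s) - h (y t)| <= L * `|y s - y t| by lra.
have [yts|/ltW yst] := leP (y t) (y s).
  by rewrite (ger0_norm (x := y s - y t)) ?subr_ge0 //; apply: HL => //; exact: cy.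
rewrite distrC (distrC (y s)) (ger0_norm (x := y t - y s)) ?subr_ge0 //.
by apply: HL => //; [exact: cy|lra].
Qed.

(** h(y) + L y and L y are nondecreasing on [0, T] for a Lipschitz constant L
    of h. *)
Lemma loc_lip_FV c h (y : R -> R) : loc_lip c h ->
  (forall t, 0 <= t -> c <= y t) ->
  (forall s t, 0 <= s -> s <= t -> y s <= y t) ->
  path_continuous y -> FV_loc (fun t => h (y t)).
Proof.
move=> lh cy ymono yc; split.
  exact/path_continuous_cadlag/(loc_lip_path_continuous lh).
move=> T T0; have [L L0 HL] := lh (y T).
have -> : (fun t => h (y t)) = (fun t => h (y t) + L * y t) \+ (\- (fun t => L * y t)).
  by apply/funext => t /=; ring.
have mono s t : s \in `[0, T] -> t \in `[0, T] -> s <= t ->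
    `|h (y t) - h (y s)| <= L * (y t - y s).
  rewrite !in_itv /= => /andP[s0 sT] /andP[t0 tT] st.
  by apply: HL; [exact: cy|exact: ymono|exact: ymono].
apply: bounded_variationD => //.
  apply: nondecreasing_bounded_variation => s t sT tT st.
  by have := mono s t sT tT st; rewrite ler_norml mulrBr; lra.
apply: bounded_variationN; apply: nondecreasing_bounded_variation => s t + _ st.
by rewrite in_itv /= => /andP[s0 _]; apply: ler_wpM2l => //; exact: ymono.
Qed.

Section Solutions.
Variables (astar : R) (w V phi : R -> R).
Hypotheses (w_C1 : C1_from astar w) (VS : C1_slope astar V phi)
  (phiV : forall y, astar <= y -> V y = phi y * (y - w y)).

Let phi_lip : loc_lip astar phi. Proof. by case: VS. Qed.
Let phi_gt0 y : astar <= y -> 0 < phi y. Proof. by case: VS => _ + _; apply. Qed.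

Let gam_lip : loc_lip astar (fun y => (phi y)^-1).
Proof. exact: loc_lipV. Qed.

Lemma ay_data_V Y : cadlag Y -> (forall t, 0 <= t -> astar <= running_max Y t) ->
  ay_data Y (fun t => V (running_max Y t)) (fun t => phi (running_max Y t)).
Proof.
move=> cY aY T T0; have [L L0 HL] := slope_taylor VS (running_max Y T).
have [K K0 HK] := phi_lip (running_max Y T).
exists (L + K) => [|s t s0 st tT]; first exact: addr_ge0.
have t0 := le_trans s0 st.
have mst := running_max_mono cY s0 st; have mtT := running_max_mono cY t0 tT.
split.
  apply: le_trans (HL _ _ (aY s s0) (le_trans mst mtT) (aY t t0) mtT) _.
  by apply: ler_wpM2r; [exact: sqr_ge0|lra].
apply: le_trans (HK _ _ (aY s s0) mst mtT) _.
by apply: ler_wpM2r; rewrite ?subr_ge0 //; lra.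
Qed.

Variables (X y : R -> R).
Hypotheses (cX : cadlag X) (cXm : path_continuous (running_max X))
  (ay : forall t, 0 <= t -> astar <= y t)
  (Vy : forall t, 0 <= t -> V (y t) = running_max X t).

Let y_mono s t : 0 <= s -> s <= t -> y s <= y t.
Proof.
move=> s0 st; have t0 := le_trans s0 st; rewrite leNgt; apply/negP => ts.
have := slope_le VS (ay t0) (ltW ts); rewrite !Vy // => mst.
have E : running_max X s = running_max X t.
  by apply: le_anti; rewrite mst running_max_mono.
suff E' : y s = y t by rewrite E' ltxx in ts.
by apply: (slope_inj VS); rewrite ?ay // !Vy.
Qed.

Let y_lip T : exists2 K, 0 < K & forall s t, 0 <= s -> s <= t -> t <= T ->
  y t - y s <= K * (running_max X t - running_max X s).
Proof.
have [m m0 Hm] := slope_incr VS (y T).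
exists m^-1 => [|s t s0 st tT]; first by rewrite invr_gt0.
have t0 := le_trans s0 st.
rewrite ler_pdivlMl // -!Vy //.
by apply: Hm; [exact: ay|exact: y_mono|exact: y_mono].
Qed.

Lemma inverse_max_continuous : path_continuous y.
Proof.
move=> t eps t0 eps0.
have t1 : t <= t + 1 by lra.
have [K K0 HK] := y_lip (t + 1).
have [d d0 Hd] := cXm t0 (divr_gt0 eps0 K0).
have m1 : Num.min d 1 <= d by rewrite ge_min lexx.
have m2 : Num.min d 1 <= 1 by rewrite ge_min lexx orbT.
exists (Num.min d 1); first by rewrite lt_min d0 ltr01.
move=> s s0 ts st.
have : `|running_max X s - running_max X t| < eps / K by apply: Hd; lra.
rewrite ltr_pdivlMr // mulrC.
have [tles|/ltW slet] := leP t s.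
  rewrite !ger0_norm ?subr_ge0 ?running_max_mono ?y_mono //.
  by apply: le_lt_trans; apply: HK => //; lra.
rewrite distrC (distrC (y s)).
rewrite !ger0_norm ?subr_ge0 ?running_max_mono ?y_mono //.
by apply: le_lt_trans; apply: HK.
Qed.

(** (y, 1 / phi(y)) are the value and the derivative of the inverse of V at
    max X; their expansions follow from those of V. *)
Lemma ay_data_U : ay_data X y (fun t => (phi (y t))^-1).
Proof.
move=> T T0; have [L L0 HL] := slope_taylor VS (y T).
have [K K0 HK] := y_lip T; have [L' L'0 HL'] := gam_lip (y T).
have [G G0 HG] := loc_lip_bounded (y T) gam_lip.
exists (G * (L * K ^+ 2) + L' * K) => [|s t s0 st tT].
  by rewrite addr_ge0 // ?mulr_ge0 ?sqr_ge0 // ltW.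
have t0 := le_trans s0 st.
have as_ := ay s0; have at_ := ay t0; have yst := y_mono s0 st.
have ytT := y_mono t0 tT; have Kst := HK s t s0 st tT.
have pos := phi_gt0 as_.
have DX : 0 <= running_max X t - running_max X s by rewrite subr_ge0 running_max_mono.
split.
  rewrite -!Vy //.
  have -> : y t - y s - (phi (y s))^-1 * (V (y t) - V (y s))
    = - ((phi (y s))^-1 * (V (y t) - V (y s) - phi (y s) * (y t - y s))).
    by field; rewrite gt_eqF.
  rewrite normrN normrM mulrDl; apply: ler_wpDr.
    by apply: mulr_ge0; [exact/mulr_ge0/ltW|exact: sqr_ge0].
  rewrite -mulrA; apply: ler_pM => //; first by apply: HG => //; exact: le_trans ytT.
  apply: le_trans (HL _ _ as_ (le_trans yst ytT) at_ ytT) _; rewrite -mulrA.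
  apply: ler_wpM2l => //; rewrite !Vy // -exprMn ler_sqr ?nnegrE ?subr_ge0 //.
  by rewrite mulr_ge0 // ltW.
apply: le_trans (HL' _ _ as_ yst ytT) _; rewrite mulrDl; apply: ler_wpDl.
  apply: mulr_ge0 => //; apply: mulr_ge0 => //; apply: mulr_ge0 => //; exact: sqr_ge0.
by rewrite -mulrA; apply: ler_wpM2l.
Qed.

Variables (Y : R -> R) (Pi : nat -> nat -> R).
Hypotheses (Pi_part : forall n, is_partition (Pi n))
  (Pi_mesh : mesh (Pi n) @[n --> \oo] --> 0%E)
  (X0 : X 0 = V astar)
  (X_neq0 : forall t, 0 <= t -> X t != 0 /\ left_lim X t != 0)
  (YE : forall t, 0 <= t -> Y t = ay_path X y (fun t => (phi (y t))^-1) t).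

Lemma running_max_ay_inv t : 0 <= t -> running_max Y t = y t.
Proof.
move=> t0; rewrite (running_max_ext _ YE) (running_max_ay cX ay_data_U) //.
by move=> s s0; rewrite invr_ge0 ltW // phi_gt0 // ay.
Qed.

Let YE' t : 0 <= t -> Y t = w (y t) + (phi (y t))^-1 * X t.
Proof.
move=> t0; rewrite YE // /ay_path -Vy // phiV ?ay //.
by field; rewrite gt_eqF // phi_gt0 // ay.
Qed.

Let wc : path_continuous (fun t => w (y t)).
Proof.
apply: (loc_lip_path_continuous (C1_from_loc_lip w_C1)) => //.
exact: inverse_max_continuous.
Qed.

Let gc : path_continuous (fun t => (phi (y t))^-1).
Proof. by apply: (loc_lip_path_continuous gam_lip) => //; exact: inverse_max_continuous. Qed.

Lemma ay_solution_cadlag : cadlag Y.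
Proof.
apply: (@cadlag_ext _ (fun t => w (y t) + (phi (y t))^-1 * X t)) => [t t0|].
  by rewrite YE'.
apply: cadlagD; first exact: path_continuous_cadlag.
by apply: cadlagM => //; exact: path_continuous_cadlag.
Qed.

Lemma ay_integrandE t : 0 <= t -> integrand w X Y t = (phi (y t))^-1.
Proof.
move=> t0; rewrite /integrand running_max_ay_inv // YE' // addrAC subrr add0r mulfK //.
by case: (X_neq0 t0).
Qed.

Lemma ay_is_solution : is_solution Pi astar w X Y.
Proof.
split => //.
- split; first exact: ay_solution_cadlag.
  move=> T T0.
  pose A t : 'rV[R]_2 := \row_j if j == ord0 then w (y t) else (phi (y t))^-1.
  exists 2%N, setT, quad_fun, A; split.
  + exact: quad_fun_C12.
  + move=> j.
    have -> : (fun t => A t 0 j)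
        = if j == ord0 then (fun t => w (y t)) else (fun t => (phi (y t))^-1).
      by apply/funext => t; rewrite mxE; case: ifP.
    case: ifP => _.
      by apply: (loc_lip_FV (C1_from_loc_lip w_C1)) => //; exact: inverse_max_continuous.
    by apply: (loc_lip_FV gam_lip) => //; exact: inverse_max_continuous.
  + move=> t /andP[t0 tT]; have [_ ->] := is_derive_quad_fun_x (A t, X t).
    by rewrite /= !mxE /= YE'.
  + have [K1 K10 H1] := cadlag_bounded (path_continuous_cadlag wc) (ltW T0).
    have [K2 K20 H2] := cadlag_bounded (path_continuous_cadlag gc) (ltW T0).
    have [K3 K30 H3] := cadlag_bounded cX (ltW T0).
    apply: (@bounded_relatively_compact _ _ (K1 + K2 + K3)).
    move=> _ [t /= + <-]; rewrite in_itv /= => /andP[t0 tT].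
    split=> [i|]; last by have := H3 t t0 tT; lra.
    rewrite mxE; case: ifP => _.
      by have := H1 t t0 tT; lra.
    by have := H2 t t0 tT; lra.
- move=> t t0; exists (Y t - astar); last by ring.
  split.
    apply: (@cadlag_ext _ (fun t => (phi (y t))^-1)) => [s s0|].
      by rewrite ay_integrandE.
    exact: path_continuous_cadlag.
  have -> : astar = Y 0.
    rewrite YE // /ay_path running_max0 // subrr mulr0 subr0.
    apply: (slope_inj VS) => //; first exact: ay.
    by rewrite Vy // running_max0 // X0.
  rewrite !YE //.
  have -> : (fun n => riemann_sum (Pi n) (integrand w X Y) X t)
      = (fun n => riemann_sum (Pi n) (fun t => (phi (y t))^-1) X t).
    apply/funext => n; rewrite !riemann_sumE //.
    apply: eq_partition_sum => // [x|x|x z x0 _ _]; rewrite ?subrr ?mulr0 //.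
    by rewrite ay_integrandE.
  exact: (ay_riemann_cvg cX cXm ay_data_U Pi_part Pi_mesh t0).
Qed.

End Solutions.
End AzemaYorSolution.

(** * Quadratic variation of c Y + d *)

Section QuadraticVariation.
Context {R : realType}.
Variable Pi : nat -> nat -> R.
Hypotheses (Pi_part : forall n, is_partition (Pi n))
  (Pi_mesh : mesh (Pi n) @[n --> \oo] --> 0%E).
Implicit Types (X Y Q u c m : R -> R) (s t x y z e eta eps om delta C L K T : R).

(** Cutting at s the subinterval that contains s changes its squared increment
    by little, since the path is right continuous at s. *)
Lemma sq_border Y s eta : cadlag Y -> 0 <= s -> 0 < eta ->
  exists2 d, 0 < d & forall x y, 0 <= x -> x <= s -> s < y -> y < s + d ->
    `|(Y y - Y x) ^+ 2 - (Y s - Y x) ^+ 2| <= eta.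
Proof.
move=> cY s0 eta0.
have [K K0 HK] := cadlag_bounded cY (addr_ge0 s0 ler01).
have [d d0 Hd] := cadlag_right cY s0 (divr_gt0 eta0 (mulr_gt0 (ltr0n _ 4) K0)).
have m1 : Num.min d 1 <= d by rewrite ge_min lexx.
have m2 : Num.min d 1 <= 1 by rewrite ge_min lexx orbT.
exists (Num.min d 1); first by rewrite lt_min d0 ltr01.
move=> x y x0 xs sy yd.
have -> : (Y y - Y x) ^+ 2 - (Y s - Y x) ^+ 2
  = (Y y - Y s) * (Y y + Y s - 2 * Y x) by ring.
have h1 : `|Y y - Y s| <= eta / (4 * K) by apply/ltW/Hd; lra.
have h2 : `|Y y + Y s - 2 * Y x| <= 4 * K.
  have := HK x x0; have := HK y; have := HK s s0; rewrite !ler_norml; lra.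
rewrite normrM; apply: le_trans (ler_pM _ _ h1 h2) _ => //.
by rewrite divfK // mulf_neq0 // gt_eqF.
Qed.

Section Weighted.
Variables (Y Q : R -> R).
Hypotheses (cY : cadlag Y) (cQ : cadlag Q)
  (Qmono : forall s t, 0 <= s -> s <= t -> Q s <= Q t)
  (YQ : forall t, 0 <= t -> qv_sum (Pi n) Y t @[n --> \oo] --> Q t).

Definition weighted_sq u x y : R := u x * (Y y - Y x) ^+ 2.

Lemma weighted_sq_diag u x : weighted_sq u x x = 0.
Proof. by rewrite /weighted_sq subrr expr0n /= mulr0. Qed.

(** On an interval where u oscillates by at most om, u may be replaced by its
    initial value at the cost of om times the sum of the squares, which tends to
    Q t - Q s. *)
Lemma weighted_sq_step u s t C om delta : 0 <= s -> s < t -> 0 < delta -> 0 <= om ->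
  (forall x, 0 <= x -> x <= t -> `|u x| <= C) ->
  (forall x, s <= x -> x <= t -> `|u x - u s| <= om) ->
  \forall n \near \oo,
    `|partition_sum (Pi n) (weighted_sq u) t - partition_sum (Pi n) (weighted_sq u) s - u s * (Q t - Q s)|
      <= om * (Q t - Q s) + delta.
Proof.
move=> s0 st delta0 om0 uC uom.
have t0 : 0 <= t by lra.
have C0 : 0 <= C by apply: le_trans (uC 0 (lexx _) t0).
have den : 0 < 4 * (C + om) + 1 by lra.
pose eta := delta / (4 * (C + om) + 1).
have eta0 : 0 < eta by rewrite divr_gt0.
have etaE : eta * (4 * (C + om) + 1) = delta by rewrite /eta divfK // gt_eqF.
have [d d0 Hd] := sq_border cY s0 eta0.
have /cvgrPdist_le/(_ _ eta0) := YQ s0.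
have /cvgrPdist_le/(_ _ eta0) := YQ t0.
move: (partition_sum_split Pi_part Pi_mesh s0 st d0); apply: filterS3 => n.
move=> [k [j [/andP[k1 k2] /andP[k3 k4] /andP[j1 j2] kj E]]].
rewrite !qv_sumE => Ht Hs.
have pk0 := partition_ge0 (Pi_part n) k.
have pkj : Pi n k.+1 <= Pi n j by exact: partition_le.
have Eu := E _ (weighted_sq_diag u).
have sq0 x : (Y x - Y x) ^+ 2 = 0 by rewrite subrr expr0n.
rewrite (E (fun x y => (Y y - Y x) ^+ 2) sq0) in Ht.
rewrite Eu.
move: Ht Hs.
set qs := partition_sum _ _ s; set bq := (_ - (Y s - _) ^+ 2).
set Iq := interior_sum _ _ _ _ + _ => Ht Hs.
have bq_le : `|bq| <= eta by apply: Hd => //; lra.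
have bu : `|weighted_sq u (Pi n k) (Pi n k.+1) - weighted_sq u (Pi n k) s| <= C * eta.
  have -> : weighted_sq u (Pi n k) (Pi n k.+1) - weighted_sq u (Pi n k) s = u (Pi n k) * bq.
    by rewrite /weighted_sq -mulrBr.
  by rewrite normrM; apply: ler_pM => //; apply: uC => //; lra.
have Iu : `|interior_sum (Pi n) (weighted_sq u) k.+1 j + weighted_sq u (Pi n j) t - u s * Iq| <= om * Iq.
  have -> : interior_sum (Pi n) (weighted_sq u) k.+1 j + weighted_sq u (Pi n j) t - u s * Iq
    = interior_sum (Pi n) (fun x y => (u x - u s) * (Y y - Y x) ^+ 2) k.+1 j
      + (u (Pi n j) - u s) * (Y t - Y (Pi n j)) ^+ 2.
    rewrite /Iq mulrDr -interior_sumZ opprD addrACA; congr (_ + _); last by rewrite /weighted_sq; ring.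
    by rewrite /interior_sum -sumrB; apply: eq_bigr => i _; rewrite /weighted_sq; ring.
  apply: le_trans (ler_normD _ _) _; rewrite /Iq mulrDr -interior_sumZ; apply: lerD.
    apply: interior_sum_norm_le => // x y xk xy yj; rewrite normrM (ger0_norm (sqr_ge0 _)).
    by apply: ler_wpM2r; [exact: sqr_ge0|apply: uom; lra].
  rewrite normrM (ger0_norm (sqr_ge0 _)).
  by apply: ler_wpM2r; [exact: sqr_ge0|apply: uom; lra].
have IQ : `|Iq - (Q t - Q s)| <= 3 * eta.
  by move: Ht Hs bq_le; rewrite !ler_norml; lra.
have us : `|u s| <= C by apply: uC => //; lra.
have uIQ : `|u s * (Iq - (Q t - Q s))| <= C * (3 * eta).
  by rewrite normrM; apply: ler_pM.
have omI : om * Iq <= om * (Q t - Q s) + om * (3 * eta).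
  by rewrite -mulrDr; apply: ler_wpM2l => //; move: IQ; rewrite ler_norml; lra.
have Eeta : delta = 4 * (C * eta) + 4 * (om * eta) + eta by rewrite -etaE; ring.
have o0 : 0 <= om * eta by rewrite mulr_ge0 // ltW.
rewrite mulrCA in omI; rewrite mulrCA in uIQ.
rewrite mulrBr in uIQ.
by rewrite Eeta; move: bu Iu uIQ; rewrite !ler_norml; lra.
Qed.

Lemma weighted_sq_mono u s t l l' : 0 <= s -> s < t -> (forall x, 0 <= x -> 0 <= u x) ->
  path_continuous u ->
  partition_sum (Pi n) (weighted_sq u) s @[n --> \oo] --> l ->
  partition_sum (Pi n) (weighted_sq u) t @[n --> \oo] --> l' -> l <= l'.
Proof.
move=> s0 st u0 uc Hl Hl'; apply/ler_addgt0Pr => eps eps0.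
have [C C0 uC] := cadlag_bounded (path_continuous_cadlag uc) s0.
have eta0 : 0 < eps / C by rewrite divr_gt0.
have [d d0 Hd] := sq_border cY s0 eta0.
have {}Hl' : (partition_sum (Pi n) (weighted_sq u) t + eps) @[n --> \oo] --> l' + eps.
  by apply: cvgD => //; exact: cvg_cst.
apply: (ler_cvg_to Hl Hl').
move: (partition_sum_split Pi_part Pi_mesh s0 st d0); apply: filterS => n.
move=> [k [j [/andP[k1 k2] /andP[k3 k4] /andP[j1 j2] kj E]]].
rewrite /= (E _ (weighted_sq_diag u)).
have pk0 := partition_ge0 (Pi_part n) k.
have I0 : 0 <= interior_sum (Pi n) (weighted_sq u) k.+1 j.
  by apply: sumr_ge0 => i _; rewrite mulr_ge0 ?sqr_ge0 // u0 // partition_ge0.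
have J0 : 0 <= weighted_sq u (Pi n j) t.
  by rewrite mulr_ge0 ?sqr_ge0 // u0 // partition_ge0.
have : `|weighted_sq u (Pi n k) (Pi n k.+1) - weighted_sq u (Pi n k) s| <= eps.
  rewrite /weighted_sq -mulrBr normrM.
  have h : `|(Y (Pi n k.+1) - Y (Pi n k)) ^+ 2 - (Y s - Y (Pi n k)) ^+ 2| <= eps / C.
    by apply: Hd => //; lra.
  apply: le_trans (ler_pM _ _ (uC _ pk0 k2) h) _ => //.
  by rewrite mulrC divfK // gt_eqF.
by rewrite ler_norml; lra.
Qed.

(** Cauchy criterion: up to eps times an increment of Q, the sums are
    those of a piecewise constant weight, which converge. *)
Lemma weighted_sq_cvg u T : 0 <= T -> path_continuous u ->
  cvg (partition_sum (Pi n) (weighted_sq u) T @[n --> \oo]).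
Proof.
move=> T0 uc.
have [C C0 uC] := cadlag_bounded (path_continuous_cadlag uc) T0.
apply: cauchy_cvg; apply: cauchy_exP => eps1 eps10.
have QT : 0 <= Q T - Q 0 by rewrite subr_ge0 Qmono.
pose eps := eps1 / (2 * (Q T - Q 0 + T + 1)).
have eps0 : 0 < eps by apply: divr_gt0; lra.
have epsE : eps * (Q T - Q 0 + T) < eps1.
  have E : eps1 = 2 * (eps * (Q T - Q 0 + T + 1)) by rewrite /eps; field; lra.
  have h := mulr_ge0 (ltW eps0) QT; have h' := mulr_ge0 (ltW eps0) T0.
  by rewrite [ltRHS]E !mulrDr mulr1; lra.
suff [l Hl] : exists l, \forall n \near \oo,
    `|partition_sum (Pi n) (weighted_sq u) T - l| <= eps * (Q T - Q 0 + T).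
  exists l; apply: filterS Hl => n Hn.
  by rewrite /ball /= distrC; apply: le_lt_trans epsE.
have step s t : 0 <= s -> s < t -> t <= T ->
    (forall x, s <= x -> x <= t -> `|u x - u s| <= eps) ->
    (exists l, \forall n \near \oo,
      `|partition_sum (Pi n) (weighted_sq u) s - l| <= eps * (Q s - Q 0 + s)) ->
    exists l, \forall n \near \oo,
      `|partition_sum (Pi n) (weighted_sq u) t - l| <= eps * (Q t - Q 0 + t).
  move=> s0 st tT us [l Hl]; exists (l + u s * (Q t - Q s)).
  have de : 0 < eps * (t - s) by rewrite mulr_gt0 // subr_gt0.
  have uCt x : 0 <= x -> x <= t -> `|u x| <= C by move=> x0 xt; apply: uC => //; lra.
  have := weighted_sq_step s0 st de (ltW eps0) uCt us; move: Hl; apply: filterS2 => n.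
  rewrite !mulrDr !mulrN !ler_norml; lra.
apply: (real_induction (P := fun t => exists l, \forall n \near \oo,
    `|partition_sum (Pi n) (weighted_sq u) t - l| <= eps * (Q t - Q 0 + t))) => //.
- exists 0; near=> n; rewrite partition_sum0 //; last exact: weighted_sq_diag.
  by rewrite subrr normr0 subrr addr0 mulr0.
- move=> t t0 tT Pt; have [d d0 Hd] := uc t eps t0 eps0.
  exists d => // s ts std sT; apply: (step t s) => // x tx xs.
  by apply/ltW/Hd; lra.
- move=> t t0 tT; have [d d0 Hd] := uc t (eps / 2) (ltW t0) (divr_gt0 eps0 (ltr0n _ 2)).
  exists d => // s s0 tds st; apply: step => // x sx xt.
  have h1 : `|u x - u t| < eps / 2 by apply: Hd; lra.
  have h2 : `|u s - u t| < eps / 2 by apply: Hd; lra.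
  by move: h1 h2; rewrite !ltr_norml ler_norml; lra.
Unshelve. all: by end_near.
Qed.

Definition weighted_qv u t : R := limn (fun n => partition_sum (Pi n) (weighted_sq u) t).

(** The weighted quadratic variation behaves as the integral of u against Q. *)
Lemma weighted_qv_incr u s t C om : path_continuous u -> 0 <= s -> s <= t -> 0 <= om ->
  (forall x, 0 <= x -> x <= t -> `|u x| <= C) ->
  (forall x, s <= x -> x <= t -> `|u x - u s| <= om) ->
  `|weighted_qv u t - weighted_qv u s - u s * (Q t - Q s)| <= om * (Q t - Q s).
Proof.
move=> uc s0; rewrite le_eqVlt => /orP[/eqP <-|st] om0 uC us.
  by rewrite !subrr !mulr0 subrr normr0.
have t0 : 0 <= t by lra.
apply/ler_addgt0Pr => eps eps0.
have H : (partition_sum (Pi n) (weighted_sq u) t - partition_sum (Pi n) (weighted_sq u) s - u s * (Q t - Q s)) @[n --> \oo]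
    --> weighted_qv u t - weighted_qv u s - u s * (Q t - Q s).
  by apply: cvgB; [apply: cvgB; exact: weighted_sq_cvg|exact: cvg_cst].
have /cvg_norm Hn := H.
apply: (ler_cvg_to Hn (cvg_cst _)).
exact: weighted_sq_step eps0 om0 uC us.
Qed.

Lemma weighted_qv_mono u s t : path_continuous u -> (forall x, 0 <= x -> 0 <= u x) ->
  0 <= s -> s <= t -> weighted_qv u s <= weighted_qv u t.
Proof.
move=> uc u0 s0; rewrite le_eqVlt => /orP[/eqP <-//|st].
by apply: (weighted_sq_mono s0 st u0 uc); apply: weighted_sq_cvg => //; lra.
Qed.

(** The left limit misses exactly the mass u_t (Q_t - Q_{t-}) of the jump of Q. *)
Lemma weighted_qv_left u t : path_continuous u -> 0 < t ->
  weighted_qv u s @[s --> t^'-] --> weighted_qv u t - u t * jump Q t.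
Proof.
move=> uc t0; apply: eps_at_left => eps eps0.
have [C C0 uC] := cadlag_bounded (path_continuous_cadlag uc) (ltW t0).
have Qt : 0 <= Q t - Q 0 by rewrite subr_ge0 Qmono // ltW.
pose eta := eps / 2 / (3 * (Q t - Q 0 + 1)).
have eta0 : 0 < eta by apply: divr_gt0; lra.
have etaE : 3 * (eta * (Q t - Q 0)) + 3 * eta = eps / 2 by rewrite /eta; field; lra.
have [d1 d10 H1] := uc t eta (ltW t0) eta0.
have e2 : 0 < eps / 2 / C by apply: divr_gt0 => //; lra.
have [d2 d20 H2] := cadlag_left cQ t0 e2.
pose d := Num.min (Num.min d1 d2) t.
have dd1 : d <= d1 by rewrite !ge_min lexx.
have dd2 : d <= d2 by rewrite !ge_min lexx orbT.
have dt : d <= t by rewrite !ge_min lexx orbT.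
exists d; first by rewrite !lt_min d10 d20.
move=> s tds st.
have s0 : 0 <= s by lra.
have h1 : `|u s - u t| < eta by apply: H1; lra.
have h2 : `|Q s - left_lim Q t| < eps / 2 / C by apply: H2; lra.
have us x : s <= x -> x <= t -> `|u x - u s| <= 2 * eta.
  move=> sx xt; have h3 : `|u x - u t| < eta by apply: H1; lra.
  by move: h1 h3; rewrite !ltr_norml ler_norml; lra.
have eta2 : 0 <= 2 * eta by lra.
have h4 := weighted_qv_incr uc s0 (ltW st) eta2 uC us.
have Qst : 0 <= Q t - Q s by rewrite subr_ge0 Qmono // ltW.
have Qst' : Q t - Q s <= Q t - Q 0 by rewrite lerD2l lerN2 Qmono.
have h5 : `|(u s - u t) * (Q t - Q s)| <= eta * (Q t - Q s).
  by rewrite normrM (ger0_norm Qst) ler_wpM2r // ltW.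
have h6 : eta * (Q t - Q s) <= eta * (Q t - Q 0) by rewrite ler_wpM2l // ltW.
have h7 : `|u t * (Q s - left_lim Q t)| <= eps / 2.
  have := ler_pM (normr_ge0 _) (normr_ge0 _) (uC t (ltW t0) (lexx _)) (ltW h2).
  by rewrite -normrM [C * _]mulrC divfK // gt_eqF.
have -> : weighted_qv u s - (weighted_qv u t - u t * jump Q t)
  = - (weighted_qv u t - weighted_qv u s - u s * (Q t - Q s)) - (u s - u t) * (Q t - Q s)
    + u t * (Q s - left_lim Q t) by rewrite /jump; ring.
rewrite -mulrA in h4.
by move: h4 h5 h7; rewrite !ler_norml ltr_norml; lra.
Qed.

Lemma weighted_qv_right u t : path_continuous u -> 0 <= t ->
  weighted_qv u s @[s --> t^'+] --> weighted_qv u t.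
Proof.
move=> uc t0; apply: eps_at_right => eps eps0.
have t1 : 0 <= t + 1 by lra.
have [C C0 uC] := cadlag_bounded (path_continuous_cadlag uc) t1.
have e3 : 0 < eps / (3 * C) by apply: divr_gt0; lra.
have [d d0 Hd] := cadlag_right cQ t0 e3.
have m1 : Num.min d 1 <= d by rewrite ge_min lexx.
have m2 : Num.min d 1 <= 1 by rewrite ge_min lexx orbT.
exists (Num.min d 1); first by rewrite lt_min d0 ltr01.
move=> s ts std.
have uCs x : 0 <= x -> x <= s -> `|u x| <= C by move=> x0 xs; apply: uC => //; lra.
have us x : t <= x -> x <= s -> `|u x - u t| <= 2 * C.
  move=> tx xs; have h1 := uCs t t0 (ltW ts); have h2 : `|u x| <= C by apply: uCs; lra.
  by move: h1 h2; rewrite !ler_norml; lra.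
have C2 : 0 <= 2 * C by lra.
have h := weighted_qv_incr uc t0 (ltW ts) C2 uCs us.
have Qst : 0 <= Q s - Q t by rewrite subr_ge0 Qmono // ltW.
have h2 : `|u t * (Q s - Q t)| <= C * (Q s - Q t).
  by rewrite normrM (ger0_norm Qst) ler_wpM2r // uCs // ltW.
have h3 : `|Q s - Q t| < eps / (3 * C) by apply: Hd; lra.
rewrite (ger0_norm Qst) ltr_pdivlMr in h3; last lra.
by rewrite -mulrA in h; move: h h2 h3; rewrite !ler_norml ltr_norml; lra.
Qed.

Lemma weighted_qv_jump u t : path_continuous u -> 0 <= t ->
  jump (weighted_qv u) t = u t * jump Q t.
Proof.
move=> uc; rewrite le_eqVlt => /orP[/eqP <-|t0].
  by rewrite /jump !left_lim0 !subrr mulr0.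
by rewrite {1}/jump (left_lim_eq t0 (weighted_qv_left uc t0)); ring.
Qed.

End Weighted.

(** With X = c Y + d, the difference between dX^2 and c^2 dY^2 factors as
    (dc Y + dd) (dX + c dY).  The first factor is of the order of dm and the
    second one is small on short intervals on either side of each time, so the
    difference is negligible; since c and d are continuous the jump of X is c
    times the jump of Y. *)
Lemma QV_affine Y c d m : QV Pi Y -> path_continuous c -> path_continuous d ->
  path_continuous m -> (forall s t, 0 <= s -> s <= t -> m s <= m t) ->
  (forall T, 0 <= T -> exists2 L, 0 <= L & forall s t, 0 <= s -> s <= t -> t <= T ->
    `|c t - c s| <= L * (m t - m s) /\ `|d t - d s| <= L * (m t - m s)) ->
  QV Pi (fun t => c t * Y t + d t).
Proof.
move=> [cY [Q [cQ Qmono YQ Qjump]]] cc cd mc mmono cdL.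
have cX : cadlag (fun t => c t * Y t + d t).
  apply: cadlagD; last exact: path_continuous_cadlag.
  by apply: cadlagM => //; exact: path_continuous_cadlag.
split=> //.
have c2 : path_continuous (fun t => c t ^+ 2).
  move=> t eps t0 eps0.
  have t1 : 0 <= t + 1 by lra.
  have [C C0 HC] := cadlag_bounded (path_continuous_cadlag cc) t1.
  have e2 : 0 < eps / (2 * C) by apply: divr_gt0; lra.
  have [e e0 He] := cc t _ t0 e2.
  have m1 : Num.min e 1 <= e by rewrite ge_min lexx.
  have m2 : Num.min e 1 <= 1 by rewrite ge_min lexx orbT.
  exists (Num.min e 1); first by rewrite lt_min e0 ltr01.
  move=> s s0 ts st; rewrite subr_sqr normrM.
  have h1 : `|c s - c t| < eps / (2 * C) by apply: He; lra.
  have h2 : `|c s + c t| <= 2 * C.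
    have := HC s s0; have := HC t t0; rewrite !ler_norml; lra.
  rewrite ltr_pdivlMr in h1; last lra.
  by apply: le_lt_trans h1; apply: ler_wpM2l.
exists (weighted_qv Y (fun t => c t ^+ 2)); split.
- split=> t t0; first exact: (weighted_qv_right cY cQ Qmono YQ).
  apply/cvg_ex; eexists; exact: (weighted_qv_left cY cQ Qmono YQ).
- by move=> s t s0 st; apply: (weighted_qv_mono cY Qmono YQ) => // x _; exact: sqr_ge0.
- move=> T T0; have [L L0 HL] := cdL T T0.
  pose X t := c t * Y t + d t.
  pose e x y := (X y - X x) ^+ 2 - weighted_sq Y (fun t => c t ^+ 2) x y.
  have e0 x : e x x = 0 by rewrite /e weighted_sq_diag subrr expr0n subrr.
  have eE x y : e x y = ((c y - c x) * Y y + (d y - d x))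
                        * ((X y - X x) + c x * (Y y - Y x)).
    by rewrite /e /weighted_sq /X; ring.
  have [KX KX0 HX] := cadlag_bounded cX T0.
  have [KY KY0 HY] := cadlag_bounded cY T0.
  have [Kc Kc0 Hc] := cadlag_bounded (path_continuous_cadlag cc) T0.
  have fact1 s t : 0 <= s -> s <= t -> t <= T ->
      `|(c t - c s) * Y t + (d t - d s)| <= L * (KY + 1) * (m t - m s).
    move=> s0 st tT; have [H1 H2] := HL s t s0 st tT.
    apply: le_trans (ler_normD _ _) _; rewrite normrM.
    have := ler_pM (normr_ge0 _) (normr_ge0 _) H1 (HY t (le_trans s0 st) tT).
    have -> : L * (KY + 1) * (m t - m s)
      = L * (m t - m s) * KY + L * (m t - m s) by ring.
    lra.
  have fact2 s t eps : 0 < eps -> 0 <= s -> s <= t -> t <= T ->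
      `|X t - X s| <= eps / (L * (KY + 1) * (Kc + 1) + 1) ->
      `|Y t - Y s| <= eps / (L * (KY + 1) * (Kc + 1) + 1) ->
      `|e s t| <= eps * (m t - m s).
    move=> eps0 s0 st tT HXst HYst; rewrite eE normrM.
    have mst : 0 <= m t - m s by rewrite subr_ge0 mmono.
    have G0 : 0 <= L * (KY + 1) * (Kc + 1) by rewrite !mulr_ge0 //; lra.
    set eta := eps / _ in HXst HYst.
    have eta0 : 0 < eta by rewrite divr_gt0 //; lra.
    have h : `|X t - X s + c s * (Y t - Y s)| <= (Kc + 1) * eta.
      apply: le_trans (ler_normD _ _) _; rewrite normrM.
      have := ler_pM (normr_ge0 _) (normr_ge0 _) (Hc s s0 (le_trans st tT)) HYst.
      by rewrite mulrDl mul1r; lra.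
    apply: le_trans (ler_pM _ _ (fact1 s t s0 st tT) h) _ => //.
    have -> : L * (KY + 1) * (m t - m s) * ((Kc + 1) * eta)
      = (L * (KY + 1) * (Kc + 1)) * eta * (m t - m s) by ring.
    apply: ler_wpM2r => //; rewrite /eta mulrC mulrAC ler_pdivrMr; last lra.
    by rewrite ler_pM2l //; lra.
  have den : 0 < L * (KY + 1) * (Kc + 1) + 1.
    have : 0 <= L * (KY + 1) * (Kc + 1) by rewrite !mulr_ge0 //; lra.
    lra.
  have eps2 eps : 0 < eps -> 0 < eps / (L * (KY + 1) * (Kc + 1) + 1).
    by move=> eps0; apply: divr_gt0.
  have null := @null_sum _ Pi Pi_part Pi_mesh e m T (L * (KY + 1) * (2 * KX + Kc * (2 * KY)))
    T0 _ e0 mc mmono.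
  have nullT : partition_sum (Pi n) (fun x z => `|e x z|) T @[n --> \oo] --> 0.
    apply: null => [|s t s0 st tT|t eps t0 tT eps0|t eps t0 tT eps0].
    + by rewrite !mulr_ge0 // ?addr_ge0 ?mulr_ge0 //; lra.
    + rewrite eE normrM.
      have -> : L * (KY + 1) * (2 * KX + Kc * (2 * KY)) * (m t - m s)
        = (L * (KY + 1) * (m t - m s)) * (2 * KX + Kc * (2 * KY)) by ring.
      apply: ler_pM => //; first exact: fact1.
      apply: le_trans (ler_normD _ _) _; apply: lerD.
        have := HX s s0; have := HX t (le_trans s0 st); rewrite /X !ler_norml; lra.
      rewrite normrM; apply: ler_pM => //; first by apply: Hc; lra.
      have := HY s s0; have := HY t (le_trans s0 st); rewrite !ler_norml; lra.
    + have [d1 d10 H1] := cadlag_right_osc cX t0 (eps2 _ eps0).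
      have [d2 d20 H2] := cadlag_right_osc cY t0 (eps2 _ eps0).
      exists (Num.min d1 d2); first by rewrite lt_min d10.
      move=> x z tx xz zt zT; have tz := le_trans tx xz.
      have zd1 : z < t + d1 by apply: ltD_mono zt; rewrite ge_min lexx.
      have zd2 : z < t + d2 by apply: ltD_mono zt; rewrite ge_min lexx orbT.
      apply: fact2 => //; first exact: le_trans tx.
        by apply/ltW/H1 => //; exact: le_lt_trans zd1.
      by apply/ltW/H2 => //; exact: le_lt_trans zd2.
    + have [d1 d10 H1] := cadlag_left_osc cX t0 (eps2 _ eps0).
      have [d2 d20 H2] := cadlag_left_osc cY t0 (eps2 _ eps0).
      exists (Num.min d1 d2); first by rewrite lt_min d10.
      move=> x z x0 tx xz zt; have xt := le_lt_trans xz zt.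
      have xd1 : t - d1 < x by apply: ltB_mono tx; rewrite ge_min lexx.
      have xd2 : t - d2 < x by apply: ltB_mono tx; rewrite ge_min lexx orbT.
      apply: fact2 => //; first exact: le_trans (ltW zt) tT.
        by apply/ltW/H1 => //; exact: lt_le_trans xz.
      by apply/ltW/H2 => //; exact: lt_le_trans xz.
  have eT : partition_sum (Pi n) e T @[n --> \oo] --> 0.
    apply/cvgrPdist_le => eps eps0; have /cvgrPdist_le/(_ _ eps0) := nullT.
    apply: filterS => n; rewrite !sub0r !normrN => h.
    apply: le_trans (le_trans (ler_norm _) h).
    by apply: partition_sum_norm_le => // x; rewrite e0 normr0.
  have H : (partition_sum (Pi n) e T + partition_sum (Pi n) (weighted_sq Y (fun t => c t ^+ 2)) T) @[n --> \oo]
      --> 0 + weighted_qv Y (fun t => c t ^+ 2) T.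
    by apply: cvgD => //; exact: (weighted_sq_cvg cY Qmono YQ T0 c2).
  rewrite add0r in H; move: H; rewrite [X in X @ _](_ : _ = fun n => qv_sum (Pi n) X T) //.
  apply/funext => n; rewrite qv_sumE -partition_sumD //; last exact: weighted_sq_diag.
  apply: eq_partition_sum => // [x|x|x y _ _ _]; rewrite ?e0 ?weighted_sq_diag ?subrr ?addr0 ?expr0n //.
  by rewrite /e subrK.
- move=> t t0; rewrite (weighted_qv_jump cY cQ Qmono YQ) // Qjump //.
  by rewrite {2}/jump left_lim_affine // /jump; ring.
Qed.

End QuadraticVariation.

(** * A local Ito-Taylor estimate *)

Section ItoTaylor.
Context {R : realType}.
Implicit Types (x z d r eps eta C L T rho B : R).

Lemma mvt_norm_le (g dg : R -> R) (x y B : R) :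
  (forall z, Num.min x y <= z -> z <= Num.max x y -> is_derive z 1 g (dg z)) ->
  (forall z, Num.min x y <= z -> z <= Num.max x y -> `|dg z| <= B) ->
  `|g y - g x| <= B * `|y - x|.
Proof.
wlog xy : x y / x <= y.
  move=> H Hd HB; have [xy|/ltW yx] := leP x y; first exact: H.
  by rewrite distrC (distrC y); apply: H => // z; rewrite minC maxC; [exact: Hd|exact: HB].
rewrite min_l // max_r // => Hd HB.
have [z + ->] : exists2 z, z \in `[x, y] & g y - g x = dg z * (y - x).
  apply: MVT_segment => // [z|].
    by rewrite in_itv /= => /andP[xz zy]; apply: Hd; exact: ltW.
  apply: derivable_within_continuous => z; rewrite in_itv /= => /andP[xz zy].
  by have [] := Hd z xz zy.
rewrite in_itv /= => /andP[xz zy]; rewrite normrM; apply: ler_wpM2r => //.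
exact: HB.
Qed.

Lemma is_derive_line (V : normedModType R) (f : V -> R) (p v : V) (z : R) :
  derivable f (p + z *: v) v ->
  is_derive z 1 (fun z => f (p + z *: v)) ('D_v f (p + z *: v)).
Proof.
move=> df.
have E : (fun h : R => h^-1 *: (((fun z => f (p + z *: v)) \o shift z) (h *: 1)
      - f (p + z *: v)))
    = (fun h : R => h^-1 *: ((f \o shift (p + z *: v)) (h *: v) - f (p + z *: v))).
  apply/funext => h /=; congr (_ *: (f _ - _)).
  by rewrite [h *: 1]mulr1 scalerDl addrCA.
by split; rewrite /derivable /derive E.
Qed.

Lemma primitive_exists (g : R -> R) (x0 r : R) : 0 < r ->
  (forall z, x0 - r <= z -> z <= x0 + r -> {for z, continuous g}) ->
  exists2 P : R -> R, P x0 = 0 & forall z, x0 - r < z -> z < x0 + r ->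
    is_derive z 1 P (g z).
Proof.
move=> r0 gc.
have gi : lebesgue_measure.-integrable `[x0 - r, x0 + r] (EFin \o g).
  apply: continuous_compact_integrable; first exact: segment_compact.
  apply/subspace_continuousP => z; rewrite /= in_itv /= => /andP[z1 z2].
  exact: cvg_within_filter (gc z z1 z2).
pose P z := \int[lebesgue_measure]_(t in `[x0 - r, z]) g t.
exists (fun z => P z - P x0); first by rewrite subrr.
move=> z z1 z2.
have [dP PE] := continuous_FTC1_closed z2 gi z1 (gc z (ltW z1) (ltW z2)).
have dP' : is_derive z 1 P (g z).
  by apply: DeriveDef; [exact: dP|rewrite -derive1E; exact: PE].
have -> : (fun z => P z - P x0) = P \- cst (P x0) by [].
by rewrite -[g z]subr0; exact: is_deriveB.
Qed.

Section LocalIto.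
Variables (m : nat) (D : set ('rV[R]_m * R)) (f : 'rV[R]_m * R -> R).
Hypothesis fC12 : class_C12 D f.
Let fx := 'D_dir_x f.
Let fxx := 'D_dir_x fx.

(** This ball of the sup norm is a product of intervals, so the coordinates can
    be varied one at a time inside it. *)
Definition box (p0 : 'rV[R]_m * R) (r : R) (p : 'rV[R]_m * R) : Prop :=
  (forall j, `|p.1 0 j - p0.1 0 j| < r) /\ `|p.2 - p0.2| < r.

Lemma nbhs_box (p0 : 'rV[R]_m * R) (A : set ('rV[R]_m * R)) : nbhs p0 A ->
  exists2 r, 0 < r & forall p, box p0 r p -> A p.
Proof.
move=> /nbhs_ballP[r r0 Hr]; exists r => // p [H1 H2]; apply: Hr; split => /=.
  by split => // i j; rewrite ord1 /ball /= distrC; exact: H1.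
by rewrite /ball /= distrC.
Qed.

(** All the constants of the local estimates come from the continuity of the
    derivatives at the centre of a small box. *)
Lemma C12_locally_bounded p0 : D p0 -> p0.2 != 0 -> exists r B rho,
  [/\ 0 < r, 0 <= B, 0 < rho & forall p, box p0 r p ->
    [/\ D p, forall j, `|'D_(dir_b j) f p| <= B, `|fx p| <= B, `|fxx p| <= B
      & rho <= `|p.2|]].
Proof.
move=> Dp0 x0; have [oD Db Dx Dxx] := fC12.
have bnd (g : 'rV[R]_m * R -> R) : {for p0, continuous g} ->
    exists2 B, 0 <= B & \forall p \near p0, `|g p| <= B.
  move=> /cvgrPdist_le/(_ 1 ltr01) H; exists (`|g p0| + 1); first exact: addr_ge0.
  apply: filterS H => p; rewrite distrC => h.
  by have := ler_normD (g p - g p0) (g p0); rewrite subrK; lra.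
have rho0 : 0 < `|p0.2| / 2 by rewrite divr_gt0 // normr_gt0.
have nD : nbhs p0 D by exact: open_nbhs_nbhs.
have [Bb Bb0 nb] : exists2 B, 0 <= B &
    \forall p \near p0, forall j, `|'D_(dir_b j) f p| <= B.
  have /choice[b Hb] : forall j, exists b, 0 <= b /\
      \forall p \near p0, `|'D_(dir_b j) f p| <= b.
    by move=> j; have [b b0 Hb] := bnd _ (Db j p0 Dp0).2; exists b.
  exists (\sum_j b j); first by apply: sumr_ge0 => j _; case: (Hb j).
  apply: (@filter_forall _ 'I_m (fun j => [set p | `|'D_(dir_b j) f p| <= \sum_j b j])
    (nbhs p0)) => j.
  have [b0 Hbj] := Hb j; apply: filterS Hbj => p h; apply: le_trans h _.
  by rewrite (bigD1 j) //= lerDl; apply: sumr_ge0 => i _; case: (Hb i).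
have [Bx Bx0 nx] := bnd _ (Dx p0 Dp0).2.
have [Bxx Bxx0 nxx] := bnd _ (Dxx p0 Dp0).2.
have [r r0 Hr] := nbhs_box (filterI nD (filterI nb (filterI nx nxx))).
exists (Num.min r (`|p0.2| / 2)), (Bb + Bx + Bxx), (`|p0.2| / 2); split => //.
- by rewrite lt_min r0.
- by rewrite !addr_ge0.
move=> p [H1 H2].
have m1 : Num.min r (`|p0.2| / 2) <= r by rewrite ge_min lexx.
have m2 : Num.min r (`|p0.2| / 2) <= `|p0.2| / 2 by rewrite ge_min lexx orbT.
have [|Dp [h1 [h2 h3]]] := Hr p.
  by split => [j|]; [exact: lt_le_trans (H1 j) _|exact: lt_le_trans H2 _].
split=> //.
- move=> j; apply: le_trans (h1 j) _; lra.
- by apply: le_trans h2 _; lra.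
- by apply: le_trans h3 _; lra.
by have := ler_normB p.2 (p.2 - p0.2); rewrite opprB addrCA subrr addr0; lra.
Qed.

Section InBox.
Variables (p0 : 'rV[R]_m * R) (r B rho : R).
Hypotheses (r0 : 0 < r) (B0 : 0 <= B) (rho0 : 0 < rho)
  (HB : forall p, box p0 r p ->
    [/\ D p, forall j, `|'D_(dir_b j) f p| <= B, `|fx p| <= B, `|fxx p| <= B
      & rho <= `|p.2|]).

Let between (x y z x1 s : R) : `|x - x1| < s -> `|y - x1| < s ->
  Num.min x y <= z -> z <= Num.max x y -> `|z - x1| < s.
Proof.
rewrite !ltr_norml => /andP[a1 a2] /andP[b1 b2].
by rewrite ge_min le_max => /orP[] ? /orP[] ?; lra.
Qed.

(** The bounds concern the partial derivatives, so the coordinates of b are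
    changed one after the other, inside the box. *)
Lemma f_lip_b b b' x : box p0 r (b, x) -> box p0 r (b', x) ->
  `|f (b', x) - f (b, x)| <= B * \sum_j `|b' 0 j - b 0 j|.
Proof.
move=> [H1 H2] [H1' _].
pose h k : 'rV[R]_m := \row_j if (j < k)%N then b' 0 j else b 0 j.
have h0 : h 0%N = b by apply/rowP => j; rewrite mxE.
have hm : h m = b' by apply/rowP => j; rewrite mxE ltn_ord.
have step (k : 'I_m) : `|f (h k.+1, x) - f (h k, x)| <= B * `|b' 0 k - b 0 k|.
  have line z : (h k, x) + z *: dir_b k = (h k + z *: delta_mx 0 k, x) :> 'rV[R]_m * R.
    transitivity (h k + z *: delta_mx 0 k, x + z *: 0) => //.
    by rewrite scaler0 addr0.
  have E1 : (h k.+1, x) = (h k, x) + (b' 0 k - b 0 k) *: dir_b k.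
    rewrite line; congr (_, _); apply/rowP => j; rewrite !mxE eqxx /= ltnS leq_eqVlt.
    have [->|jk] := eqVneq j k; first by rewrite eqxx ltnn /= mulr1 addrCA subrr addr0.
    by rewrite (negbTE (jk : (j : nat) != k)) /= mulr0 addr0.
  have E0 : (h k, x) = (h k, x) + 0 *: dir_b k by rewrite scale0r addr0.
  have inb z : Num.min 0 (b' 0 k - b 0 k) <= z -> z <= Num.max 0 (b' 0 k - b 0 k) ->
      box p0 r ((h k, x) + z *: dir_b k).
    move=> z1 z2; rewrite line; split => //= j; rewrite !mxE eqxx /=.
    have [->|jk] := eqVneq j k.
      rewrite ltnn mulr1; apply: (@between (b 0 k) (b' 0 k)) => //.
        by move: z1; rewrite !ge_min => /orP[] ?; apply/orP; [left|right]; lra.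
      by move: z2; rewrite !le_max => /orP[] ?; apply/orP; [left|right]; lra.
    by rewrite mulr0 addr0; case: ifP.
  rewrite E1 [X in _ - f X]E0 -{2}[b' 0 k - b 0 k]subr0.
  apply: (mvt_norm_le (g := fun z => f ((h k, x) + z *: dir_b k))
    (dg := fun z => 'D_(dir_b k) f ((h k, x) + z *: dir_b k))) => z z1 z2.
    apply: is_derive_line; have [oD Db _ _] := fC12.
    by have [Dp _ _ _ _] := HB (inb z z1 z2); case: (Db k _ Dp).
  by have [_ + _ _ _] := HB (inb z z1 z2); apply.
rewrite -{1}hm -{1}h0.
have -> : f (h m, x) - f (h 0%N, x) = \sum_(k < m) (f (h k.+1, x) - f (h k, x)).
  by rewrite -(big_mkord xpredT (fun k => f (h k.+1, x) - f (h k, x))) telescope_sumr.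
apply: le_trans (ler_norm_sum _ _ _) _; rewrite big_distrr /=.
by apply: ler_sum => k _; exact: step.
Qed.

Let xline (b : 'rV[R]_m) (z : R) : (b, z) = (b, 0) + z *: dir_x :> 'rV[R]_m * R.
Proof.
transitivity ((b + z *: 0, 0 + z *: (1 : R^o)) : 'rV[R]_m * R) => //.
by rewrite scaler0 addr0 add0r; congr (_, _); exact/esym/mulr1.
Qed.

Let f_dx b z : box p0 r (b, z) -> is_derive z 1 (fun z => f (b, z)) (fx (b, z)).
Proof.
move=> /HB[Dp _ _ _ _]; have [_ _ Dx _] := fC12.
have -> : (fun z => f (b, z)) = (fun z => f ((b, 0) + z *: dir_x)).
  by apply/funext => u; rewrite -xline.
by rewrite xline; apply: is_derive_line; rewrite -xline; case: (Dx _ Dp).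
Qed.

Let fx_dx b z : box p0 r (b, z) -> is_derive z 1 (fun z => fx (b, z)) (fxx (b, z)).
Proof.
move=> /HB[Dp _ _ _ _]; have [_ _ _ Dxx] := fC12.
have -> : (fun z => fx (b, z)) = (fun z => fx ((b, 0) + z *: dir_x)).
  by apply/funext => u; rewrite -xline.
by rewrite xline; apply: is_derive_line; rewrite -xline; case: (Dxx _ Dp).
Qed.

Let box_neq0 b z : box p0 r (b, z) -> z != 0.
Proof.
by move=> /HB[_ _ _ _ h]; rewrite -normr_gt0; exact: lt_le_trans h.
Qed.

Let inv_dx (z : R) : z != 0 -> is_derive z 1 (fun z : R => z^-1) (- (z ^+ 2)^-1).
Proof.
move=> z0; apply: is_derive_eq (is_deriveV z0 (is_derive_id z 1)) _.
exact: mulr1.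
Qed.

Let in_r z : `|z - p0.2| < r / 2 -> `|z - p0.2| < r.
Proof. by have r0' := r0; lra. Qed.

Let f_cont b z : box p0 r (b, z) -> {for z, continuous (fun z => f (b, z))}.
Proof.
move=> /f_dx[df _]; exact/differentiable_continuous/derivable1_diffP.
Qed.

Let prim (b : 'rV[R]_m) : (forall j, `|b 0 j - p0.1 0 j| < r) -> exists P : R -> R,
  P p0.2 = 0 /\ forall z, `|z - p0.2| < r / 2 ->
    is_derive z 1 P (f (b, z) * (z ^+ 2)^-1).
Proof.
move=> Hb; have r0' := r0; have r2 : 0 < r / 2 by lra.
have [z z1 z2|P P0 HP] := @primitive_exists
    (fun z => f (b, z) * (z ^+ 2)^-1) p0.2 (r / 2) r2.
  have bz : box p0 r (b, z) by split => //=; rewrite ltr_norml; lra.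
  apply: cvgM; first exact: f_cont.
  apply: cvgV; first by rewrite expf_neq0 // (box_neq0 bz).
  exact: exprn_continuous.
by exists P; split => // z; rewrite ltr_norml => /andP[z1 z2]; apply: HP; lra.
Qed.

Let prim_inv : exists P : R -> R,
  P p0.2 = 0 /\ forall z, `|z - p0.2| < r / 2 -> is_derive z 1 P (z^-1).
Proof.
have r0' := r0; have r2 : 0 < r / 2 by lra.
have [z z1 z2|P P0 HP] := @primitive_exists (fun z => z^-1) p0.2 (r / 2) r2.
  have bz : box p0 r (p0.1, z).
    by split => //= [j|]; rewrite ?subrr ?normr0 // ltr_norml; lra.
  by apply: cvgV; [exact: (box_neq0 bz)|exact: cvg_id].
by exists P; split => // z; rewrite ltr_norml => /andP[z1 z2]; apply: HP; lra.
Qed.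

(** The function F(b, c, x) = f(b, x) / x + P_b(x) - c L(x), where P_b and L are
    primitives in x of f(b, x) / x^2 and 1 / x, has the derivative
    (f_x(b, x) - c) / x in x.  That derivative is Lipschitz in x, hence the
    quadratic term; F is Lipschitz in (b, c), because P_b depends on b
    through f itself and not through f_x. *)
Lemma box_ito W : 0 <= W -> exists (F : 'rV[R]_m -> R -> R -> R) (C : R), 0 <= C /\
  forall b (c x : R) b' (c' x' : R), box p0 (r / 2) (b, x) -> box p0 (r / 2) (b', x') ->
  `|c| <= W -> `|c'| <= W ->
  `|F b' c' x' - F b c x - (fx (b, x) - c) / x * (x' - x)|
    <= C * ((x' - x) ^+ 2 + (\sum_j `|b' 0 j - b 0 j| + `|c' - c|)).
Proof.
move=> W0; have r0' := r0; have rho0' := rho0; have B0' := B0.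
have [LL [LL0 dLL]] := prim_inv.
have /choice[P HP] : forall b : 'rV[R]_m, exists P : R -> R,
    (forall j, `|b 0 j - p0.1 0 j| < r) -> P p0.2 = 0 /\
      forall z, `|z - p0.2| < r / 2 -> is_derive z 1 P (f (b, z) * (z ^+ 2)^-1).
  move=> b; have [Hb|nHb] := pselect (forall j, `|b 0 j - p0.1 0 j| < r).
    by have [P HP] := prim Hb; exists P.
  by exists (fun=> 0).
pose F (b : 'rV[R]_m) c z := f (b, z) * z^-1 + P b z - c * LL z.
pose xi (b : 'rV[R]_m) c z := (fx (b, z) - c) / z.
(* C1 bounds the derivative of xi in z, and C2 is a Lipschitz constant of F in
   (b, c). *)
pose C1 := B / rho + (B + W) / rho ^+ 2.
pose C2 := B / rho + B / rho ^+ 2 * r + r / rho.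
have C10 : 0 <= C1 by rewrite addr_ge0 // divr_ge0 ?addr_ge0 ?exprn_ge0 // ltW.
have C20 : 0 <= C2.
  by rewrite !addr_ge0 // ?mulr_ge0 ?invr_ge0 ?exprn_ge0 // ltW.
have halfbox b z : box p0 (r / 2) (b, z) -> box p0 r (b, z).
  by move=> [h1 h2]; split => [j|]; [apply: lt_trans (h1 j) _|apply: lt_trans h2 _]; lra.
have x00 : `|p0.2 - p0.2| < r / 2 by rewrite subrr normr0; lra.
have rho_inv b z : box p0 r (b, z) -> `|z^-1| <= rho^-1.
  move=> /HB[_ _ _ _ h]; rewrite normfV lef_pV2 // posrE.
  exact: lt_le_trans h.
have dF b c z : box p0 (r / 2) (b, z) -> is_derive z 1 (F b c) (xi b c z).
  move=> bz; have bz' := halfbox _ _ bz; have z0 := box_neq0 bz'.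
  have [_ HPz] := HP b bz'.1; have [_ /= hz] := bz.
  have H := is_deriveB (is_deriveD (is_deriveM (f_dx bz') (inv_dx z0)) (HPz z hz))
    (is_deriveM (is_derive_cst c z 1) (dLL z hz)).
  apply: is_derive_eq H _.
  rewrite /cst /xi /GRing.scale /= mulr0 addr0.
  by field.
have dxi b c z : box p0 (r / 2) (b, z) ->
    is_derive z 1 (xi b c) ((fxx (b, z)) / z - (fx (b, z) - c) / z ^+ 2).
  move=> bz; have bz' := halfbox _ _ bz; have z0 := box_neq0 bz'.
  have H := is_deriveM (is_deriveB (fx_dx bz') (is_derive_cst c z 1)) (inv_dx z0).
  apply: is_derive_eq H _.
  rewrite /cst /GRing.scale /= subr0.
  have -> : ((fun z => fx (b, z)) - (fun=> c)) z = fx (b, z) - c by [].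
  by field.
exists F, (C1 + C2); split; first exact: addr_ge0.
move=> b c x b' c' x' bx bx' cW cW'.
have bx'1 : box p0 (r / 2) (b, x') by split; [exact: bx.1|exact: bx'.2].
have inx u v z : `|u - p0.2| < r / 2 -> `|v - p0.2| < r / 2 ->
   Num.min u v <= z -> z <= Num.max u v -> `|z - p0.2| < r / 2.
  exact: between.
have Ex : `|F b c x' - F b c x - xi b c x * (x' - x)| <= C1 * (x' - x) ^+ 2.
  have inb z : Num.min x x' <= z -> z <= Num.max x x' -> box p0 (r / 2) (b, z).
    by move=> z1 z2; split; [exact: bx.1|exact: inx bx.2 bx'.2 z1 z2].
  have E : F b c x' - F b c x - xi b c x * (x' - x)
    = (F b c x' - xi b c x * x') - (F b c x - xi b c x * x) by ring.
  have -> : C1 * (x' - x) ^+ 2 = (C1 * `|x' - x|) * `|x' - x|.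
    by rewrite -mulrA -normrM -expr2 ger0_norm // sqr_ge0.
  rewrite E; apply: (mvt_norm_le (g := fun z => F b c z - xi b c x * z)
     (dg := fun z => xi b c z - xi b c x)) => z z1 z2.
    have H := is_deriveB (dF b c z (inb z z1 z2))
      (is_deriveM (is_derive_cst (xi b c x) z 1) (is_derive_id z 1)).
    by apply: is_derive_eq H _; rewrite /cst /GRing.scale /= mulr0 addr0 mulr1.
  apply: (@le_trans _ _ (C1 * `|z - x|)).
    apply: (mvt_norm_le (g := xi b c)
      (dg := fun z => fxx (b, z) / z - (fx (b, z) - c) / z ^+ 2)) => u u1 u2.
      apply: dxi; split; first exact: bx.1.
      exact: inx bx.2 (inb z z1 z2).2 u1 u2.
    have bu : box p0 r (b, u).
      apply: halfbox; split; first exact: bx.1.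
      exact: inx bx.2 (inb z z1 z2).2 u1 u2.
    have iu := rho_inv _ _ bu; have [_ _ h1 h2 _] := HB bu.
    have h3 : `|fx (b, u) - c| <= B + W.
      by apply: le_trans (ler_normB _ _) _; exact: lerD.
    apply: le_trans (ler_normB _ _) _; apply: lerD.
      by rewrite normrM; apply: ler_pM.
    rewrite normrM; apply: ler_pM => //.
    by rewrite -!exprVn normrX; apply: lerXn2r; rewrite ?nnegrE // invr_ge0 ltW.
  apply: ler_wpM2l => //.
  move: z1 z2; have [xx'|x'x] := leP x x' => z1 z2.
    by rewrite !ger0_norm ?subr_ge0 // lerD2r.
  by rewrite (ler0_norm (x := z - x)) ?(ler0_norm (x := x' - x)); lra.
have Eb : `|F b' c' x' - F b c x'| <= C2 * (\sum_j `|b' 0 j - b 0 j| + `|c' - c|).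
  set S := \sum_j _.
  have S0 : 0 <= S by apply: sumr_ge0.
  have h1 : `|(f (b', x') - f (b, x')) * x'^-1| <= (B * S) * rho^-1.
    rewrite normrM; apply: ler_pM => //.
      by apply: f_lip_b; apply: halfbox.
    exact: rho_inv (halfbox _ _ bx').
  have [P0 dP] := HP b (halfbox _ _ bx).1; have [P0' dP'] := HP b' (halfbox _ _ bx').1.
  have h2 : `|(P b' x' - P b x') - (P b' p0.2 - P b p0.2)|
      <= (B * S) * (rho ^+ 2)^-1 * `|x' - p0.2|.
    apply: (mvt_norm_le (g := fun z => P b' z - P b z) (dg := fun z =>
      f (b', z) * (z ^+ 2)^-1 - f (b, z) * (z ^+ 2)^-1)) => z z1 z2.
      have hz := inx _ _ _ x00 bx'.2 z1 z2.
      exact: is_deriveB (dP' z hz) (dP z hz).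
    have hz := inx _ _ _ x00 bx'.2 z1 z2.
    have hb : box p0 r (b, z) by split; [exact: (halfbox _ _ bx).1|exact: in_r].
    have hb' : box p0 r (b', z) by split; [exact: (halfbox _ _ bx').1|exact: in_r].
    rewrite -mulrBl normrM; apply: ler_pM => //; first exact: f_lip_b.
    have iu := rho_inv _ _ hb.
    by rewrite -!exprVn normrX; apply: lerXn2r; rewrite ?nnegrE // invr_ge0 ltW.
  have h3 : `|LL x' - LL p0.2| <= rho^-1 * `|x' - p0.2|.
    apply: (mvt_norm_le (g := LL) (dg := fun z => z^-1)) => z z1 z2.
      by apply: dLL; exact: inx x00 bx'.2 z1 z2.
    have hz := inx _ _ _ x00 bx'.2 z1 z2.
    apply: (rho_inv b); split; first exact: (halfbox _ _ bx).1.
    exact: in_r.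
  have xr : `|x' - p0.2| <= r by apply/ltW/in_r/bx'.2.
  have h2' : `|P b' x' - P b x'| <= B / rho ^+ 2 * r * S.
    move: h2; rewrite P0 P0' subrr subr0 => h; apply: le_trans h _.
    have -> : B / rho ^+ 2 * r * S = B * S / rho ^+ 2 * r by ring.
    by apply: ler_wpM2l => //; rewrite !mulr_ge0 ?invr_ge0 ?exprn_ge0 // ltW.
  have h3' : `|(c' - c) * LL x'| <= r / rho * `|c' - c|.
    move: h3; rewrite LL0 subr0 => h; rewrite normrM mulrC; apply: ler_wpM2r => //.
    apply: le_trans h _; rewrite mulrC; apply: ler_wpM2r => //.
    by rewrite invr_ge0 ltW.
  have -> : F b' c' x' - F b c x' = (f (b', x') - f (b, x')) * x'^-1
      + (P b' x' - P b x') - (c' - c) * LL x' by rewrite /F; ring.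
  apply: le_trans (ler_normB _ _) _.
  apply: le_trans (lerD (le_trans (ler_normD _ _) (lerD h1 h2')) h3') _.
  have n0 := normr_ge0 (c' - c).
  have i1 : 0 <= B / rho * `|c' - c| by rewrite !mulr_ge0 // invr_ge0 ltW.
  have i2 : 0 <= B / rho ^+ 2 * r * `|c' - c|.
    by rewrite !mulr_ge0 ?invr_ge0 ?exprn_ge0 // ltW.
  have i3 : 0 <= r / rho * S by rewrite !mulr_ge0 ?invr_ge0 // ltW.
  have -> : C2 * (S + `|c' - c|) = B * S * rho^-1 + B / rho ^+ 2 * r * S
      + r / rho * `|c' - c| + (B / rho * `|c' - c| + B / rho ^+ 2 * r * `|c' - c|
      + r / rho * S) by rewrite /C2; ring.
  by rewrite lerDl !addr_ge0.
have -> : F b' c' x' - F b c x - (fx (b, x) - c) / x * (x' - x)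
  = (F b c x' - F b c x - xi b c x * (x' - x)) + (F b' c' x' - F b c x').
  by rewrite /xi; ring.
apply: le_trans (ler_normD _ _) _; apply: le_trans (lerD Ex Eb) _.
set S := \sum_j _ + _.
have S0 : 0 <= S by rewrite addr_ge0 // sumr_ge0.
have sq := sqr_ge0 (x' - x).
have j1 := mulr_ge0 C10 S0; have j2 := mulr_ge0 C20 sq.
have -> : (C1 + C2) * ((x' - x) ^+ 2 + S)
  = C1 * (x' - x) ^+ 2 + C2 * S + (C1 * S + C2 * (x' - x) ^+ 2) by ring.
by rewrite lerDl addr_ge0.
Qed.

End InBox.

(** At b = A, c = w(y) and x = X the derivative of F in x is the
    integrand (Y - w(y)) / X, for Y = f_x(A, X). *)
Lemma local_ito p0 W : D p0 -> p0.2 != 0 -> 0 <= W ->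
  exists (r : R) (F : 'rV[R]_m -> R -> R -> R) (C : R), [/\ 0 < r, 0 <= C &
  forall b (c x : R) b' (c' x' : R), box p0 r (b, x) -> box p0 r (b', x') ->
  `|c| <= W -> `|c'| <= W ->
  `|F b' c' x' - F b c x - (fx (b, x) - c) / x * (x' - x)|
    <= C * ((x' - x) ^+ 2 + (\sum_j `|b' 0 j - b 0 j| + `|c' - c|))].
Proof.
move=> Dp0 x0 W0; have [r [B [rho [r0 B0 rho0 HB]]]] := C12_locally_bounded Dp0 x0.
have [F [C [C0 HF]]] := box_ito r0 B0 rho0 HB W0.
by exists (r / 2), F, C; split => //; rewrite divr_gt0.
Qed.

End LocalIto.
End ItoTaylor.

(** * Comparison of a solution with a local primitive *)

Section LocalComparison.
Context {R : realType}.
Implicit Types (s t x z d r eps eta om delta C L T lo hi rho : R).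

Lemma le_of_eps (x b c : R) : 0 <= c ->
  (forall eta, 0 < eta -> x <= b + c * eta) -> x <= b.
Proof.
move=> c0 H; apply/ler_addgt0Pr => eps eps0.
have c1 : 0 < c + 1 by lra.
apply: le_trans (H (eps / (c + 1)) (divr_gt0 eps0 c1)) _.
by rewrite lerD2l mulrCA ger_pMr // ler_pdivrMr // mul1r; lra.
Qed.

Lemma lin_border (F G c : R -> R) s eta : cadlag F -> cadlag G -> cadlag c ->
  0 <= s -> 0 < eta ->
  exists2 d, 0 < d & forall x z, 0 <= x -> x <= s -> s < z -> z < s + d ->
    `|(F z - F x - c x * (G z - G x)) - (F s - F x - c x * (G s - G x))| <= eta.
Proof.
move=> cF cG cc s0 eta0.
have [C C0 HC] := cadlag_bounded cc s0.
have e1 : 0 < eta / 2 by lra.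
have [d1 d10 H1] := cadlag_right cF s0 e1.
have [d2 d20 H2] := cadlag_right cG s0 (divr_gt0 e1 C0).
have m1 : Num.min d1 d2 <= d1 by rewrite ge_min lexx.
have m2 : Num.min d1 d2 <= d2 by rewrite ge_min lexx orbT.
exists (Num.min d1 d2); first by rewrite lt_min d10.
move=> x z x0 xs sz zd.
have -> : F z - F x - c x * (G z - G x) - (F s - F x - c x * (G s - G x))
  = (F z - F s) - c x * (G z - G s) by ring.
have h1 : `|F z - F s| < eta / 2 by apply: H1; lra.
have h2 : `|G z - G s| < eta / 2 / C by apply: H2; lra.
have h3 : `|c x * (G z - G s)| <= eta / 2.
  rewrite normrM; apply: le_trans (ler_pM _ _ (HC x x0 xs) (ltW h2)) _ => //.
  by rewrite mulrC divfK // gt_eqF.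
apply: le_trans (ler_normB _ _) _; lra.
Qed.

Section Local.
Variable Pi : nat -> nat -> R.
Hypotheses (Pi_part : forall n, is_partition (Pi n))
  (Pi_mesh : mesh (Pi n) @[n --> \oo] --> 0%E).
Variables (X Y xi Q M : R -> R).
Hypotheses (cX : cadlag X) (cY : cadlag Y) (cxi : cadlag xi) (cQ : cadlag Q)
  (Qmono : forall s t, 0 <= s -> s <= t -> Q s <= Q t)
  (XQ : forall t, 0 <= t -> qv_sum (Pi n) X t @[n --> \oo] --> Q t)
  (Qjump : forall t, 0 <= t -> jump Q t = jump X t ^+ 2)
  (QM : forall s t, 0 <= s -> s <= t -> Q t - Q s <= M t - M s).

(** The defect of Y from being an integral of xi against X on one interval. *)
Definition sol_err x z : R := Y z - Y x - xi x * (X z - X x).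
Let e := sol_err.

Hypothesis e_null : forall t, 0 <= t -> partition_sum (Pi n) e t @[n --> \oo] --> 0.

Let e0 x : e x x = 0.
Proof. by rewrite /e /sol_err !subrr mulr0 subr0. Qed.

Let sq0 x : (X x - X x) ^+ 2 = 0.
Proof. by rewrite subrr expr0n. Qed.

Let Mmono s t : 0 <= s -> s <= t -> M s <= M t.
Proof.
move=> s0 st; rewrite -subr_ge0; apply: le_trans (QM s0 st).
by rewrite subr_ge0 Qmono.
Qed.

(** The decomposition of the sums over [s, t] along one fine partition, with the
    limits already replaced by eta-approximations: all the estimates on [s, t]
    below are read off a single such partition. *)
Let approx s t eta d : 0 <= s -> s < t -> 0 < eta -> 0 < d ->
  \forall n \near \oo, exists k j,
  [/\ [/\ 0 <= Pi n k, Pi n k <= s, s < Pi n k.+1 & Pi n k.+1 < s + d],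
      t - d < Pi n j /\ Pi n j < t, (k.+1 <= j)%N /\ Pi n k.+1 <= Pi n j,
      `|interior_sum (Pi n) e k.+1 j + e (Pi n j) t| <= 3 * eta &
      `|interior_sum (Pi n) (fun x z => (X z - X x) ^+ 2) k.+1 j + (X t - X (Pi n j)) ^+ 2
        - (Q t - Q s)| <= 3 * eta /\
      forall e', (forall x, e' x x = 0) -> partition_sum (Pi n) e' t = partition_sum (Pi n) e' s
         + (e' (Pi n k) (Pi n k.+1) - e' (Pi n k) s)
         + (interior_sum (Pi n) e' k.+1 j + e' (Pi n j) t)].
Proof.
move=> s0 st eta0 d0; have t0 : 0 <= t by lra.
have [d1 d10 H1] := lin_border cY cX cxi s0 eta0.
have [d2 d20 H2] := sq_border cX s0 eta0.
pose d' := Num.min (Num.min d1 d2) d.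
have d'0 : 0 < d' by rewrite !lt_min d10 d20.
have m1 : d' <= d1 by rewrite !ge_min lexx.
have m2 : d' <= d2 by rewrite !ge_min lexx orbT.
have m3 : d' <= d by rewrite !ge_min lexx orbT.
have /cvgrPdist_le/(_ _ eta0) E1 := e_null s0.
have /cvgrPdist_le/(_ _ eta0) E2 := e_null t0.
have /cvgrPdist_le/(_ _ eta0) E3 := XQ s0.
have /cvgrPdist_le/(_ _ eta0) E4 := XQ t0.
apply: filterS (filterI (partition_sum_split Pi_part Pi_mesh s0 st d'0)
  (filterI (filterI E1 E2) (filterI E3 E4))) => n.
move=> [[k [j [/andP[k1 k2] /andP[k3 k4] /andP[j1 j2] kj E]]] [[h1 h2] [h3 h4]]].
rewrite !sub0r !normrN in h1 h2; rewrite !qv_sumE in h3 h4.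
rewrite (E e e0) in h2.
rewrite (E (fun x z => (X z - X x) ^+ 2) sq0) in h4.
have pk0 := partition_ge0 (Pi_part n) k.
have pkj : Pi n k.+1 <= Pi n j by exact: partition_le.
exists k, j; split => //.
- by split => //; apply: lt_le_trans k4 _; rewrite lerD2l.
- by split => //; apply: le_lt_trans j1; rewrite lerB.
- have b1 : `|e (Pi n k) (Pi n k.+1) - e (Pi n k) s| <= eta.
    by apply: H1 => //; apply: lt_le_trans k4 _; rewrite lerD2l.
  move: h1 h2 b1.
  move: (partition_sum _ _ _) (e _ (Pi n k.+1) - _) (interior_sum _ _ _ _ + _) => u v z.
  by rewrite !ler_norml; lra.
- split=> //; have b2 : `|(X (Pi n k.+1) - X (Pi n k)) ^+ 2 - (X s - X (Pi n k)) ^+ 2| <= eta.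
    by apply: H2 => //; apply: lt_le_trans k4 _; rewrite lerD2l.
  move: h3 h4 b2.
  move: (partition_sum _ _ _) ((X (Pi n k.+1) - _) ^+ 2 - _) (interior_sum _ _ _ _ + _) => u v z.
  by rewrite !ler_norml; lra.
Qed.

(** H is a primitive of xi along X on [lo, hi[, up to second-order terms in X
    and terms of the order of dM. *)
Definition ito_primitive lo hi H C :=
  (forall x z, lo <= x -> x <= z -> z < hi ->
    `|H z - H x - xi x * (X z - X x)| <= C * ((X z - X x) ^+ 2 + (M z - M x))) /\
  (forall x eta, lo <= x -> x < hi -> 0 < eta -> exists2 d, 0 < d &
    forall z, x <= z -> z < x + d -> z < hi -> `|H z - H x| <= eta).

Section OnInterval.
Variables (lo hi C : R) (H : R -> R).
Hypotheses (lo0 : 0 <= lo) (C0 : 0 <= C) (HH : ito_primitive lo hi H C).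

(** The path Y - H has the increments e - (dH - xi dX) along a partition.  The
    sum of e tends to 0 and the sum of the other term is at most C (dQ + dM), so
    the increments of Y - H over any interval are at most 2 C dM; the bound
    of the primitive then transfers to Y. *)
Lemma sol_err_le s t : lo <= s -> s <= t -> t < hi ->
  `|e s t| <= C * (3 * (M t - M s) + (X t - X s) ^+ 2).
Proof.
move=> los; rewrite le_eqVlt => /orP[/eqP <- _|st thi].
  by rewrite e0 normr0 !subrr mulr0 expr0n addr0 mulr0.
have s0 : 0 <= s by exact: le_trans los.
have [H1 H2] := HH.
pose G z := Y z - H z.
suff GG : `|G t - G s| <= C * (2 * (M t - M s)).
  have -> : e s t = (G t - G s) + (H t - H s - xi s * (X t - X s)).
    by rewrite /e /sol_err /G; ring.
  apply: le_trans (ler_normD _ _) _; apply: le_trans (lerD GG (H1 s t los (ltW st) thi)) _.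
  by rewrite le_eqVlt; apply/orP; left; apply/eqP; ring.
have c0 : 0 <= 5 + 3 * C by rewrite addr_ge0 // mulr_ge0.
apply: (le_of_eps c0) => eta eta0.
have [d1 d10 D1] := H2 s eta los (lt_trans st thi) eta0.
have [d2 d20 D2] := cadlag_right cY s0 eta0.
pose d := Num.min d1 d2.
have d0 : 0 < d by rewrite lt_min d10.
have [n [k [j [[k0 k1 k2 k3] [j1 j2] [kj pkj] Ee [Eq _]]]]] :=
  filter_ex (approx s0 st eta0 d0).
set u := Pi n k.+1 in k2 k3 pkj; set v := Pi n j in j1 j2 pkj Ee Eq.
have k3' r : d <= r -> u < s + r by move=> dr; rewrite (lt_le_trans k3) // lerD2l.
have lou : lo <= u by exact: le_trans los (ltW k2).
have h1 : `|H u - H s| <= eta.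
  apply: D1 => //; [exact: ltW|by apply: k3'; rewrite ge_min lexx|].
  exact: le_lt_trans pkj (lt_trans j2 thi).
have h2 : `|Y u - Y s| <= eta.
  by apply/ltW/D2 => //; [exact: ltW|apply: k3'; rewrite ge_min lexx orbT].
pose e' x z := H z - H x - xi x * (X z - X x).
have E : interior_sum (Pi n) e k.+1 j + e v t
    = (G t - G u) + (interior_sum (Pi n) e' k.+1 j + e' v t).
  have -> : interior_sum (Pi n) e k.+1 j = interior_sum (Pi n) (fun x z => (G z - G x) + e' x z) k.+1 j.
    by apply: eq_interior_sum => // x z _ _ _; rewrite /e /sol_err /e' /G; ring.
  rewrite interior_sumD interior_sum_telescope // -/u -/v /e /sol_err /e' /G; ring.
have E' : `|interior_sum (Pi n) e' k.+1 j + e' v t|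
    <= C * (interior_sum (Pi n) (fun x z => (X z - X x) ^+ 2) k.+1 j + (X t - X v) ^+ 2
       + (M t - M u)).
  apply: le_trans (ler_normD _ _) _.
  have -> : C * (interior_sum (Pi n) (fun x z => (X z - X x) ^+ 2) k.+1 j + (X t - X v) ^+ 2
       + (M t - M u))
     = interior_sum (Pi n) (fun x z => C * ((X z - X x) ^+ 2 + (M z - M x))) k.+1 j
       + C * ((X t - X v) ^+ 2 + (M t - M v)).
    by rewrite interior_sumZ interior_sumD interior_sum_telescope // -/u -/v; ring.
  apply: lerD; last by apply: H1; [exact: le_trans pkj|exact: ltW|].
  apply: interior_sum_norm_le => // x z; rewrite -/u -/v => ux xz zv.
  apply: H1 => //; first exact: le_trans ux.
  exact: le_lt_trans zv (lt_trans j2 thi).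
have E3 : `|interior_sum (Pi n) e' k.+1 j + e' v t| <= C * (2 * (M t - M s) + 3 * eta).
  apply: le_trans E' _; apply: ler_wpM2l => //.
  have := le_trans (ler_norm _) Eq; rewrite lerBlDr => Iq.
  have -> : 2 * (M t - M s) + 3 * eta = 3 * eta + (M t - M s) + (M t - M s) by ring.
  apply: lerD; last by rewrite lerD2l lerN2 Mmono // ltW.
  by apply: le_trans Iq _; rewrite lerD2l; apply: QM => //; exact: ltW.
have -> : G t - G s = (interior_sum (Pi n) e k.+1 j + e v t)
    - (interior_sum (Pi n) e' k.+1 j + e' v t) + ((Y u - Y s) - (H u - H s)).
  by rewrite E /G; ring.
apply: le_trans (ler_normD _ _) _.
apply: le_trans (lerD (ler_normB _ _) (ler_normB _ _)) _.
apply: le_trans (lerD (lerD Ee E3) (lerD h2 h1)) _.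
by rewrite le_eqVlt; apply/orP; left; apply/eqP; ring.
Qed.

(** For N = phi xi X, the increment of N / X from x to z is
    (phi_x e + eta) / X_z with eta = dN - phi dY.  Writing
    phi_x / X_z = a0 + O(om), the constant part sums up to a0 times the sum
    of e, which vanishes, and the rest is at most om times the sum of |e|. *)
Lemma ratio_incr_le (N phi : R -> R) (rho a0 om : R) s t :
  cadlag N -> cadlag phi ->
  (forall t, 0 <= t -> partition_sum (Pi n)
     (fun x z => `|N z - N x - phi x * (Y z - Y x)|) t @[n --> \oo] --> 0) ->
  cadlag (fun t => N t / X t) ->
  lo <= s -> s <= t -> t < hi -> 0 <= om -> 0 < rho ->
  (forall x, s <= x -> x <= t -> rho <= `|X x|) ->
  (forall x, s <= x -> x <= t -> N x = phi x * xi x * X x) ->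
  (forall x z, s <= x -> x <= z -> z <= t -> `|phi x / X z - a0| <= om) ->
  `|N t / X t - N s / X s| <= om * (C * (4 * (M t - M s))).
Proof.
move=> cN cphi Nnull cNX los + thi om0 rho0 Xrho NE aom.
rewrite le_eqVlt => /orP[/eqP <-|st].
  by rewrite !subrr normr0 !mulr0.
have s0 : 0 <= s by exact: le_trans los.
have t0 : 0 <= t by lra.
pose eta_ x z := N z - N x - phi x * (Y z - Y x).
have eta_0 x : eta_ x x = 0 by rewrite /eta_ !subrr mulr0 subr0.
pose Rt z := N z / X z.
have MQ : Q t - Q s <= M t - M s by apply: QM => //; exact: ltW.
have crho : 0 <= 3 / rho by rewrite divr_ge0 // ltW.
have c0 : 0 <= 1 + `|a0| * 3 + om * (C * 3) + 3 / rho.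
  by rewrite !addr_ge0 // !mulr_ge0.
apply: (le_of_eps c0) => eta eta0.
have [d1 d10 D1] := cadlag_right cNX s0 eta0.
have [d2 d20 D2] := lin_border cN cY cphi s0 eta0.
pose d := Num.min d1 d2.
have d0 : 0 < d by rewrite lt_min d10.
have /cvgrPdist_le/(_ _ eta0) N2 := Nnull t t0.
have [n [[k [j [[k0 k1 k2 k3] [j1 j2] [kj pkj] Ee [Eq E]]]] Nt]] :=
  filter_ex (filterI (approx s0 st eta0 d0) N2).
set u := Pi n k.+1 in k2 k3 pkj; set v := Pi n j in j1 j2 pkj Ee Eq.
rewrite sub0r normrN in Nt.
have k3' r : d <= r -> u < s + r by move=> dr; rewrite (lt_le_trans k3) // lerD2l.
have su := ltW k2; have vt := ltW j2; have sv := le_trans su pkj.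
have Eeta : interior_sum (Pi n) (fun x z => `|eta_ x z|) k.+1 j + `|eta_ v t| <= 2 * eta.
  have abs0 x : `|eta_ x x| = 0 by rewrite eta_0 normr0.
  have partition_sum_ge0 r : 0 <= r -> 0 <= partition_sum (Pi n) (fun x z => `|eta_ x z|) r.
    move=> r0; apply: le_trans (normr_ge0 (partition_sum (Pi n) eta_ r)) _.
    by apply: partition_sum_norm_le.
  have b : `|eta_ (Pi n k) u - eta_ (Pi n k) s| <= eta.
    by rewrite /eta_; apply: D2 => //; apply: k3'; rewrite ge_min lexx orbT.
  have b' := lerB_dist (eta_ (Pi n k) s) (eta_ (Pi n k) u).
  rewrite distrC in b'.
  have := partition_sum_ge0 s s0; move: Nt; rewrite (ger0_norm (partition_sum_ge0 t t0)).
  rewrite (E (fun x z => `|eta_ x z|) abs0) -/u -/v.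
  move: (partition_sum _ _ _) (interior_sum _ _ _ _) => p1 p2 h1 h2.
  have h3 : `|eta_ (Pi n k) s| - `|eta_ (Pi n k) u| <= eta := le_trans b' b.
  by lra.
have RtE x z : s <= x -> x <= z -> z <= t ->
    Rt z - Rt x = a0 * e x z + ((phi x / X z - a0) * e x z + eta_ x z / X z).
  move=> sx xz zt.
  have X0 r : s <= r -> r <= t -> X r != 0.
    by move=> sr rt; rewrite -normr_gt0; exact: lt_le_trans (Xrho r sr rt).
  have Xx := X0 x sx (le_trans xz zt); have Xz := X0 z (le_trans sx xz) zt.
  have NX : N x / X x = phi x * xi x by rewrite NE ?mulfK //; exact: le_trans zt.
  by rewrite /Rt NX /e /sol_err /eta_ (NE x) ?(le_trans xz zt) //; field.
pose r1 x z := (phi x / X z - a0) * e x z + eta_ x z / X z.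
pose b1 x z := om * (C * (3 * (M z - M x) + (X z - X x) ^+ 2)) + rho^-1 * `|eta_ x z|.
have r1b x z : s <= x -> x <= z -> z <= t -> `|r1 x z| <= b1 x z.
  move=> sx xz zt; apply: le_trans (ler_normD _ _) _; rewrite !normrM; apply: lerD.
    by apply: ler_pM => //; [exact: aom|apply: sol_err_le => //;
      [exact: le_trans sx|exact: le_lt_trans zt thi]].
  rewrite mulrC; apply: ler_pM => //; rewrite normfV lef_pV2 ?posrE //.
    by apply: Xrho => //; exact: le_trans xz.
  by apply: lt_le_trans rho0 _; apply: Xrho => //; exact: le_trans xz.
have R1 : Rt t - Rt s = (Rt u - Rt s) + a0 * (interior_sum (Pi n) e k.+1 j + e v t)
    + (interior_sum (Pi n) r1 k.+1 j + r1 v t).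
  have -> : Rt t - Rt s = (Rt u - Rt s) + (interior_sum (Pi n) (fun x z => Rt z - Rt x) k.+1 j
     + (Rt t - Rt v)) by rewrite interior_sum_telescope // -/u -/v; ring.
  have -> : interior_sum (Pi n) (fun x z => Rt z - Rt x) k.+1 j
     = interior_sum (Pi n) (fun x z => a0 * e x z + r1 x z) k.+1 j.
    apply: eq_interior_sum => // x z; rewrite -/u -/v => ux xz zv.
    by apply: RtE => //; [exact: le_trans ux|exact: le_trans zv vt].
  by rewrite interior_sumD interior_sumZ (RtE v t sv vt (lexx t)) /r1; ring.
have R2 : `|interior_sum (Pi n) r1 k.+1 j + r1 v t| <= interior_sum (Pi n) b1 k.+1 j + b1 v t.
  apply: le_trans (ler_normD _ _) _; apply: lerD; last exact: r1b.
  apply: interior_sum_norm_le => // x z; rewrite -/u -/v => ux xz zv.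
  by apply: r1b => //; [exact: le_trans ux|exact: le_trans zv vt].
have R3 : interior_sum (Pi n) b1 k.+1 j + b1 v t
    = om * (C * (3 * (M t - M u)
        + (interior_sum (Pi n) (fun x z => (X z - X x) ^+ 2) k.+1 j + (X t - X v) ^+ 2)))
      + rho^-1 * (interior_sum (Pi n) (fun x z => `|eta_ x z|) k.+1 j + `|eta_ v t|).
  by rewrite /b1 interior_sumD !interior_sumZ interior_sumD interior_sumZ interior_sum_telescope // -/u -/v; ring.
have R4 : om * (C * (3 * (M t - M u)
        + (interior_sum (Pi n) (fun x z => (X z - X x) ^+ 2) k.+1 j + (X t - X v) ^+ 2)))
     <= om * (C * (4 * (M t - M s) + 3 * eta)).
  apply: ler_wpM2l => //; apply: ler_wpM2l => //.
  have := le_trans (ler_norm _) Eq; rewrite lerBlDr => Iq.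
  have -> : 4 * (M t - M s) + 3 * eta = 3 * (M t - M s) + (3 * eta + (M t - M s)) by ring.
  apply: lerD; first by rewrite ler_pM2l // lerD2l lerN2 Mmono.
  by apply: le_trans Iq _; rewrite lerD2l.
have R5 : rho^-1 * (interior_sum (Pi n) (fun x z => `|eta_ x z|) k.+1 j + `|eta_ v t|)
     <= 3 / rho * eta.
  rewrite mulrC mulrAC ler_wpM2r ?invr_ge0 ?(ltW rho0) //.
  by apply: le_trans Eeta _; rewrite ler_pM2r // ler_nat.
have R6 : `|a0 * (interior_sum (Pi n) e k.+1 j + e v t)| <= `|a0| * (3 * eta).
  by rewrite normrM ler_wpM2l.
have R7 : `|Rt u - Rt s| <= eta by apply/ltW/D1 => //; apply: k3'; rewrite ge_min lexx.
rewrite -/(Rt t) -/(Rt s) R1.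
apply: le_trans (ler_normD _ _) _; apply: le_trans (lerD (ler_normD _ _) (lexx _)) _.
have -> : om * (C * (4 * (M t - M s))) + (1 + `|a0| * 3 + om * (C * 3) + 3 / rho) * eta
  = eta + `|a0| * (3 * eta) + (om * (C * (4 * (M t - M s) + 3 * eta)) + 3 / rho * eta).
  by ring.
apply: lerD; first exact: lerD.
by apply: le_trans R2 _; rewrite R3; exact: lerD.
Qed.

(** Although only the limits of the Riemann sums are prescribed, the solution
    jumps like the integral: the squared increments of X over [s, hi[ carry no
    mass near hi, because the jump of Q is the square of the jump of X. *)
Lemma sol_jump : lo < hi ->
  Y hi - left_lim Y hi - left_lim xi hi * (X hi - left_lim X hi) = 0.
Proof.
move=> lohi; have hi0 : 0 < hi by exact: le_lt_trans lohi.
set J := (X in X = 0); apply/eqP; rewrite -normr_le0.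
have c0 : 0 <= 4 + 8 * C by rewrite addr_ge0 // mulr_ge0.
apply: (le_of_eps c0) => eta eta0; rewrite add0r.
(* M is nondecreasing, so it has a finite left limit at hi. *)
have [d1 d10 D1] : exists2 d, 0 < d & forall s s', 0 <= s -> hi - d < s ->
    s <= s' -> s' < hi -> M s' - M s <= eta.
  have supE : has_sup (M @` `[0, hi[).
    split; first by exists (M 0), 0 => //=; rewrite in_itv /= lexx.
    exists (M hi) => _ [x /= + <-]; rewrite in_itv /= => /andP[x0 xh].
    by apply: Mmono => //; exact: ltW.
  have [_ [s1 /= + <-] Hs1] := sup_adherent eta0 supE.
  rewrite in_itv /= => /andP[s10 s1h]; exists (hi - s1); first by rewrite subr_gt0.
  move=> s s' s0 s1s ss' s'h.
  have h1 : M s1 <= M s by apply: Mmono => //; lra.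
  have h2 : M s' <= sup (M @` `[0, hi[).
    by apply: ub_le_sup; [exact: supE.2|exists s' => //=; rewrite in_itv /=; apply/andP; split; lra].
  move: h1 h2 Hs1; move: (M s1) (M s) (M s') => w1 w2 w3; lra.
have [d2 d20 D2] := cadlag_left cQ hi0 eta0.
pose d3 := Num.min (Num.min d1 d2) (hi - lo).
have d30 : 0 < d3 by rewrite !lt_min d10 d20 subr_gt0.
have m1 : d3 <= d1 by rewrite !ge_min lexx.
have m2 : d3 <= d2 by rewrite !ge_min lexx orbT.
have m3 : d3 <= hi - lo by rewrite !ge_min lexx orbT.
have [s [los shi sd1 sd2]] : exists s, [/\ lo <= s, s < hi, hi - d1 < s & hi - d2 < s].
  by exists (hi - d3 / 2); split; lra.
have s0 : 0 <= s by exact: le_trans los.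
have eJ : e v hi @[v --> hi^'-] --> J.
  apply: cvgB; first by apply: cvgB; [exact: cvg_cst|exact: cadlag_left_cvg].
  apply: cvgM; first exact: cadlag_left_cvg.
  by apply: cvgB; [exact: cvg_cst|exact: cadlag_left_cvg].
have XJ : (X hi - X v) ^+ 2 @[v --> hi^'-] --> jump X hi ^+ 2.
  rewrite /jump expr2; under eq_fun do rewrite expr2.
  by apply: cvgM; apply: cvgB; [exact: cvg_cst|exact: cadlag_left_cvg|exact: cvg_cst|exact: cadlag_left_cvg].
have [d4 d40 D4] := at_left_eps eta0 eJ.
have [d5 d50 D5] := at_left_eps eta0 XJ.
pose d := Num.min d4 d5.
have d0 : 0 < d by rewrite lt_min d40.
have [n [k [j [[k0 k1 k2 k3] [j1 j2] [kj pkj] Ee [Eq _]]]]] :=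
  filter_ex (approx s0 shi eta0 d0).
set u := Pi n k.+1 in k2 k3 pkj; set v := Pi n j in j1 j2 pkj Ee Eq.
have lou : lo <= u by exact: le_trans los (ltW k2).
have j1' r : d <= r -> hi - r < v by move=> dr; apply: le_lt_trans j1; rewrite lerB.
have F1 : `|interior_sum (Pi n) e k.+1 j| <= C * (3 * (M v - M u)
    + interior_sum (Pi n) (fun x z => (X z - X x) ^+ 2) k.+1 j).
  have -> : C * (3 * (M v - M u) + interior_sum (Pi n) (fun x z => (X z - X x) ^+ 2) k.+1 j)
    = interior_sum (Pi n) (fun x z => C * (3 * (M z - M x) + (X z - X x) ^+ 2)) k.+1 j.
    by rewrite interior_sumZ interior_sumD interior_sumZ interior_sum_telescope.
  apply: interior_sum_norm_le => // x z; rewrite -/u -/v => ux xz zv.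
  by apply: sol_err_le => //; [exact: le_trans ux|exact: le_lt_trans zv j2].
have F2 : M v - M u <= eta.
  apply: le_trans (D1 s v s0 sd1 (le_trans (ltW k2) pkj) j2).
  by rewrite lerD2l lerN2; apply: Mmono => //; exact: ltW.
have F3 : `|Q s - left_lim Q hi| < eta by exact: D2.
have F4 : `|(X hi - X v) ^+ 2 - jump X hi ^+ 2| < eta by apply: D5 => //; apply: j1'; rewrite ge_min lexx orbT.
have F5 : `|e v hi - J| < eta by apply: D4 => //; apply: j1'; rewrite ge_min lexx.
have F6 : C * (3 * (M v - M u) + interior_sum (Pi n) (fun x z => (X z - X x) ^+ 2) k.+1 j)
    <= C * (8 * eta).
  apply: ler_wpM2l => //; move: F2 F3 F4 Eq; have := Qjump (ltW hi0).
  rewrite {1}/jump => <-; move: (M v - M u) (interior_sum _ _ _ _) ((X hi - X v) ^+ 2) => w1 w2 w3.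
  by rewrite !ltr_norml ler_norml; lra.
move: Ee F5 (le_trans F1 F6); have -> : (4 + 8 * C) * eta = 4 * eta + C * (8 * eta) by ring.
move: (interior_sum _ _ _ _) (e v hi) (C * (8 * eta)) => w1 w2 w3.
by rewrite ltr_norml !ler_norml; lra.
Qed.

End OnInterval.
End Local.
End LocalComparison.

(** * Paths of finite variation in several dimensions *)

Section VectorPaths.
Context {R : realType}.
Implicit Types (s t x z d r eps eta om delta C L T lo hi rho : R).

Lemma at_right_near (P : R -> Prop) (x : R) : (\forall z \near x^'+, P z) ->
  exists2 d, 0 < d & forall z, x < z -> z < x + d -> P z.
Proof.
move=> [d /= d0 Hd]; exists d => // z xz zd; apply: Hd => //=.
by rewrite distrC ger0_norm; lra.
Qed.

Lemma at_left_near (P : R -> Prop) (x : R) : (\forall z \near x^'-, P z) ->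
  exists2 d, 0 < d & forall z, x - d < z -> z < x -> P z.
Proof.
move=> [d /= d0 Hd]; exists d => // z xz zd; apply: Hd => //=.
by rewrite ger0_norm; lra.
Qed.

Lemma prod_close (c c0 U U0 KU om : R) : 0 < om -> 0 <= KU -> `|U| <= KU ->
  `|c - c0| <= om / (2 * (KU + 1)) -> `|U - U0| <= om / (2 * (`|c0| + 1)) ->
  `|c * U - c0 * U0| <= om.
Proof.
move=> om0 KU0 HU Hc HUU; have n0 := normr_ge0 c0.
have -> : c * U - c0 * U0 = (c - c0) * U + c0 * (U - U0) by ring.
apply: le_trans (ler_normD _ _) _; rewrite !normrM.
have h1 : `|c - c0| * `|U| <= om / 2.
  apply: le_trans (ler_pM _ _ Hc HU) _ => //.
  rewrite invfM mulrA mulrAC ler_pdivrMr; last lra.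
  by rewrite ler_wpM2l; lra.
have h2 : `|c0| * `|U - U0| <= om / 2.
  apply: le_trans (ler_wpM2l n0 HUU) _.
  have q0 : 0 <= om / (2 * (`|c0| + 1)) by apply: divr_ge0; lra.
  have E : (`|c0| + 1) * (om / (2 * (`|c0| + 1))) = om / 2 by field; lra.
  by rewrite -E ler_wpM2r //; lra.
lra.
Qed.

Section Variation.
Variables (m : nat) (A : R -> 'rV[R]_m).
Hypothesis AFV : forall j : 'I_m, FV_loc (fun t => A t 0 j).

Definition vec_variation t : R := \sum_j fine (total_variation 0 t (fun t => A t 0 j)).

Lemma vec_variation_ge s t : 0 <= s -> s <= t ->
  \sum_j `|A t 0 j - A s 0 j| <= vec_variation t - vec_variation s.
Proof.
move=> s0 st; rewrite /vec_variation -sumrB; apply: ler_sum => j _.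
have t0 := le_trans s0 st.
have [_ bvA] := AFV j.
have bvt : bounded_variation 0 t (fun t => A t 0 j).
  move: t0; rewrite le_eqVlt => /orP[/eqP <-|t0]; first exact: bounded_variationxx.
  exact: bvA.
have fin_t := (bounded_variationP _ t0).1 bvt.
have fin_s := (bounded_variationP _ s0).1 (bounded_variationl s0 st bvt).
have fin_st := (bounded_variationP _ st).1 (bounded_variationr s0 st bvt).
rewrite (total_variationD _ s0 st) fineD // addrAC subrr add0r.
by rewrite -lee_fin fineK //; exact: total_variation_ge.
Qed.

Lemma vec_variation_mono s t : 0 <= s -> s <= t ->
  vec_variation s <= vec_variation t.
Proof.
move=> s0 st; rewrite -subr_ge0; apply: le_trans (vec_variation_ge s0 st).
exact: sumr_ge0.
Qed.

Lemma vec_right_close t eps : 0 <= t -> 0 < eps -> exists2 d, 0 < d &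
  forall s, t <= s -> s < t + d -> forall j, `|A s 0 j - A t 0 j| < eps.
Proof.
move=> t0 eps0.
have [d d0 Hd] : exists2 d, 0 < d & forall z, t < z -> z < t + d ->
    forall j, `|A z 0 j - A t 0 j| < eps.
  apply: at_right_near.
  apply: (@filter_forall _ 'I_m (fun j => [set z | `|A z 0 j - A t 0 j| < eps]) (t^'+)) => j.
  have [[rA _] _] := AFV j; have /cvgrPdist_lt/(_ _ eps0) := rA t t0.
  by apply: filterS => z; rewrite /= distrC.
exists d => // s; rewrite le_eqVlt => /orP[/eqP <- _ j|ts std]; last exact: Hd.
by rewrite subrr normr0.
Qed.

Definition vec_left t : 'rV[R]_m := \row_j left_lim (fun t => A t 0 j) t.

Lemma vec_left_close t eps : 0 < t -> 0 < eps -> exists2 d, 0 < d &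
  forall s, t - d < s -> s < t -> forall j, `|A s 0 j - vec_left t 0 j| < eps.
Proof.
move=> t0 eps0; apply: at_left_near.
apply: (@filter_forall _ 'I_m (fun j => [set z | `|A z 0 j - vec_left t 0 j| < eps])
  (t^'-)) => j.
have [cA _] := AFV j; have /cvgrPdist_lt/(_ _ eps0) := cadlag_left_cvg cA t0.
by apply: filterS => z; rewrite /= mxE distrC.
Qed.

End Variation.

(** This places the left limits of the path (A, X) inside D, where f is
    differentiable. *)
Lemma relatively_compact_closure m (D S : set ('rV[R]_m * R)) :
  relatively_compact_in D S -> closure S `<=` D.
Proof.
move=> [SD cK].
have clK : closed (closure S `&` D).
  by apply: compact_closed => //; exact: norm_hausdorff.
have SK : S `<=` closure S `&` D by move=> p Sp; split; [exact: subset_closure|exact: SD].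
move=> p /(closure_subset SK); rewrite -(closure_id _).1 // => -[].
by [].
Qed.

End VectorPaths.

(** * The Azema-Yor transform of a solution *)

Section SolutionInverse.
Context {R : realType}.
Implicit Types (s t x z d r eps eta om delta C L T lo hi rho : R).
Variables (astar : R) (w V phi : R -> R).
Hypotheses (w_C1 : C1_from astar w) (VS : C1_slope astar V phi)
  (phiV : forall y, astar <= y -> V y = phi y * (y - w y)).
Variable Pi : nat -> nat -> R.
Hypotheses (Pi_part : forall n, is_partition (Pi n))
  (Pi_mesh : mesh (Pi n) @[n --> \oo] --> 0%E).

Variables (X Y : R -> R).
Hypotheses (QX : QV Pi X) (X0 : X 0 = V astar) (solY : is_solution Pi astar w X Y)
  (Ymc : path_continuous (running_max Y)).
Let y := running_max Y.
Let xi := integrand w X Y.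

Let cX : cadlag X. Proof. by case: QX. Qed.
Let cY : cadlag Y. Proof. by case: solY => [[]]. Qed.

Let X_neq0 t : 0 <= t -> X t != 0 /\ left_lim X t != 0.
Proof. by case: solY => _ + _; apply. Qed.

Let cxi : cadlag xi.
Proof. by case: solY => _ _ /(_ 0 (lexx _))[I []]. Qed.

Lemma solution_start : Y 0 = astar.
Proof.
case: solY => _ _ /(_ 0 (lexx _))[I [_ cvI] ->].
suff -> : I = 0 by rewrite addr0.
have E n : riemann_sum (Pi n) (integrand w X Y) X 0 = 0.
  by rewrite riemann_sumE // partition_sum0 // => x; rewrite subrr mulr0.
rewrite (_ : (fun n => _) = fun=> 0) in cvI; last exact/funext.
by apply: (cvg_unique _ cvI (cvg_cst _)).
Qed.

Let ay t : 0 <= t -> astar <= y t.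
Proof.
by move=> t0; rewrite -solution_start; exact: running_max_ge.
Qed.

Let y0 : y 0 = astar.
Proof. by rewrite /y running_max0 // solution_start. Qed.

Let ymono s t : 0 <= s -> s <= t -> y s <= y t.
Proof. exact: running_max_mono. Qed.

Let wc : path_continuous (fun t => w (y t)).
Proof. exact: (loc_lip_path_continuous (C1_from_loc_lip w_C1)). Qed.

Let phi_lip : loc_lip astar phi. Proof. by case: VS. Qed.

Let phic : path_continuous (fun t => phi (y t)).
Proof. exact: (loc_lip_path_continuous (phi_lip)). Qed.

Let Vc : path_continuous (fun t => V (y t)).
Proof. exact: (loc_lip_path_continuous (slope_loc_lip VS)). Qed.

Let N := ay_path Y (fun t => V (y t)) (fun t => phi (y t)).

Let NE t : 0 <= t -> N t = phi (y t) * (Y t - w (y t)).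
Proof.
by move=> t0; rewrite /N /ay_path -/y phiV ?ay //; ring.
Qed.

Let cN : cadlag N.
Proof.
apply: (@cadlag_ext _ (fun t => phi (y t) * (Y t - w (y t)))) => [t t0|].
  by rewrite NE.
apply: cadlagM; first exact: path_continuous_cadlag.
by apply: cadlagB => //; exact: path_continuous_cadlag.
Qed.

Let cNX : cadlag (fun t => N t / X t).
Proof. by apply: cadlagM => //; exact: cadlagV. Qed.

Let Nxi t : 0 <= t -> N t = phi (y t) * xi t * X t.
Proof.
move=> t0; rewrite NE // /xi /integrand -/y -mulrA divfK //.
by case: (X_neq0 t0).
Qed.

Let N_null t : 0 <= t ->
  partition_sum (Pi n) (fun x z => `|N z - N x - phi (y x) * (Y z - Y x)|) t @[n --> \oo] --> 0.
Proof. exact: (ay_sum_cvg cY Ymc (ay_data_V VS cY ay)). Qed.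

Let e_null t : 0 <= t -> partition_sum (Pi n) (sol_err X Y xi) t @[n --> \oo] --> 0.
Proof.
move=> t0; case: solY => _ _ /(_ t t0)[I [_ cvI] YI].
have -> : (fun n => partition_sum (Pi n) (sol_err X Y xi) t)
    = (fun n => I - riemann_sum (Pi n) xi X t).
  apply/funext => n; rewrite riemann_sumE //; apply/eqP; rewrite eq_sym subr_eq.
  rewrite -partition_sumD // => [|x|x]; last 2 first.
  - by rewrite /sol_err !subrr mulr0 subr0.
  - by rewrite subrr mulr0.
  have -> : I = Y t - Y 0 by rewrite YI solution_start addrAC subrr add0r.
  rewrite -(partition_sum_telescope Y (Pi_part n) t0); apply/eqP.
  apply: eq_partition_sum => // [x|x|x z _ _ _]; rewrite /sol_err ?subrr ?mulr0 ?subr0 ?addr0 //.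
  by rewrite subrK.
rewrite -(subrr I); apply: cvgB; first exact: cvg_cst.
exact: cvI.
Qed.

Let xi_left t : 0 < t -> left_lim xi t = (left_lim Y t - w (y t)) / left_lim X t.
Proof.
move=> t0; apply: left_lim_eq => //; apply: cvgM.
  by apply: cvgB; [exact: cadlag_left_cvg|exact: (path_continuous_left wc)].
by apply: cvgV; [case: (X_neq0 (ltW t0))|exact: cadlag_left_cvg].
Qed.

Section Ratio.
Variables (Q : R -> R) (T : R).
Hypotheses (cQ : cadlag Q)
  (Qmono : forall s t, 0 <= s -> s <= t -> Q s <= Q t)
  (XQ : forall t, 0 <= t -> qv_sum (Pi n) X t @[n --> \oo] --> Q t)
  (Qjump : forall t, 0 <= t -> jump Q t = jump X t ^+ 2)
  (T0 : 0 < T).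
Variables (m : nat) (D : set ('rV[R]_m * R)) (f : 'rV[R]_m * R -> R)
  (A : R -> 'rV[R]_m).
Hypotheses (fC12 : class_C12 D f)
  (AFV : forall j : 'I_m, FV_loc (fun t => A t 0 j))
  (Yf : forall t, 0 <= t <= T -> Y t = 'D_dir_x f (A t, X t))
  (ADc : relatively_compact_in D [set (A t, X t) | t in `[0, T]]).
Variable Lw : R.
Hypotheses (Lw0 : 0 <= Lw) (HLw : forall x z, astar <= x -> x <= z -> z <= y T ->
  `|w z - w x| <= Lw * (z - x)).

Let K t := vec_variation A t + Lw * y t.

Let Kmono s t : 0 <= s -> s <= t -> K s <= K t.
Proof.
move=> s0 st; apply: lerD; first exact: vec_variation_mono.
by apply: ler_wpM2l => //; exact: ymono.
Qed.

Let M t := Q t + K t.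

Let QM s t : 0 <= s -> s <= t -> Q t - Q s <= M t - M s.
Proof. by move=> s0 st; have := Kmono s0 st; rewrite /M; lra. Qed.

Let KM s t : 0 <= s -> s <= t -> K t - K s <= M t - M s.
Proof. by move=> s0 st; have := Qmono s0 st; rewrite /M; lra. Qed.

Let Mmono s t : 0 <= s -> s <= t -> M s <= M t.
Proof. by move=> s0 st; apply: lerD; [exact: Qmono|exact: Kmono]. Qed.

Let in0T t : 0 <= t -> t <= T -> D (A t, X t).
Proof.
move=> t0 tT; apply: ADc.1; exists t => //=; by rewrite in_itv /= t0.
Qed.

Let left_in t : 0 < t -> t <= T -> D (vec_left A t, left_lim X t).
Proof.
move=> t0 tT; apply: (relatively_compact_closure ADc) => B /nbhs_box[r r0 Hr].
have [d1 d10 H1] := vec_left_close AFV t0 r0.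
have [d2 d20 H2] := cadlag_left cX t0 r0.
pose d := Num.min (Num.min d1 d2) t.
have d0 : 0 < d by rewrite !lt_min d10 d20.
have m1 : d <= d1 by rewrite !ge_min lexx.
have m2 : d <= d2 by rewrite !ge_min lexx orbT.
have m3 : d <= t by rewrite !ge_min lexx orbT.
exists (A (t - d / 2), X (t - d / 2)); split.
  by exists (t - d / 2) => //=; rewrite in_itv /=; apply/andP; split; lra.
apply: Hr; split => [j|] /=; first by apply: H1; lra.
by apply: H2; lra.
Qed.

(** The local function F evaluated along (A, w(y), X) is a primitive of xi
    while (A, X) stays in a box. *)
Let primitive p : D p -> p.2 != 0 -> exists r C, [/\ 0 < r, 0 <= C &
  forall lo hi, 0 <= lo -> hi <= T ->
    (forall x, lo <= x -> x < hi -> box p r (A x, X x)) ->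
    exists H, ito_primitive X xi M lo hi H C].
Proof.
move=> Dp p20.
have [W W0 HW] := cadlag_bounded (path_continuous_cadlag wc) (ltW T0).
have [r [F [C [r0 C0 HF]]]] := local_ito fC12 Dp p20 (ltW W0).
exists r, C; split => //.
move=> lo hi lo0 hiT Hbox; exists (fun x => F (A x) (w (y x)) (X x)).
have T0' := T0.
have xiE x : 0 <= x -> x <= T ->
    xi x = ('D_dir_x f (A x, X x) - w (y x)) / X x.
  by move=> x0 xT; rewrite /xi /integrand Yf // x0.
have bound x z : lo <= x -> x <= z -> z < hi ->
    `|F (A z) (w (y z)) (X z) - F (A x) (w (y x)) (X x) - xi x * (X z - X x)|
    <= C * ((X z - X x) ^+ 2 + (\sum_j `|A z 0 j - A x 0 j| + `|w (y z) - w (y x)|)).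
  move=> lox xz zhi; rewrite xiE; [|lra|lra].
  have x0 := le_trans lo0 lox; have zT := ltW (lt_le_trans zhi hiT).
  apply: HF.
  - by apply: Hbox => //; exact: le_lt_trans xz zhi.
  - by apply: Hbox => //; exact: le_trans xz.
  - by apply: HW => //; exact: le_trans zT.
  - by apply: HW => //; exact: le_trans xz.
split.
  move=> x z lox xz zhi; apply: le_trans (bound x z lox xz zhi) _.
  have x0 : 0 <= x by lra.
  apply: ler_wpM2l => //; rewrite lerD2l; apply: le_trans (KM x0 xz).
  have h1 := vec_variation_ge AFV x0 xz.
  have h2 : `|w (y z) - w (y x)| <= Lw * (y z - y x).
    apply: HLw; [exact: ay|exact: ymono|apply: ymono; first exact: le_trans xz].
    exact: ltW (lt_le_trans zhi hiT).
  by apply: le_trans (lerD h1 h2) _; rewrite /K mulrBr; lra.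
move=> x eta lox xhi eta0.
have x0 : 0 <= x by lra.
pose c := `|xi x| + C * (1 + (m%:R + 1)).
have c0 : 0 <= c by rewrite addr_ge0 // mulr_ge0 // !addr_ge0.
pose eps := Num.min 1 (eta / (c + 1)).
have eps0 : 0 < eps by rewrite lt_min ltr01 divr_gt0 //; lra.
have eps1 : eps <= 1 by rewrite ge_min lexx.
have epsE : c * eps <= eta.
  have h : eps <= eta / (c + 1) by rewrite ge_min lexx orbT.
  rewrite ler_pdivlMr in h; last lra.
  by rewrite mulrC; apply: le_trans h; rewrite ler_wpM2l ?ltW //; lra.
have [d1 d10 H1] := cadlag_right cX x0 eps0.
have [d2 d20 H2] := vec_right_close AFV x0 eps0.
have [d3 d30 H3] := wc x0 eps0.
pose d := Num.min (Num.min d1 d2) d3.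
have m1 : d <= d1 by rewrite !ge_min lexx.
have m2 : d <= d2 by rewrite !ge_min lexx orbT.
have m3 : d <= d3 by rewrite !ge_min lexx orbT.
exists d; first by rewrite !lt_min d10 d20.
move=> z xz zd zhi.
have h1 : `|X z - X x| <= eps by apply/ltW; exact: H1 xz (ltD_mono m1 zd).
have h2 : \sum_j `|A z 0 j - A x 0 j| <= m%:R * eps.
  apply: (@le_trans _ _ (\sum_(j < m) eps)).
    by apply: ler_sum => j _; exact/ltW/(H2 z xz (ltD_mono m2 zd)).
  by rewrite sumr_const card_ord mulr_natl.
have h3 : `|w (y z) - w (y x)| <= eps.
  exact/ltW/(H3 z (le_trans x0 xz) (le_ltB d30 xz) (ltD_mono m3 zd)).
have h4 : (X z - X x) ^+ 2 <= eps.
  rewrite -[leLHS]ger0_norm ?sqr_ge0 // normrX expr2.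
  apply: le_trans (ler_pM _ _ h1 h1) _ => //.
  by rewrite ger_pMr.
have h5 : `|xi x * (X z - X x)| <= `|xi x| * eps.
  by rewrite normrM ler_wpM2l.
have h6 : C * ((X z - X x) ^+ 2 + (\sum_j `|A z 0 j - A x 0 j| + `|w (y z) - w (y x)|))
    <= C * (eps + (m%:R * eps + eps)).
  by apply: ler_wpM2l => //; apply: lerD => //; exact: lerD.
have h7 := le_trans (bound x z lox xz zhi) h6.
set DH := (X in `|X| <= eta).
have -> : DH = (DH - xi x * (X z - X x)) + xi x * (X z - X x) by ring.
apply: le_trans (ler_normD _ _) _; apply: le_trans (lerD h7 h5) _.
by apply: le_trans epsE; rewrite /c le_eqVlt; apply/orP; left; apply/eqP; ring.
Qed.

(** The inverse of X is cadlag because neither X nor its left limits vanish. *)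
Let X_inv : exists2 KU, 0 < KU & forall x, 0 <= x -> x <= T -> `|(X x)^-1| <= KU.
Proof. exact: cadlag_bounded (cadlagV cX X_neq0) (ltW T0). Qed.

Let ratio_step lo hi H C rhoi a1 eps s t : 0 <= lo -> hi <= T -> 0 <= C -> 0 < eps ->
  (forall x, 0 <= x -> x <= T -> `|(X x)^-1| <= rhoi) -> 0 < rhoi ->
  ito_primitive X xi M lo hi H C -> lo <= s -> s <= t -> t < hi ->
  (forall x z, s <= x -> x <= z -> z <= t ->
     `|phi (y x) / X z - a1| <= eps / (4 * C + 1)) ->
  `|N t / X t - N s / X s| <= eps * (M t - M s).
Proof.
move=> lo0 hiT C0 eps0 Xi rhoi0 HH los st thi Ha.
have s0 : 0 <= s by exact: le_trans los.
have C1 : 0 < 4 * C + 1 by lra.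
have om0 : 0 <= eps / (4 * C + 1) by apply/ltW/divr_gt0.
have rho0 : 0 < rhoi^-1 by rewrite invr_gt0.
have Mst : 0 <= M t - M s by rewrite subr_ge0 Mmono.
apply: le_trans (ratio_incr_le Pi_part Pi_mesh cX cY cxi Qmono XQ QM e_null lo0 C0 HH
  cN (path_continuous_cadlag phic) N_null cNX los st thi om0 rho0 _ _ Ha) _.
- move=> x sx xt; have x0 : 0 <= x by lra.
  have xT : x <= T by lra.
  have Xx : 0 < `|X x| by rewrite normr_gt0; case: (X_neq0 x0).
  by rewrite -[leRHS]invrK lef_pV2 ?posrE ?invr_gt0 // -normfV; exact: Xi.
- by move=> x sx xt; apply: Nxi; lra.
have -> : eps / (4 * C + 1) * (C * (4 * (M t - M s)))
  = eps * (M t - M s) * (4 * C / (4 * C + 1)) by field; rewrite gt_eqF.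
rewrite ler_piMr ?mulr_ge0 ?(ltW eps0) //.
by rewrite ler_pdivrMr // mul1r; lra.
Qed.

Let invX_cadlag : cadlag (fun x => (X x)^-1).
Proof. exact: cadlagV. Qed.

Let close_const (om KU : R) : 0 < om -> 0 < KU -> 0 < om / (2 * (KU + 1)).
Proof. by move=> om0 KU0; apply: divr_gt0; lra. Qed.

Let close_const' (om c : R) : 0 < om -> 0 < om / (2 * (`|c| + 1)).
Proof. by move=> om0; have := normr_ge0 c => c0; apply: divr_gt0; lra. Qed.

(** Just after t, the path (A, X) stays in a box around its value at t, and
    phi(y) / X is close to its value at t. *)
Let ratio_right eps t : 0 < eps -> 0 <= t -> t < T ->
  exists2 d, 0 < d & forall s, t < s -> s < t + d -> s <= T ->
    `|N s / X s - N t / X t| <= eps * (M s - M t).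
Proof.
move=> eps0 t0 tT.
have [KU KU0 HKU] := X_inv.
have [r [C [r0 C0 HC]]] := primitive (in0T t0 (ltW tT)) (X_neq0 t0).1.
have om0 : 0 < eps / (4 * C + 1) by apply: divr_gt0; lra.
have [d1 d10 H1] := cadlag_right cX t0 r0.
have [d2 d20 H2] := vec_right_close AFV t0 r0.
have [d3 d30 H3] := phic t0 (close_const om0 KU0).
have [d4 d40 H4] := cadlag_right invX_cadlag t0 (close_const' (phi (y t)) om0).
pose d := Num.min (Num.min (Num.min d1 d2) (Num.min d3 d4)) (T - t).
have d0 : 0 < d by rewrite !lt_min d10 d20 d30 d40 subr_gt0.
have m1 : d <= d1 by rewrite !ge_min lexx.
have m2 : d <= d2 by rewrite !ge_min lexx orbT.
have m3 : d <= d3 by rewrite !ge_min lexx !orbT.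
have m4 : d <= d4 by rewrite !ge_min lexx !orbT.
have m5 : d <= T - t by rewrite !ge_min lexx !orbT.
have hiT : t + d <= T by rewrite -lerBrDl.
have [|H HH] := HC t (t + d) t0 hiT.
  move=> x tx xd.
  by split => [j|] /=; [exact: H2 (ltD_mono m2 xd) j|exact: H1 (ltD_mono m1 xd)].
exists d => // s ts sd _.
apply: (ratio_step t0 hiT C0 eps0 HKU KU0 HH (lexx t) (ltW ts) sd).
  move=> x z tx xz zs; apply: (prod_close om0 (ltW KU0)).
  - apply: HKU; first exact: le_trans (le_trans tx xz).
    exact: le_trans zs (le_trans (ltW sd) hiT).
  - apply/ltW/H3; [exact: le_trans tx|exact: le_ltB|].
    exact: le_lt_trans (le_trans xz zs) (ltD_mono m3 sd).
  - apply/ltW/H4; first exact: le_trans xz.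
    exact: le_lt_trans zs (ltD_mono m4 sd).
Qed.

(** Just before t, the path (A, X) stays in a box around its left limit, and
    phi(y) / X is close to its left limit.  The bound extends to t itself because
    N / X has no jump at t, by the formula for the jump of Y. *)
Let ratio_left eps t : 0 < eps -> 0 < t -> t <= T ->
  exists2 d, 0 < d & forall s, 0 <= s -> t - d < s -> s < t ->
    `|N t / X t - N s / X s| <= eps * (M t - M s).
Proof.
move=> eps0 t0 tT.
have [KU KU0 HKU] := X_inv.
have Xl0 := (X_neq0 (ltW t0)).2.
have [r [C [r0 C0 HC]]] := primitive (left_in t0 tT) Xl0.
have om0 : 0 < eps / (4 * C + 1) by apply: divr_gt0; lra.
have [d1 d10 H1] := cadlag_left cX t0 r0.
have [d2 d20 H2] := vec_left_close AFV t0 r0.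
have [d3 d30 H3] := phic (ltW t0) (close_const om0 KU0).
have [d4 d40 H4] := cadlag_left invX_cadlag t0 (close_const' (phi (y t)) om0).
pose d := Num.min (Num.min d1 d2) (Num.min d3 d4).
have d0 : 0 < d by rewrite !lt_min d10 d20 d30 d40.
have m1 : d <= d1 by rewrite !ge_min lexx.
have m2 : d <= d2 by rewrite !ge_min lexx orbT.
have m3 : d <= d3 by rewrite !ge_min lexx !orbT.
have m4 : d <= d4 by rewrite !ge_min lexx !orbT.
exists d => // s s0 sd st.
have [|H HH] := HC s t s0 tT.
  move=> x sx xt; have xd := lt_le_trans sd sx.
  by split => [j|] /=; [exact: H2 (ltB_mono m2 xd) xt j|exact: H1 (ltB_mono m1 xd) xt].
have J := sol_jump Pi_part Pi_mesh cX cY cxi cQ Qmono XQ Qjump QM e_null s0 C0 HH st.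
(* N is affine in Y with continuous coefficients, so its left limit is given by
   that of Y, which the jump formula J relates to Y t. *)
have Rleft : (N z / X z) @[z --> t^'-] --> N t / X t.
  have -> : N t / X t = phi (y t) * (left_lim Y t - w (y t)) / left_lim X t.
    rewrite xi_left // in J.
    have Xt := (X_neq0 (ltW t0)).1.
    have YE : Y t = left_lim Y t + (left_lim Y t - w (y t)) / left_lim X t * (X t - left_lim X t).
      by apply/eqP; rewrite -subr_eq0 -J; apply/eqP; ring.
    by rewrite NE ?(ltW t0) // YE; field; rewrite Xl0.
  apply: cvgM; last by apply: cvgV => //; exact: cadlag_left_cvg.
  have -> : phi (y t) * (left_lim Y t - w (y t))
      = V (y t) - phi (y t) * (y t - left_lim Y t).
    by rewrite phiV ?ay ?(ltW t0) //; ring.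
  apply: cvgB; first exact: (path_continuous_left Vc).
  apply: cvgM; first exact: (path_continuous_left phic).
  by apply: cvgB; [exact: path_continuous_left|exact: cadlag_left_cvg].
apply/ler_addgt0Pr => eta eta0.
have [d5 d50 H5] := at_left_eps eta0 Rleft.
have mt : Num.max s (t - d5) < t by rewrite gt_max st gtrBl.
have [z /andP[mz z3]] : exists z, Num.max s (t - d5) < z < t.
  by exists ((Num.max s (t - d5) + t) / 2); rewrite !midf_lt.
move: mz; rewrite gt_max => /andP[/ltW sz z5].
have h1 : `|N z / X z - N t / X t| < eta by exact: H5.
have h2 : `|N z / X z - N s / X s| <= eps * (M z - M s).
  apply: (ratio_step (a1 := phi (y t) * left_lim (fun x => (X x)^-1) t)
     s0 tT C0 eps0 HKU KU0 HH (lexx s) sz z3).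
  move=> x u tx xu uz; apply: (prod_close om0 (ltW KU0)).
  - apply: HKU; first exact: le_trans (le_trans tx xu).
    exact: le_trans uz (le_trans (ltW z3) tT).
  - have xt : x <= t := le_trans (le_trans xu uz) (ltW z3).
    apply/ltW/H3; [exact: le_trans tx|exact: ltB_mono m3 (lt_le_trans sd tx)|].
    exact: le_ltD.
  - apply/ltW/H4; last exact: le_lt_trans uz z3.
    exact: ltB_mono m4 (lt_le_trans sd (le_trans tx xu)).
have h3 : eps * (M z - M s) <= eps * (M t - M s).
  by rewrite ler_pM2l // lerD2r Mmono // ?(ltW z3) //; exact: le_trans sz.
rewrite distrC in h1.
have -> : N t / X t - N s / X s = (N t / X t - N z / X z) + (N z / X z - N s / X s) by ring.
apply: le_trans (ler_normD _ _) _; rewrite addrC; apply: lerD; last exact: ltW.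
exact: le_trans h3.
Qed.

Lemma ratio_le eps : 0 < eps -> `|N T / X T - N 0 / X 0| <= eps * (M T - M 0).
Proof.
move=> eps0.
have chain s t : `|N t / X t - N s / X s| <= eps * (M t - M s) ->
    `|N s / X s - N 0 / X 0| <= eps * (M s - M 0) ->
    `|N t / X t - N 0 / X 0| <= eps * (M t - M 0).
  move=> h1 h2.
  have -> : N t / X t - N 0 / X 0 = (N t / X t - N s / X s) + (N s / X s - N 0 / X 0) by ring.
  have -> : eps * (M t - M 0) = eps * (M t - M s) + eps * (M s - M 0) by ring.
  by apply: le_trans (ler_normD _ _) _; exact: lerD.
apply: (real_induction
  (P := fun t => `|N t / X t - N 0 / X 0| <= eps * (M t - M 0)) (ltW T0)).
- by rewrite !subrr normr0 mulr0.
- move=> t t0 tT Pt; have [d d0 Hd] := ratio_right eps0 t0 tT.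
  by exists d => // s ts sd sT; apply: chain Pt; exact: Hd.
- move=> t t0 tT; have [d d0 Hd] := ratio_left eps0 t0 tT.
  by exists d => // s s0 sd st; apply: chain; exact: Hd.
Qed.

End Ratio.

(** The ratio M^V(Y) / X is constant, and equals 1 at time 0. *)
Lemma solution_inverse t : 0 <= t -> X t = N t.
Proof.
move=> t0.
have R0 : N 0 / X 0 = 1.
  rewrite NE // y0 solution_start -phiV // -X0 divff //.
  by case: (X_neq0 (lexx 0)).
suff R1 : N t / X t = 1.
  by apply/esym; rewrite -[X t]mul1r -R1 divfK //; case: (X_neq0 t0).
move: t0; rewrite le_eqVlt => /orP[/eqP <-//|t0].
case: QX => _ [Q [cQ Qmono XQ Qjump]].
case: solY => -[_ adm] _ _.
have [m [D [f [A [fC AFV Yf ADc]]]]] := adm t t0.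
have [Lw Lw0 HLw] := C1_from_loc_lip w_C1 (y t).
apply/eqP; rewrite -subr_eq0 -normr_le0 -{1}R0.
pose M t := Q t + (vec_variation A t + Lw * y t).
apply/ler_addgt0Pr => eps eps0; rewrite add0r.
have Mt : 0 <= M t - M 0.
  rewrite subr_ge0; apply: lerD; first by apply: Qmono => //; exact: ltW.
  apply: lerD; first by apply: vec_variation_mono => //; exact: ltW.
  by apply: ler_wpM2l => //; apply: ymono => //; exact: ltW.
have e1 : 0 < eps / (M t - M 0 + 1) by apply: divr_gt0; lra.
apply: le_trans (ratio_le cQ Qmono XQ Qjump t0 fC AFV Yf ADc Lw0 HLw e1) _.
by rewrite -/(M t) -/(M 0) mulrAC ler_pdivrMr ?ler_pM2l //; lra.
Qed.

End SolutionInverse.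

(** * The correspondence between X and Y *)

Section Transforms.
Context {R : realType}.

Lemma path_continuous_ext (y z : R -> R) : (forall t, 0 <= t -> y t = z t) ->
  path_continuous y -> path_continuous z.
Proof.
move=> yz yc t eps t0 eps0; have [d d0 Hd] := yc t eps t0 eps0.
by exists d => // s s0 ts st; rewrite -!yz //; exact: Hd.
Qed.

Lemma QV_ext (Pi : nat -> nat -> R) (X Z : R -> R) :
  (forall n, is_partition (Pi n)) -> (forall t, 0 <= t -> X t = Z t) ->
  QV Pi X -> QV Pi Z.
Proof.
move=> Pi_part XZ [cX [Q [cQ Qm XQ Qj]]]; split; first exact: cadlag_ext cX.
exists Q; split => // t t0.
  have <- : (fun n => qv_sum (Pi n) X t) = (fun n => qv_sum (Pi n) Z t); last exact: XQ.
  apply/funext => n; rewrite !qv_sumE; apply: eq_partition_sum => // [x|x|x z x0 xz _].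
  - by rewrite subrr expr0n.
  - by rewrite subrr expr0n.
  - by rewrite !XZ // (le_trans x0).
by rewrite Qj // /jump XZ // (left_lim_ext cX XZ).
Qed.

Section Correspondence.
Variables (Pi : nat -> nat -> R).
Hypotheses (Pi_part : forall n, is_partition (Pi n))
  (Pi_mesh : mesh (Pi n) @[n --> \oo] --> 0%E).
Variables (astar : R) (w V phi : R -> R).
Hypotheses (w_C1 : C1_from astar w) (VS : C1_slope astar V phi)
  (phiV : forall y, astar <= y -> V y = phi y * (y - w y)).
Let a := V astar.

Let phi_lip : loc_lip astar phi. Proof. by case: VS. Qed.
Let phi_gt0 y : astar <= y -> 0 < phi y. Proof. by case: VS => _ + _; apply. Qed.

Section FromX.
Variables X U : R -> R.
Hypotheses (QX : QV Pi X) (X0 : X 0 = a)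
  (Xpos : forall t, 0 <= t -> 0 < Num.min (X t) (left_lim X t))
  (Xmc : continuous_running_max X)
  (UV : forall y, astar <= y -> U (V y) = y)
  (domU : forall t, 0 <= t -> exists2 y, astar <= y & V y = running_max X t).
Let y t := U (running_max X t).

Let cX : cadlag X. Proof. by case: QX. Qed.
Let Xmc' : path_continuous (running_max X). Proof. exact/path_continuousP. Qed.

Let ay t : 0 <= t -> astar <= y t.
Proof. by move=> /domU[z az Vz]; rewrite /y -Vz UV. Qed.

Let Vy t : 0 <= t -> V (y t) = running_max X t.
Proof. by move=> /domU[z az Vz]; rewrite /y -Vz UV. Qed.

Let X_gt0 t : 0 <= t -> 0 < X t /\ 0 < left_lim X t.
Proof. by move=> /Xpos; rewrite lt_min => /andP. Qed.

Let X_neq0 t : 0 <= t -> X t != 0 /\ left_lim X t != 0.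
Proof. by move=> /X_gt0[h1 h2]; rewrite !gt_eqF. Qed.

Let azema_yorE t : 0 <= t ->
  azema_yor a U X t = ay_path X y (fun t => (phi (y t))^-1) t.
Proof.
move=> t0; rewrite /azema_yor /ay_path -/(y t) -[in derive_from _ _ _]Vy //.
by rewrite (derive_from_slope_inv VS UV (ay t0)).
Qed.

Let mY t : 0 <= t -> running_max (azema_yor a U X) t = y t.
Proof.
exact: (running_max_ay_inv VS cX ay Vy azema_yorE).
Qed.

Let yc : path_continuous y.
Proof. exact: (inverse_max_continuous VS cX Xmc' ay Vy). Qed.

Let azema_yor_affine t : 0 <= t ->
  (phi (y t))^-1 * X t + w (y t) = azema_yor a U X t.
Proof.
move=> t0; rewrite azema_yorE // /ay_path -Vy // phiV ?ay //.
by field; rewrite gt_eqF // phi_gt0 // ay.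
Qed.

Lemma azema_yor_sol : [/\ is_solution Pi astar w X (azema_yor a U X),
  drawdown w (azema_yor a U X) & continuous_running_max (azema_yor a U X)].
Proof.
split.
- exact: (ay_is_solution w_C1 VS phiV cX Xmc' ay Vy Pi_part Pi_mesh X0 X_neq0 azema_yorE).
- move=> t t0; rewrite mY //; have g0 : 0 < (phi (y t))^-1.
    by rewrite invr_gt0 phi_gt0 // ay.
  have [h1 h2] := X_gt0 t0.
  have gc : path_continuous (fun t => (phi (y t))^-1).
    apply: (loc_lip_path_continuous (h := fun y => (phi y)^-1) _ ay yc).
    exact: loc_lipV.
  have wc : path_continuous (fun t => w (y t)).
    exact: (loc_lip_path_continuous (C1_from_loc_lip w_C1) ay yc).
  have cA : cadlag (fun t => (phi (y t))^-1 * X t + w (y t)).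
    apply: cadlagD; last exact: path_continuous_cadlag.
    by apply: cadlagM => //; exact: path_continuous_cadlag.
  rewrite -(left_lim_ext cA azema_yor_affine t0) left_lim_affine //.
  by rewrite -azema_yor_affine // lt_min !ltrDr !mulr_gt0.
- apply/path_continuousP; apply: path_continuous_ext yc => t t0.
  by rewrite mY.
Qed.

(** As X = M^V(Y), the maximum of X is V(max Y), so max Y = U(max X) and the
    affine map M^V can be solved for Y. *)
Lemma azema_yor_unique Y : is_solution Pi astar w X Y ->
  continuous_running_max Y -> forall t, 0 <= t -> Y t = azema_yor a U X t.
Proof.
move=> solY /path_continuousP Ymc t t0.
have XN := solution_inverse w_C1 VS phiV Pi_part Pi_mesh QX X0 solY Ymc.
have cY : cadlag Y by case: solY => -[].
have Y0 := solution_start Pi_part solY.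
have aY s : 0 <= s -> astar <= running_max Y s.
  by move=> s0; rewrite -Y0; exact: running_max_ge.
have mX : running_max X t = V (running_max Y t).
  rewrite (running_max_ext _ XN).
  apply: (running_max_ay cY (ay_data_V VS cY aY)) => //.
    by move=> s s0; apply/ltW/phi_gt0/aY.
  move=> r s r0 rs; apply: (slope_le VS); first exact: aY.
  exact: running_max_mono.
rewrite azema_yorE // /ay_path /y mX UV ?aY // (XN t) // /ay_path.
by field; rewrite gt_eqF // phi_gt0 // aY.
Qed.

End FromX.

Section FromY.
Variable Y : R -> R.
Hypotheses (QY : QV Pi Y) (Ydd : drawdown w Y) (Y0 : Y 0 = astar)
  (Ymc : continuous_running_max Y).
Let y := running_max Y.

Let cY : cadlag Y. Proof. by case: QY. Qed.
Let yc : path_continuous y. Proof. exact/path_continuousP. Qed.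

Let ay t : 0 <= t -> astar <= y t.
Proof. by move=> t0; rewrite -Y0; exact: running_max_ge. Qed.

Let azema_yorE t : 0 <= t ->
  azema_yor astar V Y t = ay_path Y (fun t => V (y t)) (fun t => phi (y t)) t.
Proof.
move=> t0; rewrite /azema_yor /ay_path -/(y t).
by rewrite (derive_from_slope VS (ay t0)).
Qed.

Let azema_yor_affine t : 0 <= t ->
  phi (y t) * Y t + (V (y t) - phi (y t) * y t) = azema_yor astar V Y t.
Proof. by move=> t0; rewrite azema_yorE // /ay_path -/(y t); ring. Qed.

Let d_lip : loc_lip astar (fun y => V y - phi y * y).
Proof.
apply: loc_lipB; first exact: slope_loc_lip VS.
by apply: loc_lipM => //; exact: loc_lip_id.
Qed.

Let phic : path_continuous (fun t => phi (y t)).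
Proof. exact: (loc_lip_path_continuous phi_lip). Qed.

Let dc : path_continuous (fun t => V (y t) - phi (y t) * y t).
Proof. exact: (loc_lip_path_continuous d_lip). Qed.

Let QA : QV Pi (fun t => phi (y t) * Y t + (V (y t) - phi (y t) * y t)).
Proof.
apply: (QV_affine Pi_part Pi_mesh QY phic dc yc) => [s t s0 st|T T0].
  exact: running_max_mono.
have [L L0 HL] := phi_lip (y T); have [L' L'0 HL'] := d_lip (y T).
exists (L + L') => [|s t s0 st tT]; first exact: addr_ge0.
have t0 := le_trans s0 st.
have yst : y s <= y t by exact: running_max_mono.
have ytT : y t <= y T by exact: running_max_mono.
split.
  apply: le_trans (HL _ _ (ay s0) yst ytT) _.
  by apply: ler_wpM2r; rewrite ?subr_ge0 // lerDl.
apply: le_trans (HL' _ _ (ay s0) yst ytT) _.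
by apply: ler_wpM2r; rewrite ?subr_ge0 // lerDr.
Qed.

Let QX : QV Pi (azema_yor astar V Y).
Proof. exact: QV_ext QA. Qed.

Let mX t : 0 <= t -> V (y t) = running_max (azema_yor astar V Y) t.
Proof.
move=> t0; rewrite (running_max_ext _ azema_yorE).
apply/esym; apply: (running_max_ay cY (ay_data_V VS cY ay)) => //.
  by move=> s s0; apply/ltW/phi_gt0/ay.
move=> r s r0 rs; apply: (slope_le VS); first exact: ay.
exact: running_max_mono.
Qed.

Let X0 : azema_yor astar V Y 0 = a.
Proof.
by rewrite azema_yorE // /ay_path /y running_max0 // subrr mulr0 subr0 Y0.
Qed.

Let X_neq0 t : 0 <= t ->
  azema_yor astar V Y t != 0 /\ left_lim (azema_yor astar V Y) t != 0.
Proof.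
move=> t0; have := Ydd t0; rewrite lt_min -/(y t) => /andP[h1 h2].
have p0 := phi_gt0 (ay t0).
have [cA _] := QA.
rewrite -(left_lim_ext cA azema_yor_affine t0) left_lim_affine //.
rewrite -azema_yor_affine // phiV ?ay //.
have E z : phi (y t) * z + (phi (y t) * (y t - w (y t)) - phi (y t) * y t)
  = phi (y t) * (z - w (y t)) by ring.
by rewrite !E !gt_eqF // mulr_gt0 // subr_gt0.
Qed.

Lemma azema_yor_inverse_sol :
  [/\ QV Pi (azema_yor astar V Y), continuous_running_max (azema_yor astar V Y),
      azema_yor astar V Y 0 = a & is_solution Pi astar w (azema_yor astar V Y) Y].
Proof.
have mXc : path_continuous (running_max (azema_yor astar V Y)).
  apply: (path_continuous_ext mX).
  exact: (loc_lip_path_continuous (slope_loc_lip VS)).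
split => //; first exact/path_continuousP.
have cX : cadlag (azema_yor astar V Y) by case: QX.
apply: (ay_is_solution w_C1 VS phiV cX mXc ay mX Pi_part Pi_mesh X0 X_neq0) => t t0.
rewrite /ay_path -mX // azema_yorE // /ay_path -/(y t).
by field; rewrite gt_eqF // phi_gt0 // ay.
Qed.

Lemma azema_yor_inverse_unique X : QV Pi X -> X 0 = a ->
  is_solution Pi astar w X Y -> forall t, 0 <= t -> X t = azema_yor astar V Y t.
Proof.
move=> QX' X0' solY t t0; rewrite azema_yorE //.
exact: (solution_inverse w_C1 VS phiV Pi_part Pi_mesh QX' X0' solY yc t0).
Qed.

End FromY.
End Correspondence.
End Transforms.

Theorem proposition3p13 (R : realType) (Pi : nat -> nat -> R)
    (Pi_partition : forall n, is_partition (Pi n))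
    (Pi_mesh : mesh (Pi n) @[n --> \oo] --> 0%E)
    (a astar : R) (w : R -> R)
    (w_C1 : C1_from astar w)
    (w_lt : forall y, astar <= y -> 0 < y - w y) :
  let V := V_of a astar w in
  (forall X U : R -> R,
     QV Pi X ->
     X 0 = a ->
     (forall t, 0 <= t -> 0 < Num.min (X t) (left_lim X t)) ->
     continuous_running_max X ->
     (* U is the inverse of V, and the running maximum of X stays in the
        domain V([astar, +oo[) of U, so that M^U(X) is defined *)
     (forall y, astar <= y -> U (V y) = y) ->
     (forall t, 0 <= t -> exists2 y, astar <= y & V y = running_max X t) ->
     let sol Y := [/\ is_solution Pi astar w X Y, drawdown w Y
                    & continuous_running_max Y] in
     sol (azema_yor a U X) /\
     forall Y, sol Y -> forall t, 0 <= t -> Y t = azema_yor a U X t)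
  /\
  (forall Y : R -> R,
     0 < a ->
     QV Pi Y ->
     drawdown w Y ->
     Y 0 = astar ->
     continuous_running_max Y ->
     let sol X := [/\ QV Pi X, continuous_running_max X, X 0 = a
                    & is_solution Pi astar w X Y] in
     sol (azema_yor astar V Y) /\
     forall X, sol X -> forall t, 0 <= t -> X t = azema_yor astar V Y t).
Proof.
move=> V; have Va : V astar = a by exact: V_of_start.
have phiV y : astar <= y -> V y = V y / (y - w y) * (y - w y).
  by move=> ay; rewrite divfK // gt_eqF // w_lt.
split.
- move=> X U QX X0 Xpos Xmc UV domU sol.
  have a0 : 0 < a by have := Xpos 0 (lexx _); rewrite lt_min X0 => /andP[].
  have VS := V_of_slope a0 w_C1 w_lt; rewrite -Va in X0 *.
  split; first exact: (azema_yor_sol Pi_partition Pi_mesh w_C1 VS phiV).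
  move=> Y [solY _ Ymc] t t0.
  exact: (azema_yor_unique Pi_partition Pi_mesh w_C1 VS phiV).
- move=> Y a0 QY Ydd Y0 Ymc sol.
  have VS := V_of_slope a0 w_C1 w_lt; rewrite /sol -Va.
  split; first exact: (azema_yor_inverse_sol Pi_partition Pi_mesh w_C1 VS phiV).
  move=> X [QX _ X0 solY] t t0.
  exact: (azema_yor_inverse_unique Pi_partition Pi_mesh w_C1 VS phiV).
Qed.
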